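(* Let $A$ be a unital operator algebra and let $\mathcal{F}=A*_{\Delta(A)}A^{\#}$. For $x\in\mathcal{F}$ define $$\gamma(x)=\inf\left\{t\in\mathbb{R}^+:\begin{bmatrix} t & x\\ x^{\#} & t\end{bmatrix}\geq 0\right\}.$$ Then the function $\gamma$ is a $C^*$-seminorm on $\mathcal{F}$, and $\mathcal{F}/\ker\gamma$ is isomorphic to $C^*_m(A)$.
   Context: An operator algebra is a norm closed subalgebra of some $B(H)$, with its inherited matrix norms. Let $A\subseteq B(H)$ be a unital operator algebra (containing $I_H$). $A^{\#}$ is the canonically associated adjoint algebra, $A^{\#}=\{a^*:a\in A\}$ regarded as an operator algebra, with $a\mapsto a^{\#}$ the conjugate-linear, product-reversing bijection $A\to A^{\#}$. The diagonal is $\Delta(A)=A\cap A^*$ (independent of the chosen representation), regarded as a common subalgebra of $A$ and $A^{\#}$. $\mathcal{F}=\mathcal{F}(A)=A*_{\Delta(A)}A^{\#}$ is the operator algebraic free product amalgamated over $\Delta(A)$ (Blecher–Paulsen): the completion of the algebraic free product of $A$ and $A^{\#}$ amalgamated over $\Delta(A)$ in the norm $\|x\|_{OA}=\inf\{\|x_1\|\|x_2\|\cdots\|x_n\|:x=x_1*x_2*\cdots*x_n\}$, where each $x_i$ is a matrix of suitable size with entries all in $A$ or all in $A^{\#}$, and $*$ is the free product matrix multiplication (matrix norms are defined analogously). It is an operator algebra with the universal property that completely contractive homomorphisms of $A$ and of $A^{\#}$ into an operator algebra $X$ which agree on $\Delta(A)$ extend to a completely contractive homomorphism $\mathcal{F}\to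 X$. The formal adjoint $\#$ extends to a conjugate-linear, product-reversing involution on $\mathcal{F}$ exchanging $A$ and $A^{\#}$; on matrices, $[y_{ij}]^{\#}=[y_{ji}^{\#}]$. For $y\in M_n(\mathcal{F})$ we write $y\geq 0$ if $y=\sum_{i=1}^m y_i^{\#}y_i$ for some finite collection $y_i\in M_{k_i,n}(\mathcal{F})$, $k_i$ positive integers. A scalar $t$ denotes $t1$; $\mathbb{R}^+$ is the set of positive reals. A $C^*$-seminorm on a $*$-algebra is a submultiplicative seminorm $\gamma$ with $\gamma(x^{\#}x)=\gamma(x)^2$ for all $x$; $\ker\gamma=\{x\in\mathcal{F}:\gamma(x)=0\}$. $C^*_m(A)$ is the maximal $C^*$-algebra of $A$: the $C^*$-algebra generated by a completely isometric copy of $A$ such that every completely contractive homomorphism of $A$ into a $C^*$-algebra $B$ extends to a $*$-homomorphism $C^*_m(A)\to B$.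
   Formalization: The formal theorem identifies the completion of F/ker γ in the norm induced by γ with C*_m(A); the uncompleted quotient need not be a C*-algebra (for the disc algebra, z+z^# has a character value −2i). The zero algebra is excluded. *)

(* Defs.v *)
From HB Require Import structures.
From mathcomp Require Import all_boot all_order all_algebra.
From mathcomp Require Import all_classical all_reals all_analysis.
From mathcomp Require Import complex.

Set Implicit Arguments.
Unset Strict Implicit.
Unset Printing Implicit Defensive.

Import Order.TTheory GRing.Theory Num.Theory.
Import numFieldNormedType.Exports.

Local Open Scope classical_set_scope.
Local Open Scope ring_scope.
Local Open Scope complex_scope.

(* Inner products are linear in the first variable.  The norm of a normed
   module over R[i] takes its values in R[i]. *)
HB.mixin Record isHilbert (R : realType) H of CompleteNormedModule R[i] H := {
  dot : H -> H -> R[i] ;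
  dotDl : forall x y z : H, dot (x + y) z = dot x z + dot y z ;
  dotZl : forall (c : R[i]) (x y : H), dot (c *: x) y = c * dot x y ;
  dotC : forall x y : H, dot y x = (dot x y)^* ;
  dot_norm : forall x : H, dot x x = `|x| ^+ 2
}.

#[short(type="hilbertType")]
HB.structure Definition Hilbert (R : realType) :=
  {H of CompleteNormedModule R[i] H & isHilbert R H}.

(* Operators are plain functions H -> H; sums and scalar multiples are the
   pointwise ones, products are compositions. *)
Section Operators.
Context {R : realType} {H : hilbertType R}.
Implicit Types (S T : H -> H) (A : set (H -> H)).

Definition bounded_operator T : Prop :=
  linear T /\ exists M : R, forall x : H, `|T x| <= M%:C * `|x|.

(* A bounded operator has exactly one adjoint (Riesz), so xget selects it; the
   default value is only used outside B(H). *)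
Definition adjoint T : H -> H :=
  xget (idfun : H -> H) [set S : H -> H | forall x y : H, dot (T x) y = dot x (S y)].

(* Operator norm of a matrix acting from the Hilbert sum H^n to H^m. *)
Definition opnorm_bounds m n (a : 'M[H -> H]_(m, n)) : set R :=
  [set c : R | 0 <= c /\ forall xi : 'I_n -> H,
     \sum_(i < m) `|\sum_(j < n) (a i j) (xi j)| ^+ 2
       <= c%:C ^+ 2 * \sum_(j < n) `|xi j| ^+ 2].

Definition mx_opnorm m n (a : 'M[H -> H]_(m, n)) : R := inf (opnorm_bounds a).

Definition opnorm T : R := mx_opnorm (const_mx T : 'M[H -> H]_1).

Record operator_algebra A : Prop := {
  opalg_bounded : A `<=` bounded_operator ;
  opalg0 : A (fun=> 0) ;
  opalgD : forall S T, A S -> A T -> A (S + T) ;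
  opalgZ : forall (c : R[i]) T, A T -> A (c *: T) ;
  opalgM : forall S T, A S -> A T -> A (S \o T) ;
  opalg_closed : forall T, bounded_operator T ->
    (forall e : R, 0 < e -> exists2 S, A S & opnorm (T - S) < e) -> A T
}.

Definition unital_operator_algebra A : Prop :=
  operator_algebra A /\ A idfun.

Definition cstar_algebra A : Prop :=
  operator_algebra A /\ (forall T, A T -> A (adjoint T)).

Definition adjoint_algebra A : set (H -> H) := adjoint @` A.

Definition diagonal A : set (H -> H) := A `&` adjoint_algebra A.

End Operators.

(* Only the values on A of a map out of A are relevant; homomorphisms between
   operator algebras are not assumed to preserve units. *)
Section OperatorHomomorphisms.
Context {R : realType} {H K : hilbertType R}.
Variables (A : set (H -> H)) (f : (H -> H) -> (K -> K)).

Record operator_hom : Prop := {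
  ophomD : forall S T, A S -> A T -> f (S + T) = f S + f T ;
  ophomZ : forall (c : R[i]) T, A T -> f (c *: T) = c *: f T ;
  ophomM : forall S T, A S -> A T -> f (S \o T) = f S \o f T
}.

Definition completely_contractive : Prop :=
  forall n (a : 'M[H -> H]_n), (forall i j, A (a i j)) ->
    mx_opnorm (map_mx f a) <= mx_opnorm a.

Definition completely_isometric : Prop :=
  forall n (a : 'M[H -> H]_n), (forall i j, A (a i j)) ->
    mx_opnorm (map_mx f a) = mx_opnorm a.

Definition operator_star_hom : Prop :=
  operator_hom /\ forall T, A T -> f (adjoint T) = adjoint (f T).

End OperatorHomomorphisms.

Record is_maximal_cstar (R : realType) (H L : hilbertType R)
    (A : set (H -> H)) (C : set (L -> L)) (j : (H -> H) -> (L -> L)) : Prop := {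
  cmax_cstar : cstar_algebra C ;
  cmax_in : forall a, A a -> C (j a) ;
  cmax_hom : operator_hom A j ;
  cmax_isometric : completely_isometric A j ;
  cmax_generated : forall D : set (L -> L), cstar_algebra D ->
    (forall a, A a -> D (j a)) -> C `<=` D ;
  cmax_universal : forall (K : hilbertType R) (B : set (K -> K))
      (theta : (H -> H) -> (K -> K)),
    cstar_algebra B -> (forall a, A a -> B (theta a)) ->
    operator_hom A theta -> completely_contractive A theta ->
    exists pi : (L -> L) -> (K -> K),
      [/\ operator_star_hom C pi, (forall T, C T -> B (pi T)) &
          forall a, A a -> pi (j a) = theta a]
}.

Section FreeProduct.
Context {R : realType} {H : hilbertType R}.
Implicit Types (A : set (H -> H)).

Record unital_hom A (X : algType R[i]) (f : (H -> H) -> X) : Prop := {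
  uhom1 : f idfun = 1 ;
  uhomD : forall S T, A S -> A T -> f (S + T) = f S + f T ;
  uhomZ : forall (c : R[i]) T, A T -> f (c *: T) = c *: f T ;
  uhomM : forall S T, A S -> A T -> f (S \o T) = f S * f T
}.

(* The algebraic free product of A and A^# amalgamated over the diagonal, i.e.
   the pushout of the two inclusions of the diagonal among unital complex
   algebras. *)
Record is_algebraic_free_product A (P : algType R[i])
    (iA iA' : (H -> H) -> P) : Prop := {
  afp_homl : unital_hom A iA ;
  afp_homr : unital_hom (adjoint_algebra A) iA' ;
  afp_agree : forall d, diagonal A d -> iA d = iA' d ;
  afp_universal : forall (X : algType R[i]) (f g : (H -> H) -> X),
    unital_hom A f -> unital_hom (adjoint_algebra A) g ->
    (forall d, diagonal A d -> f d = g d) ->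
    let extends (h : {lrmorphism P -> X}) :=
      (forall a, A a -> h (iA a) = f a) /\
      (forall b, adjoint_algebra A b -> h (iA' b) = g b) in
    exists2 h, extends h & forall h', extends h' -> h' =1 h
}.

(* oa_factorization x c: x is a product x_1 * ... * x_r of rectangular matrices,
   each with all its entries in A or all its entries in A^#, and c is the
   product of the norms of the x_i. *)
Inductive oa_factorization A (P : algType R[i]) (iA iA' : (H -> H) -> P) :
    forall m n, 'M[P]_(m, n) -> R -> Prop :=
| OAleft m n (a : 'M[H -> H]_(m, n)) : (forall i j, A (a i j)) ->
    oa_factorization A iA iA' (map_mx iA a) (mx_opnorm a)
| OAright m n (b : 'M[H -> H]_(m, n)) :
    (forall i j, adjoint_algebra A (b i j)) ->
    oa_factorization A iA iA' (map_mx iA' b) (mx_opnorm b)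
| OAmul m n p (x : 'M[P]_(m, n)) (y : 'M[P]_(n, p)) (c d : R) :
    oa_factorization A iA iA' x c -> oa_factorization A iA iA' y d ->
    oa_factorization A iA iA' (x *m y) (c * d).

Definition oa_norm A (P : algType R[i]) (iA iA' : (H -> H) -> P) m n
    (x : 'M[P]_(m, n)) : R :=
  inf [set c : R | oa_factorization A iA iA' x c].

Record complete_algebra_norm (F : algType R[i]) (N : F -> R) : Prop := {
  can_eq0 : forall x, N x = 0 -> x = 0 ;
  canD : forall x y, N (x + y) <= N x + N y ;
  canZ : forall (c : R[i]) x, (N (c *: x))%:C = `|c| * (N x)%:C ;
  canM : forall x y, N (x * y) <= N x * N y ;
  can_complete : forall u : nat -> F,
    (forall e : R, 0 < e -> exists n0 : nat, forall m n : nat,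
       (n0 <= m)%N -> (n0 <= n)%N -> N (u m - u n) < e) ->
    exists l : F, forall e : R, 0 < e -> exists n0 : nat, forall n : nat,
       (n0 <= n)%N -> N (u n - l) < e
}.

Record isometric_involution (F : algType R[i]) (N : F -> R) (s : F -> F) :
    Prop := {
  invK : forall x, s (s x) = x ;
  invD : forall x y, s (x + y) = s x + s y ;
  invZ : forall (c : R[i]) x, s (c *: x) = (c^* )%C *: s x ;
  invM : forall x y, s (x * y) = s y * s x ;
  inv_norm : forall x, N (s x) = N x
}.

(* (F, N) is the completion of the algebraic free product in the norm oa_norm,
   jA and jA' are the canonical maps of A and A^# into F, and s is the
   continuous extension to F of the formal adjoint #.  As the range of k is
   generated by those of jA and jA', s is determined by ofp_star. *)
Record is_oa_free_product A (F : algType R[i]) (N : F -> R) (s : F -> F)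
    (jA jA' : (H -> H) -> F) : Prop := {
  ofp_norm : complete_algebra_norm N ;
  ofp_completion : exists (P : algType R[i]) (iA iA' : (H -> H) -> P)
      (k : {lrmorphism P -> F}),
    [/\ is_algebraic_free_product A iA iA',
        (forall a, A a -> jA a = k (iA a)) /\
          (forall b, adjoint_algebra A b -> jA' b = k (iA' b)),
        forall p : P, N (k p) = oa_norm A iA iA' (const_mx p : 'M[P]_1) &
        forall (x : F) (e : R), 0 < e -> exists p : P, N (x - k p) < e] ;
  ofp_involution : isometric_involution N s ;
  ofp_star : forall a, A a -> s (jA a) = jA' (adjoint a)
}.

End FreeProduct.

Section Positivity.
Context {R : realType} {F : algType R[i]}.
Variable s : F -> F.

Definition mx_star m n (y : 'M[F]_(m, n)) : 'M[F]_(n, m) := (map_mx s y)^T.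

Definition mx_positive n (y : 'M[F]_n) : Prop :=
  exists (m : nat) (k : 'I_m -> nat) (z : forall i, 'M[F]_(k i, n)),
    (forall i, (0 < k i)%N) /\ y = \sum_(i < m) mx_star (z i) *m z i.

Definition gamma_bounds (x : F) : set R :=
  [set t : R | 0 < t /\
     mx_positive (block_mx ((t%:C)%:A)%:M x%:M (s x)%:M ((t%:C)%:A)%:M
                    : 'M[F]_(1 + 1))].

Definition gamma (x : F) : R := inf (gamma_bounds x).

Record cstar_seminorm (g : F -> R) : Prop := {
  csn_ge0 : forall x, 0 <= g x ;
  csnD : forall x y, g (x + y) <= g x + g y ;
  csnZ : forall (c : R[i]) x, (g (c *: x))%:C = `|c| * (g x)%:C ;
  csnM : forall x y, g (x * y) <= g x * g y ;
  csn_star : forall x, g (s x * x) = g x ^+ 2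
}.

(* A *-homomorphism rho of F into C with opnorm (rho x) = g x has kernel
   {x | g x = 0}, so it is the same thing as an isometric *-homomorphism into C
   of F / ker g with the C*-norm induced by g.  F / ker g need not be complete
   for this norm: the C*-algebra it denotes is its completion, and an isometric
   rho with dense range is an isomorphism of that completion onto C. *)
Record induces_cstar_iso (g : F -> R) (L : hilbertType R) (C : set (L -> L))
    (rho : F -> (L -> L)) : Prop := {
  ici_in : forall x, C (rho x) ;
  iciD : forall x y, rho (x + y) = rho x + rho y ;
  iciZ : forall (c : R[i]) x, rho (c *: x) = c *: rho x ;
  iciM : forall x y, rho (x * y) = rho x \o rho y ;
  ici_star : forall x, rho (s x) = adjoint (rho x) ;
  ici_norm : forall x, opnorm (rho x) = g x ;
  ici_dense : forall T, C T -> forall e : R, 0 < e ->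
    exists x : F, opnorm (T - rho x) < e
}.

End Positivity.

(* Main.v *)
(** Write x >= 0 for sums of squares.  For t > 0, the block [t x; x# t] is positive iff
    t^2 - x# x >= 0 in F: compress by the column (-x, t) in one direction, and split off the
    square of the row (t, x) in the other.  Every C*-seminorm property of gamma then is an
    identity between sums of squares.  In a Banach *-algebra 1 - h is a square when h = h# has
    norm < 1, hence gamma is finite and bounded by the norm of F.

    The inclusion j of A in C*_m(A) preserves adjoints on the diagonal, because it is a unital
    contraction there, so j and its adjoint extend to a contractive *-representation rho of F,
    and t^2 - x# x >= 0 yields |rho x| <= gamma x.  Conversely, if gamma x > 0, a maximal cone
    containing the sums of squares and x# x - gamma(x)^2 defines a state, whose GNS
    representation pi satisfies |pi x| >= gamma x.  The restriction of pi to A is completely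
    contractive: for a matrix a over A, the entries of (a# a)^m have norm at most |a|^(2m) by the
    definition of the free product norm, and iterating the Cauchy-Schwarz inequality gives
    |pi a| <= |a|.  By maximality of C*_m(A), pi factors through rho, so gamma x <= |rho x|. *)

Require Import Defs.
From HB Require Import structures.
From mathcomp Require Import all_boot all_order all_algebra.
From mathcomp Require Import all_classical all_reals all_analysis.
From mathcomp Require Import complex.
From mathcomp Require Import ring lra.

Set Implicit Arguments.
Unset Strict Implicit.
Unset Printing Implicit Defensive.

Import Order.TTheory GRing.Theory Num.Theory.
Import numFieldNormedType.Exports.

Local Open Scope classical_set_scope.
Local Open Scope ring_scope.
Local Open Scope complex_scope.

(** Three obstacles shape the development. Homomorphisms need not preserve units, so [j idfun] is
    only an idempotent contraction on [L]; it is shown to be a selfadjoint projection and a unit of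
    [C], and [C] with this unit is the algebra to which the universal property of the algebraic free
    product is applied. Next, only the norm of single elements of [F] is recorded, not its matrix
    norms; complete contractivity on [A] is therefore extracted from matrix factorizations entry by
    entry, and the constants depending on the matrix size disappear under repeated squaring.
    Finally, [F] is reached from the algebraic free product only through a map [k] with dense range,
    so identities are proved on generators, propagated by induction, and then passed to limits. The
    maximal cone does the work of a separation theorem: finiteness of [gamma] makes 1 an order unit,
    a cone maximal among those avoiding -1 contains [x] or [- x] for every [x], and this turns each
    [x] into a Dedekind cut, whose value is the state at [x]. *)

Section RealNorm.
Context {R : realType}.

(** The norm as a real number, so that order reasoning takes place in [R], where [lra] and [nra]
    apply; the order of [R[i]] is only partial. *)
Definition nrm (V : normedZmodType R[i]) (x : V) : R := complex.Re `|x|.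

Lemma normE (V : normedZmodType R[i]) (x : V) : `|x| = (nrm x)%:C.
Proof. by rewrite /nrm RRe_real// normr_real. Qed.

Lemma nrm_ge0 (V : normedZmodType R[i]) (x : V) : 0 <= nrm x.
Proof. by rewrite -lecR -normE normr_ge0. Qed.

Lemma nrm0 (V : normedZmodType R[i]) : nrm (0 : V) = 0.
Proof. by rewrite /nrm normr0. Qed.

Lemma nrm_eq0 (V : normedZmodType R[i]) (x : V) : nrm x = 0 -> x = 0.
Proof. by move=> h; apply/eqP; rewrite -normr_eq0 normE h. Qed.

Lemma nrmN (V : normedZmodType R[i]) (x : V) : nrm (- x) = nrm x.
Proof. by rewrite /nrm normrN. Qed.

Lemma nrmD (V : normedZmodType R[i]) (x y : V) : nrm (x + y) <= nrm x + nrm y.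
Proof. by rewrite -lecR rmorphD /= -!normE ler_normD. Qed.

Lemma nrmB (V : normedZmodType R[i]) (x y : V) : nrm (x - y) = nrm (y - x).
Proof. by rewrite /nrm distrC. Qed.

Lemma nrm_sum (V : normedZmodType R[i]) I (r : seq I) (P : pred I) (f : I -> V) :
  nrm (\sum_(i <- r | P i) f i) <= \sum_(i <- r | P i) nrm (f i).
Proof.
apply: (big_ind2 (fun x y => nrm x <= y)) => //; first by rewrite nrm0.
by move=> x1 x2 y1 y2 h1 h2; apply: (le_trans (nrmD _ _)); exact: lerD.
Qed.

Lemma nrmZ (V : normedModType R[i]) (c : R[i]) (x : V) :
  nrm (c *: x) = nrm c * nrm x.
Proof.
by apply: (@complexI R); rewrite rmorphM /= -!normE normrZ.
Qed.

Lemma nrmcM (c d : R[i]) : nrm (c * d) = nrm c * nrm d.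
Proof. by apply: (@complexI R); rewrite rmorphM /= -!normE normrM. Qed.

Lemma nrmc_real (r : R) : nrm r%:C = `|r|.
Proof. by rewrite /nrm normc_def /= expr0n /= addr0 sqrtr_sqr. Qed.

Lemma nrmc_sqr (c : R[i]) : nrm c ^+ 2 = complex.Re c ^+ 2 + complex.Im c ^+ 2.
Proof.
apply: (@complexI R); rewrite add_Re2_Im2 normE.
by rewrite rmorphXn.
Qed.

Lemma nrmcJ (c : R[i]) : nrm (conjc c) = nrm c.
Proof. by rewrite /nrm normcJ. Qed.

Lemma mulcJ (c : R[i]) : c * conjc c = (nrm c ^+ 2)%:C.
Proof. by rewrite -sqr_normc normE rmorphXn. Qed.

Lemma conjcM (c d : R[i]) : conjc (c * d) = conjc c * conjc d.
Proof. exact: rmorphM. Qed.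

Lemma conjcN (c : R[i]) : conjc (- c) = - conjc c.
Proof. exact: rmorphN. Qed.

Lemma conjcD (c d : R[i]) : conjc (c + d) = conjc c + conjc d.
Proof. exact: rmorphD. Qed.

Lemma nrmc_i : nrm ('i%C : R[i]) = 1.
Proof.
have := nrmc_sqr ('i%C : R[i]); rewrite /= expr0n add0r expr1n => h.
by apply/eqP; rewrite -(@eqrXn2 _ 2) ?nrm_ge0// h expr1n.
Qed.

Lemma nrmc_ge_Re (c : R[i]) : complex.Re c <= nrm c.
Proof.
apply: (le_trans (ler_norm _)); rewrite -lecR -normE; exact: normc_ge_Re.
Qed.

Lemma sqr_le_lemma (a b : R) : 0 <= b -> a ^+ 2 <= b ^+ 2 -> a <= b.
Proof.
move=> b0 h; case: (leP a 0) => a0; first exact: le_trans b0.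
by rewrite -(@ler_pXn2r _ 2) ?nnegrE// ltW.
Qed.

Lemma complete_seq (V : completeNormedModType R[i]) (u : nat -> V) :
  (forall e : R, 0 < e -> exists n0 : nat, forall m n : nat,
     (n0 <= m)%N -> (n0 <= n)%N -> nrm (u m - u n) < e) ->
  exists l : V, forall e : R, 0 < e -> exists n0 : nat, forall n : nat,
     (n0 <= n)%N -> nrm (u n - l) < e.
Proof.
move=> cu.
have /cauchy_cvgP/cvg_ex[l ul] : cauchy (u @ \oo).
  apply/cauchy_ballP => e e0.
  have er : e = (complex.Re e)%:C by rewrite RRe_real// gtr0_real.
  have e0' : 0 < complex.Re e by rewrite -ltcR -er.
  have [n0 hn0] := cu _ e0'.
  (* Both components are the tail of [u] from [n0]: any two of its points are [e]-close. *)
  exists (u @` [set n | (n0 <= n)%N], u @` [set n | (n0 <= n)%N]).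
    split; exists n0 => // n /= hn; by exists n.
  move=> [_ _] [/= [m hm <-] [n hn <-]].
  by rewrite -ball_normE /ball_ /= normE er ltcR; apply: hn0.
exists l => e e0.
have e0' : (0 : R[i]) < e%:C by rewrite ltcR.
move/cvgrPdist_lt : ul => /(_ _ e0')[n0 _ hn0].
by exists n0 => n hn; have := hn0 n hn; rewrite normE ltcR nrmB.
Qed.

End RealNorm.

(** * Positive semidefinite hermitian forms *)

Section Forms.
Context {R : realType} {V : lmodType R[i]}.

(** Semidefinite forms let one Cauchy-Schwarz inequality serve Hilbert spaces, their finite sums and
    the GNS form, whose null vectors are never divided out explicitly. *)
Record psd_form := PsdForm {
  pform :> V -> V -> R[i];
  pformDl : forall x y z, pform (x + y) z = pform x z + pform y z;
  pformZl : forall c x y, pform (c *: x) y = c * pform x y;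
  pformC : forall x y, pform y x = conjc (pform x y);
  pform_ge0 : forall x, 0 <= complex.Re (pform x x) }.

Variable B : psd_form.

Definition pnrm (x : V) : R := Num.sqrt (complex.Re (B x x)).

Lemma pformDr x y z : B x (y + z) = B x y + B x z.
Proof. by rewrite pformC pformDl conjcD -!(pformC B). Qed.

Lemma pformZr c x y : B x (c *: y) = conjc c * B x y.
Proof. by rewrite pformC pformZl conjcM -(pformC B). Qed.

Lemma pformNl x y : B (- x) y = - B x y.
Proof. by rewrite -scaleN1r pformZl mulN1r. Qed.

Lemma pformNr x y : B x (- y) = - B x y.
Proof. by rewrite pformC pformNl conjcN -(pformC B). Qed.

Lemma pform0l y : B 0 y = 0.
Proof. by rewrite -(scale0r (0 : V)) pformZl mul0r. Qed.

Lemma pform0r y : B y 0 = 0.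
Proof. by rewrite pformC pform0l rmorph0. Qed.

Lemma pform_real x : B x x = (complex.Re (B x x))%:C.
Proof.
have := pformC B x x; case: (B x x) => a b /= [] h.
by congr (_ +i* _); lra.
Qed.

Lemma pform_Re_sym x y : complex.Re (B y x) = complex.Re (B x y).
Proof. by rewrite pformC; case: (B x y). Qed.

Lemma pnrm_sqr x : pnrm x ^+ 2 = complex.Re (B x x).
Proof. by rewrite /pnrm sqr_sqrtr// pform_ge0. Qed.

Lemma pnrm_ge0 x : 0 <= pnrm x.
Proof. exact: sqrtr_ge0. Qed.

Lemma pnrm_sqrD x y :
  pnrm (x + y) ^+ 2 = pnrm x ^+ 2 + complex.Re (B x y) *+ 2 + pnrm y ^+ 2.
Proof.
rewrite !pnrm_sqr pformDl !pformDr !raddfD /= (pform_Re_sym x y); ring.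
Qed.

Lemma pnrm_sqrZ c x : pnrm (c *: x) ^+ 2 = nrm c ^+ 2 * pnrm x ^+ 2.
Proof.
rewrite !pnrm_sqr pformZl pformZr mulrA mulcJ (pform_real x) -rmorphM /=.
by [].
Qed.

Lemma pnrmZ c x : pnrm (c *: x) = nrm c * pnrm x.
Proof.
apply/eqP; rewrite -(@eqrXn2 _ 2) ?pnrm_ge0 ?mulr_ge0 ?nrm_ge0 ?pnrm_ge0//.
by rewrite pnrm_sqrZ exprMn.
Qed.

Lemma cauchy_schwarz x y : nrm (B x y) <= pnrm x * pnrm y.
Proof.
apply: sqr_le_lemma; first by rewrite mulr_ge0 ?pnrm_ge0.
rewrite exprMn; set b := nrm (B x y) ^+ 2.
have b0 : 0 <= b by rewrite /b sqr_ge0.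
(* Moving [x] along the complex multiple [t * B x y] of [y] makes the cross term real for every real
   [t], so no phase has to be chosen. *)
have key (t : R) : 0 <= pnrm x ^+ 2 - t * b *+ 2 + t ^+ 2 * b * pnrm y ^+ 2.
  have := sqr_ge0 (pnrm (x + (- (t%:C * B x y)) *: y)).
  rewrite pnrm_sqrD pnrm_sqrZ pformZr nrmN nrmcM nrmc_real exprMn -normrX.
  rewrite (ger0_norm (sqr_ge0 t)) -/b.
  rewrite conjcN conjcM conjc_real.
  rewrite mulNr -(mulrA t%:C) (mulrC (conjc (B x y))) mulcJ -/b -rmorphM -rmorphN /=.
  by rewrite mulNrn.
have := sqr_ge0 (pnrm y); rewrite le_eqVlt => /predU1P[y0|y0].
  rewrite -y0 mulr0; rewrite leNgt; apply/negP => bp.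
  (* For a null vector [y] the quadratic is affine in [t]; this [t] gives it the value
     [- pnrm x ^+ 2 - 2]. *)
  have := key ((pnrm x ^+ 2 + 1) / b).
  rewrite -y0 mulr0 addr0 divfK ?gt_eqF//.
  have := sqr_ge0 (pnrm x); lra.
(* The minimizer of the quadratic in [t]. *)
have := key (pnrm y ^+ 2)^-1.
set Y := pnrm y ^+ 2 in y0 *.
have -> : Y^-1 ^+ 2 * b * Y = Y^-1 * b by field; rewrite gt_eqF.
rewrite mulr2n opprD addrA addrNK subr_ge0 mulrC ler_pdivrMr//.
Qed.

Lemma pnrmN x : pnrm (- x) = pnrm x.
Proof. by rewrite -scaleN1r pnrmZ nrmN /nrm normr1 /= mul1r. Qed.

End Forms.
Arguments psd_form {R} V.

Section RealLemmas.
Context {R : realType}.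

(** First-order condition at a minimum: the linear coefficient vanishes. It yields the Euler
    equation in [riesz] and the orthogonality in [cmax_unit_adjoint]. The denominator [K + 1] of the
    test point covers [K = 0]. *)
Lemma quad_ge0_eq0 (c K : R) : 0 <= K ->
  (forall t, 0 <= t * c *+ 2 + t ^+ 2 * K) -> c = 0.
Proof.
move=> K0 h; have := h (- c / (K + 1)).
have K1 : K + 1 != 0 by rewrite gt_eqF// ltr_pwDr.
have -> : - c / (K + 1) * c *+ 2 + (- c / (K + 1)) ^+ 2 * K
          = - (c ^+ 2 * (K + 2) / (K + 1) ^+ 2) by field.
rewrite oppr_ge0 => h1; apply/eqP; rewrite -sqrf_eq0 eq_le sqr_ge0 andbT.
move: h1; rewrite pmulr_lle0 ?invr_gt0 ?exprn_gt0 ?ltr_pwDr//.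
by rewrite pmulr_lle0// ltr_pwDr.
Qed.

Lemma le_add_eps (a b : R) : (forall e, 0 < e -> a <= b + e) -> a <= b.
Proof. by move=> h; apply/ler_addgt0Pr. Qed.

Lemma small_inv (e : R) : 0 < e -> exists n0 : nat, forall n : nat,
  (n0 <= n)%N -> n.+1%:R^-1 < e.
Proof.
move=> e0; exists (Num.bound e^-1) => n hn.
rewrite invf_plt ?posrE//.
apply: (lt_le_trans (archi_boundP _)); first by rewrite invr_ge0 ltW.
by rewrite ler_nat ltnW.
Qed.

End RealLemmas.

(** * Hilbert spaces and adjoints *)

Section HilbertBasics.
Context {R : realType} {H : hilbertType R}.
Implicit Types (x y z : H) (S T : H -> H).

Lemma dotxx x : dot x x = (nrm x ^+ 2)%:C.
Proof. by rewrite dot_norm normE rmorphXn. Qed.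

Lemma dot_ge0 x : 0 <= complex.Re (dot x x).
Proof. by rewrite dotxx /= sqr_ge0. Qed.

Definition hform : psd_form H := PsdForm (@dotDl R H) (@dotZl R H) (@dotC R H) dot_ge0.

Lemma dotDr x y z : dot x (y + z) = dot x y + dot x z.
Proof. exact: (pformDr hform). Qed.

Lemma dotZr (c : R[i]) x y : dot x (c *: y) = conjc c * dot x y.
Proof. exact: (pformZr hform). Qed.

Lemma dotNl x y : dot (- x) y = - dot x y.
Proof. exact: (pformNl hform). Qed.

Lemma dotNr x y : dot x (- y) = - dot x y.
Proof. exact: (pformNr hform). Qed.

Lemma dot0l y : dot 0 y = 0.
Proof. exact: (pform0l hform). Qed.

Lemma dot0r y : dot y 0 = 0.
Proof. exact: (pform0r hform). Qed.

Lemma dot_suml I (r : seq I) (P : pred I) (f : I -> H) y :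
  dot (\sum_(i <- r | P i) f i) y = \sum_(i <- r | P i) dot (f i) y.
Proof.
by apply: (big_morph (fun x => dot x y)) => [a b|]; [exact: dotDl|exact: dot0l].
Qed.

Lemma dot_sumr I (r : seq I) (P : pred I) (f : I -> H) y :
  dot y (\sum_(i <- r | P i) f i) = \sum_(i <- r | P i) dot y (f i).
Proof.
by apply: (big_morph (fun x => dot y x)) => [a b|]; [exact: dotDr|exact: dot0r].
Qed.

Lemma pnrm_hform x : pnrm hform x = nrm x.
Proof. by rewrite /pnrm /= dotxx /= sqrtr_sqr ger0_norm// nrm_ge0. Qed.

Lemma nrm_sqrD x y :
  nrm (x + y) ^+ 2 = nrm x ^+ 2 + complex.Re (dot x y) *+ 2 + nrm y ^+ 2.
Proof. by have := pnrm_sqrD hform x y; rewrite !pnrm_hform. Qed.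

Lemma dot_cauchy_schwarz x y : nrm (dot x y) <= nrm x * nrm y.
Proof. by have := cauchy_schwarz hform x y; rewrite !pnrm_hform. Qed.

Lemma dot_inj y z : (forall x, dot x y = dot x z) -> y = z.
Proof.
move=> h; apply/eqP; rewrite -subr_eq0; apply/eqP/nrm_eq0.
have := dotxx (y - z); rewrite dotDr dotNr h subrr => /(congr1 (@complex.Re R)) /=.
by move=> /esym/eqP; rewrite sqrf_eq0 => /eqP.
Qed.

Section Riesz.
Variables (f : H -> R[i]) (M : R).
Hypothesis fD : forall x y, f (x + y) = f x + f y.
Hypothesis fZ : forall c x, f (c *: x) = c * f x.
Hypothesis fM : forall x, nrm (f x) <= M * nrm x.

Let Q y : R := nrm y ^+ 2 - complex.Re (f y) *+ 2.

Let QD x y : Q (x + y) =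
  Q x + complex.Re (dot x y - f y) *+ 2 + nrm y ^+ 2.
Proof. rewrite /Q nrm_sqrD fD !raddfD /= raddfN /=; ring. Qed.

Let Q_lb y : - M ^+ 2 <= Q y.
Proof.
have h : complex.Re (f y) <= M * nrm y := le_trans (nrmc_ge_Re _) (fM y).
have := sqr_ge0 (nrm y - M); rewrite /Q; set n := nrm y in h *.
rewrite sqrrB; nra.
Qed.

(* The minimizer of |y|^2 - 2 Re f(y) represents f. *)
Lemma riesz : exists z, forall x, f x = dot x z.
Proof.
have hi : has_inf (range Q).
  by split; [exists (Q 0), 0|exists (- M ^+ 2) => _ [y _ <-]; exact: Q_lb].
set m := inf (range Q).
have Qm y : m <= Q y by apply: ge_inf; [exact: hi.2|exists y].
have /choice[u uP] n : exists y, Q y < m + n.+1%:R^-1.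
  have [_ [y _ <-] hy] := inf_adherent (ltac:(by rewrite invr_gt0) : 0 < n.+1%:R^-1 :> R) hi.
  by exists y.
(* Parallelogram law at the midpoint, where [Q] is at least [m]; the terms in [f] cancel. Hence
   minimizing sequences are Cauchy. *)
have Qmid x y : nrm (x - y) ^+ 2 <= (Q x + Q y - m *+ 2) *+ 2.
  have := Qm (2^-1 *: (x + y)).
  have fr : complex.Re (f (2^-1 *: (x + y))) = 2^-1 * complex.Re (f (x + y)).
    rewrite fZ (_ : 2^-1 = (2^-1 : R)%:C); last by rewrite fmorphV rmorph_nat.
    by case: (f _) => a b /=; rewrite mul0r subr0.
  have nr : nrm (2^-1 *: (x + y)) = 2^-1 * nrm (x + y).
    rewrite nrmZ (_ : 2^-1 = (2^-1 : R)%:C); last by rewrite fmorphV rmorph_nat.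
    by rewrite nrmc_real ger0_norm// invr_ge0.
  rewrite {1}/Q fr nr exprMn nrm_sqrD fD raddfD /=.
  rewrite nrm_sqrD nrmN dotNr raddfN /= /Q.
  set a := nrm x ^+ 2; set b := nrm y ^+ 2; set c := complex.Re (f x).
  set d := complex.Re (f y); set e := complex.Re (dot x y); lra.
have [l ul] : exists l : H, forall e : R, 0 < e -> exists n0 : nat, forall n : nat,
     (n0 <= n)%N -> nrm (u n - l) < e.
  apply: complete_seq => e e0.
  (* Values of [Q] within [e ^+ 2 / 4] of [m] make the bound in [Qmid] smaller than
     [2 * (e ^+ 2 / 4 + e ^+ 2 / 4) = e ^+ 2]. *)
  have e2 : 0 < e ^+ 2 / 4 by rewrite divr_gt0 ?exprn_gt0.
  have [n0 hn0] := small_inv e2; exists n0 => p q hp hq.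
  have : nrm (u p - u q) ^+ 2 < e ^+ 2.
    apply: (le_lt_trans (Qmid _ _)).
    have := hn0 p hp; have := hn0 q hq; have := uP p; have := uP q.
    move: (p.+1%:R^-1) (q.+1%:R^-1) (e ^+ 2) (Q (u p)) (Q (u q)) => a b c d g; lra.
  by rewrite ltr_pXn2r// nnegrE ?nrm_ge0 ?ltW.
(* First variation at the minimum. [Q] is expanded at the approximants [u n]: half of [e] pays for
   [Q (u n) - m], the other half for replacing [u n] by [l]. *)
have key x : complex.Re (dot l x - f x) = 0.
  apply: (@quad_ge0_eq0 _ _ (nrm x ^+ 2)); first exact: sqr_ge0.
  move=> t; apply: le_add_eps => e e0.
  pose X := `|t| * nrm x *+ 2 + 1.
  have X0 : 0 < X by rewrite ltr_wpDl// mulrn_wge0// mulr_ge0 ?nrm_ge0.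
  have [n1 h1] := small_inv (ltac:(by rewrite divr_gt0) : 0 < e / 2 :> R).
  have [n2 h2] := ul (e / 2 / X) ltac:(by rewrite !divr_gt0).
  have := h1 (maxn n1 n2) (leq_maxl _ _); have := h2 (maxn n1 n2) (leq_maxr _ _).
  have := uP (maxn n1 n2); move: (maxn n1 n2) => n Qn dn en.
  have := Qm (u n + t%:C *: x).
  rewrite QD nrmZ nrmc_real exprMn -normrX (ger0_norm (sqr_ge0 t)).
  have -> : complex.Re (dot (u n) (t%:C *: x) - f (t%:C *: x))
      = t * complex.Re (dot (u n) x - f x).
    rewrite dotZr fZ conjc_real -mulrBr.
    by case: (dot _ _ - f x) => a b /=; rewrite mul0r subr0.
  have : `|t * complex.Re (dot (u n - l) x)| *+ 2 <= e / 2.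
    have dx : `|complex.Re (dot (u n - l) x)| <= nrm (u n - l) * nrm x.
      apply: le_trans (dot_cauchy_schwarz _ _).
      by rewrite -lecR -normE; exact: normc_ge_Re.
    rewrite normrM; apply: (@le_trans _ _ (nrm (u n - l) * X)).
      rewrite /X mulrDr mulr1 -[leLHS]addr0 lerD ?nrm_ge0//.
      have := ler_wpM2l (normr_ge0 t) dx.
      set a := `|complex.Re _|; set b := nrm (u n - l); set c := nrm x; nra.
    by rewrite -ler_pdivlMr// ltW.
  have -> : complex.Re (dot (u n) x - f x)
      = complex.Re (dot l x - f x) + complex.Re (dot (u n - l) x).
    rewrite dotDl dotNl !raddfD /= !raddfN /=; ring.
  have := ler_norm (t * complex.Re (dot (u n - l) x)).
  set a := t * complex.Re (dot (u n - l) x).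
  rewrite mulrDr -/a; move: Qn en.
  move: (Q (u n)) (n.+1%:R^-1) (`|a|) (t * complex.Re _) (t ^+ 2 * _) => b c d g h.
  lra.
have key2 x : complex.Re (f x) = complex.Re (dot x l).
  have := key x; rewrite raddfB /= (dotC l x).
  by case: (dot l x) => a b /= /eqP; rewrite subr_eq0 => /eqP.
exists l => x; apply/eqP; rewrite eq_complex key2 eqxx /=.
(* Up to sign, the real parts at [i x] are the imaginary parts at [x]. *)
have := key2 ('i%C *: x); rewrite dotZl fZ.
by case: (dot x l) (f x) => a b [c d] /=; rewrite !mul0r !mul1r !sub0r => /oppr_inj ->.
Qed.

End Riesz.

Lemma bounded_operatorP T : bounded_operator T <->
  [/\ forall x y, T (x + y) = T x + T y, forall (c : R[i]) x, T (c *: x) = c *: T x &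
      exists2 M : R, 0 <= M & forall x, nrm (T x) <= M * nrm x].
Proof.
split=> [[lT [M hM]]|[TD TZ [M M0 hM]]].
  have TD x y : T (x + y) = T x + T y by have := lT 1 x y; rewrite !scale1r.
  have T0 : T 0 = 0 by apply: (addrI (T 0)); rewrite -TD !addr0.
  split=> //; first by move=> c x; have := lT c x 0; rewrite T0 !addr0.
  exists `|M| => // x; rewrite -lecR rmorphM /= -!normE.
  apply: le_trans (hM x) _; rewrite ler_wpM2r ?normr_ge0// lecR; exact: ler_norm.
split; first by move=> c x y; rewrite TD TZ.
by exists M => x; rewrite !normE -rmorphM lecR.
Qed.

End HilbertBasics.

Section Adjoint.
Context {R : realType} {H : hilbertType R}.
Implicit Types (x y z : H) (S T : H -> H).

Lemma bopD T : bounded_operator T -> forall x y, T (x + y) = T x + T y.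
Proof. by case/bounded_operatorP. Qed.

Lemma bopZ T : bounded_operator T -> forall (c : R[i]) x, T (c *: x) = c *: T x.
Proof. by case/bounded_operatorP. Qed.

Lemma bop0 T : bounded_operator T -> T 0 = 0.
Proof. by move=> bT; apply: (addrI (T 0)); rewrite -(bopD bT) !addr0. Qed.

Lemma bopN T : bounded_operator T -> forall x, T (- x) = - T x.
Proof. by move=> bT x; rewrite -scaleN1r (bopZ bT) scaleN1r. Qed.

Lemma bop_bound T : bounded_operator T ->
  exists2 M : R, 0 <= M & forall x, nrm (T x) <= M * nrm x.
Proof. by case/bounded_operatorP. Qed.

Lemma bop_sum T : bounded_operator T -> forall I (r : seq I) (P : pred I) (f : I -> H),
  T (\sum_(i <- r | P i) f i) = \sum_(i <- r | P i) T (f i).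
Proof.
by move=> bT I r P f; apply: (big_morph T) => [x y|]; [exact: bopD|exact: bop0].
Qed.

Lemma bounded_id : bounded_operator (idfun : H -> H).
Proof. by apply/bounded_operatorP; split=> //; exists 1 => // x; rewrite mul1r. Qed.

Lemma bounded_0 : bounded_operator (fun=> 0 : H).
Proof.
apply/bounded_operatorP; split=> [x y|c x|]; rewrite ?addr0 ?scaler0//.
by exists 0 => // x; rewrite nrm0 mul0r.
Qed.

Lemma bounded_add S T : bounded_operator S -> bounded_operator T -> bounded_operator (S + T).
Proof.
move=> bS bT; apply/bounded_operatorP; split=> [x y|c x|].
- by rewrite !fctE (bopD bS) (bopD bT) addrACA.
- by rewrite !fctE (bopZ bS) (bopZ bT) scalerDr.
case: (bop_bound bS) (bop_bound bT) => [M M0 hM] [N N0 hN].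
exists (M + N); first exact: addr_ge0.
by move=> x; rewrite mulrDl; apply: le_trans (nrmD _ _) _; exact: lerD.
Qed.

Lemma bounded_scale (c : R[i]) T : bounded_operator T -> bounded_operator (c *: T).
Proof.
move=> bT; apply/bounded_operatorP; split=> [x y|d x|].
- by rewrite !fctE (bopD bT) scalerDr.
- by rewrite !fctE (bopZ bT) !scalerA mulrC.
case: (bop_bound bT) => [M M0 hM]; exists (nrm c * M); first by rewrite mulr_ge0 ?nrm_ge0.
by move=> x; rewrite fctE nrmZ -mulrA ler_wpM2l ?nrm_ge0.
Qed.

Lemma bounded_comp S T : bounded_operator S -> bounded_operator T -> bounded_operator (S \o T).
Proof.
move=> bS bT; apply/bounded_operatorP; split=> [x y|c x|].
- by rewrite /= (bopD bT) (bopD bS).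
- by rewrite /= (bopZ bT) (bopZ bS).
case: (bop_bound bS) (bop_bound bT) => [M M0 hM] [N N0 hN].
exists (M * N); first exact: mulr_ge0.
move=> x; apply: le_trans (hM _) _; rewrite -mulrA ler_wpM2l//.
Qed.

Lemma bounded_sub S T : bounded_operator S -> bounded_operator T -> bounded_operator (S - T).
Proof.
by move=> bS bT; apply: bounded_add => //; rewrite -scaleN1r; exact: bounded_scale.
Qed.

(** Riesz, applied to [x |-> dot (T x) y] for each [y], supplies an inhabitant of the set from which
    [xget] chooses. *)
Lemma adjointP T : bounded_operator T -> forall x y, dot (T x) y = dot x (adjoint T y).
Proof.
move=> bT; rewrite /adjoint; apply: (@xgetPex _ _ [set S : H -> H | forall x y : H, dot (T x) y = dot x (S y)]).
case: (bop_bound bT) => M M0 hM.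
have /choice[S hS] y : exists z, forall x, dot (T x) y = dot x z.
  apply: (@riesz _ _ _ (M * nrm y)) => [a b|c a|a].
  - by rewrite (bopD bT) dotDl.
  - by rewrite (bopZ bT) dotZl.
  - apply: le_trans (dot_cauchy_schwarz _ _) _.
    by rewrite mulrAC ler_wpM2r ?nrm_ge0.
by exists S => x y; rewrite hS.
Qed.

Lemma adjointPr T : bounded_operator T -> forall x y, dot (adjoint T x) y = dot x (T y).
Proof. by move=> bT x y; rewrite dotC -(adjointP bT) -dotC. Qed.

Lemma adjoint_unique T S : bounded_operator T ->
  (forall x y, dot (T x) y = dot x (S y)) -> adjoint T = S.
Proof.
move=> bT h; apply/funext => y; apply: dot_inj => x.
by rewrite -(adjointP bT) h.
Qed.

(** With [y = adjoint T x], [nrm y ^+ 2 = dot (T y) x] is at most [M * nrm y * nrm x], and a factor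
    [nrm y] cancels unless it is 0. *)
Lemma nrm_adjoint T (M : R) : bounded_operator T -> 0 <= M ->
  (forall x, nrm (T x) <= M * nrm x) -> forall x, nrm (adjoint T x) <= M * nrm x.
Proof.
move=> bT M0 hM x.
have := dot_cauchy_schwarz (T (adjoint T x)) x.
rewrite (adjointP bT) dotxx nrmc_real ger0_norm ?sqr_ge0//.
have := hM (adjoint T x); have := nrm_ge0 (adjoint T x); have := nrm_ge0 x.
set a := nrm (adjoint T x); set b := nrm x; set c := nrm (T _) => b0 a0 hc h.
have : a * a <= (M * b) * a by rewrite -expr2; nra.
move: a0; rewrite le_eqVlt => /predU1P[<- _|a0]; first by rewrite mulr_ge0.
by rewrite ler_pM2r.
Qed.

Lemma bounded_adjoint T : bounded_operator T -> bounded_operator (adjoint T).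
Proof.
move=> bT; apply/bounded_operatorP; split=> [x y|c x|].
- by apply: dot_inj => z; rewrite -(adjointP bT) !dotDr !(adjointP bT).
- by apply: dot_inj => z; rewrite -(adjointP bT) !dotZr (adjointP bT).
by case: (bop_bound bT) => M M0 hM; exists M => //; exact: nrm_adjoint.
Qed.

Lemma adjointK T : bounded_operator T -> adjoint (adjoint T) = T.
Proof.
by move=> bT; apply: adjoint_unique => [|x y]; [exact: bounded_adjoint|exact: adjointPr].
Qed.

Lemma adjointD S T : bounded_operator S -> bounded_operator T ->
  adjoint (S + T) = adjoint S + adjoint T.
Proof.
move=> bS bT; apply: adjoint_unique => [|x y]; first exact: bounded_add.
by rewrite !fctE dotDl dotDr (adjointP bS) (adjointP bT).
Qed.

Lemma adjointZ (c : R[i]) T : bounded_operator T ->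
  adjoint (c *: T) = conjc c *: adjoint T.
Proof.
move=> bT; apply: adjoint_unique => [|x y]; first exact: bounded_scale.
by rewrite !fctE dotZl dotZr conjcK (adjointP bT).
Qed.

Lemma adjointM S T : bounded_operator S -> bounded_operator T ->
  adjoint (S \o T) = adjoint T \o adjoint S.
Proof.
move=> bS bT; apply: adjoint_unique => [|x y]; first exact: bounded_comp.
by rewrite /= (adjointP bS) (adjointP bT).
Qed.

Lemma adjoint_id : adjoint (idfun : H -> H) = idfun.
Proof. by apply: adjoint_unique => //; exact: bounded_id. Qed.

Lemma adjoint_0 : adjoint (fun=> 0 : H) = (fun=> 0).
Proof. by apply: adjoint_unique => [|x y]; [exact: bounded_0|rewrite dot0l dot0r]. Qed.

(* Polarization. *)
Lemma selfadjoint_real_range T : bounded_operator T ->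
  (forall x, complex.Im (dot (T x) x) = 0) -> adjoint T = T.
Proof.
move=> bT h; apply: adjoint_unique => // x y.
have h1 := h (x + y); have h2 := h (x + 'i%C *: y).
rewrite !(bopD bT) !(bopZ bT) !dotDl !dotDr !dotZl !dotZr in h1 h2.
move: (h x) (h y) h1 h2; rewrite (dotC (T y) x).
case: (dot (T x) x) (dot (T y) y) (dot (T x) y) (dot (T y) x) => [a b] [c d] [e f] [g k] /=.
move=> -> -> h1 h2; congr (_ +i* _); lra.
Qed.

End Adjoint.

(** * Operator matrices *)

Section OpNorm.
Context {R : realType} {H : hilbertType R}.
Implicit Types (S T : H -> H).

(** The Hilbert sum of [n] copies of [H] is represented by plain functions ['I_n -> H]; this is its
    squared norm, and [mxop] below is the action of an operator matrix on it. *)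
Definition vsq n (xi : 'I_n -> H) : R := \sum_(j < n) nrm (xi j) ^+ 2.

Definition mxop m n (a : 'M[H -> H]_(m, n)) (xi : 'I_n -> H) (i : 'I_m) : H :=
  \sum_(j < n) (a i j) (xi j).

Lemma vsq_ge0 n (xi : 'I_n -> H) : 0 <= vsq xi.
Proof. by apply: sumr_ge0 => i _; exact: sqr_ge0. Qed.

Lemma vsqE n (xi : 'I_n -> H) : \sum_(j < n) `|xi j| ^+ 2 = (vsq xi)%:C.
Proof. by rewrite rmorph_sum; apply: eq_bigr => i _; rewrite normE rmorphXn. Qed.

Lemma opnorm_boundsE m n (a : 'M[H -> H]_(m, n)) :
  opnorm_bounds a = [set c : R | 0 <= c /\ forall xi, vsq (mxop a xi) <= c ^+ 2 * vsq xi].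
Proof.
apply/seteqP; split=> c /= [c0 h]; split=> // xi; have := h xi.
  by rewrite -rmorphXn /= !vsqE -rmorphM lecR.
by rewrite -rmorphXn /= !vsqE -rmorphM lecR.
Qed.

Lemma mx_opnorm_ge0 m n (a : 'M[H -> H]_(m, n)) : 0 <= mx_opnorm a.
Proof.
rewrite /mx_opnorm; have [->|/set0P ne] := eqVneq (opnorm_bounds a) set0.
  by rewrite inf0.
by apply: lb_le_inf => // c; rewrite opnorm_boundsE => -[].
Qed.

Lemma mx_opnorm_le m n (a : 'M[H -> H]_(m, n)) (c : R) : 0 <= c ->
  (forall xi, vsq (mxop a xi) <= c ^+ 2 * vsq xi) -> mx_opnorm a <= c.
Proof.
move=> c0 h; apply: ge_inf; last by rewrite opnorm_boundsE.
by exists 0 => d; rewrite opnorm_boundsE => -[].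
Qed.

Definition bounded_mx m n (a : 'M[H -> H]_(m, n)) := forall i j, bounded_operator (a i j).

(** Lagrange's identity: half of the double sum of [(f i - f j) ^+ 2] is the difference of the two
    sides. *)
Lemma sqr_sum_le n (f : 'I_n -> R) :
  (\sum_(i < n) f i) ^+ 2 <= n%:R * \sum_(i < n) f i ^+ 2.
Proof.
have : 0 <= \sum_(i < n) \sum_(j < n) (f i - f j) ^+ 2.
  by do 2![apply: sumr_ge0 => ? _]; exact: sqr_ge0.
have -> : \sum_(i < n) \sum_(j < n) (f i - f j) ^+ 2
    = (n%:R * \sum_(i < n) f i ^+ 2) *+ 2 - (\sum_(i < n) f i) ^+ 2 *+ 2.
  rewrite (eq_bigr (fun i => n%:R * f i ^+ 2 - f i * (\sum_(j < n) f j) *+ 2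
      + \sum_(j < n) f j ^+ 2)); last first.
    move=> i _; rewrite (eq_bigr (fun j => f i ^+ 2 - f i * f j *+ 2 + f j ^+ 2)).
      rewrite big_split /= sumrB sumr_const card_ord mulr_natl.
      by rewrite sumrMnl -mulr_sumr.
    by move=> j _; rewrite sqrrB.
  rewrite big_split /= sumrB -mulr_sumr sumrMnl -mulr_suml sumr_const card_ord.
  rewrite -mulr_natl; ring.
by rewrite -mulrnBl pmulrn_lge0// subr_ge0.
Qed.

Lemma bounded_mx_has_bound m n (a : 'M[H -> H]_(m, n)) : bounded_mx a ->
  opnorm_bounds a !=set0.
Proof.
move=> ba; rewrite opnorm_boundsE.
have /choice[F hF] (p : 'I_m * 'I_n) : exists M : R, 0 <= M /\ forall x, nrm (a p.1 p.2 x) <= M * nrm x.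
  by case: (bop_bound (ba p.1 p.2)) => M M0 h; exists M.
pose K := \sum_(p : 'I_m * 'I_n) F p.
have FK i j : F (i, j) <= K.
  by rewrite /K (bigD1 (i, j)) //= lerDl sumr_ge0// => p _; case: (hF p).
have K0 : 0 <= K by apply: sumr_ge0 => p _; case: (hF p).
have X0 : 0 <= m%:R * (n%:R * K ^+ 2) :> R by rewrite !mulr_ge0 ?ler0n ?sqr_ge0.
(* A crude bound, from Cauchy-Schwarz on each row; it only has to show that the set of bounds is
   nonempty. *)
exists (Num.sqrt (m%:R * (n%:R * K ^+ 2))); split; first exact: sqrtr_ge0.
move=> xi; rewrite sqr_sqrtr//.
rewrite -mulrA mulr_natl.
have -> x : x *+ m = \sum_(i < m) x :> R by rewrite sumr_const card_ord.
apply: ler_sum => i _.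
apply: (@le_trans _ _ ((\sum_(j < n) K * nrm (xi j)) ^+ 2)).
  rewrite ler_pXn2r ?nnegrE ?nrm_ge0 ?sumr_ge0//; last first.
    by move=> j _; rewrite mulr_ge0 ?nrm_ge0.
  apply: le_trans (nrm_sum _ _ _) _; apply: ler_sum => j _.
  by case: (hF (i, j)) => _ /(_ (xi j)) /= h; rewrite (le_trans h)// ler_wpM2r ?nrm_ge0.
apply: le_trans (sqr_sum_le _) _; rewrite -mulrA ler_wpM2l ?ler0n//.
by rewrite /vsq mulr_sumr; apply: ler_sum => j _; rewrite exprMn.
Qed.

Lemma mx_opnormP m n (a : 'M[H -> H]_(m, n)) : bounded_mx a ->
  forall xi, vsq (mxop a xi) <= mx_opnorm a ^+ 2 * vsq xi.
Proof.
move=> ba xi; have ne := bounded_mx_has_bound ba.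
have hi : has_inf (opnorm_bounds a).
  by split=> //; exists 0 => d; rewrite opnorm_boundsE => -[].
have N0 := mx_opnorm_ge0 a.
apply: le_add_eps => e e0.
pose N := mx_opnorm a; pose v := vsq xi; have v0 : 0 <= v := vsq_ge0 _.
(* As [d <= 1], [(N + d) ^+ 2 * v] exceeds [N ^+ 2 * v] by at most [d * (N *+ 2 + 1) * v], hence by
   at most [e]. *)
pose d := Num.min 1 (e / ((N *+ 2 + 1) * v + 1)).
have D0 : 0 < (N *+ 2 + 1) * v + 1.
  by rewrite ltr_wpDl// mulr_ge0// addr_ge0// mulrn_wge0.
have d0 : 0 < d by rewrite lt_min ltr01 divr_gt0.
have [c hc0 ltc] := inf_adherent d0 hi.
move: hc0; rewrite opnorm_boundsE => -[c0 /(_ xi) hc].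
apply: (le_trans hc); rewrite -/v -/N.
have d1 : d <= 1 by rewrite ge_min lexx.
have d2 : d * ((N *+ 2 + 1) * v + 1) <= e by rewrite -ler_pdivlMr// ge_min lexx orbT.
have {}ltc : c < N + d by [].
have Nd : 0 <= N + d by rewrite addr_ge0// ltW.
have : c ^+ 2 <= (N + d) ^+ 2 by rewrite ler_pXn2r ?nnegrE// ltW.
move=> h; have : c ^+ 2 * v <= (N + d) ^+ 2 * v by rewrite ler_wpM2r.
have {}N0 : 0 <= N by [].
have : d * d * v <= d * v by rewrite ler_wpM2r// ler_piMl// ltW.
move: d2 => {ltc hc hi ne}; clearbody d N v; nra.
Qed.

End OpNorm.

Section OpNormTheory.
Context {R : realType} {H : hilbertType R}.
Implicit Types (S T : H -> H).

Lemma opnorm_ge0 T : 0 <= opnorm T.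
Proof. exact: mx_opnorm_ge0. Qed.

Lemma vsq1 (xi : 'I_1 -> H) : vsq xi = nrm (xi ord0) ^+ 2.
Proof. by rewrite /vsq big_ord1. Qed.

Lemma opnorm_le T (c : R) : 0 <= c -> (forall x, nrm (T x) <= c * nrm x) -> opnorm T <= c.
Proof.
move=> c0 h; apply: mx_opnorm_le => // xi.
rewrite !vsq1 /mxop big_ord1 mxE -exprMn ler_pXn2r ?nnegrE ?mulr_ge0 ?nrm_ge0//.
Qed.

Lemma opnormP T : bounded_operator T -> forall x, nrm (T x) <= opnorm T * nrm x.
Proof.
move=> bT x; have bm : bounded_mx (const_mx T : 'M[H -> H]_1) by move=> i j; rewrite mxE.
have := mx_opnormP bm (fun=> x); rewrite !vsq1 /mxop big_ord1 mxE -exprMn.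
by rewrite ler_pXn2r ?nnegrE ?mulr_ge0 ?nrm_ge0// mx_opnorm_ge0.
Qed.

Lemma opnormD S T : bounded_operator S -> bounded_operator T ->
  opnorm (S + T) <= opnorm S + opnorm T.
Proof.
move=> bS bT; apply: opnorm_le => [|x]; first by rewrite addr_ge0 ?opnorm_ge0.
by rewrite mulrDl (le_trans (nrmD _ _))// lerD ?opnormP.
Qed.

Lemma opnormM S T : bounded_operator S -> bounded_operator T ->
  opnorm (S \o T) <= opnorm S * opnorm T.
Proof.
move=> bS bT; apply: opnorm_le => [|x]; first by rewrite mulr_ge0 ?opnorm_ge0.
rewrite /= (le_trans (opnormP bS _))// -mulrA ler_wpM2l ?opnorm_ge0//.
exact: opnormP.
Qed.

Lemma opnormZ (c : R[i]) T : bounded_operator T -> opnorm (c *: T) = nrm c * opnorm T.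
Proof.
move=> bT.
have h (d : R[i]) S : bounded_operator S -> opnorm (d *: S) <= nrm d * opnorm S.
  move=> bS; apply: opnorm_le => [|x]; first by rewrite mulr_ge0 ?opnorm_ge0 ?nrm_ge0.
  by rewrite fctE nrmZ -mulrA ler_wpM2l ?nrm_ge0 ?opnormP.
apply/eqP; rewrite eq_le h//=; have [->|c0] := eqVneq c 0.
  by rewrite nrm0 mul0r opnorm_ge0.
have nc : 0 < nrm c.
  by rewrite lt_def nrm_ge0 andbT; apply: contra_neq c0 => /nrm_eq0.
rewrite mulrC -ler_pdivlMr//.
have := h c^-1 _ (bounded_scale c bT); rewrite scalerA mulVf// scale1r.
suff -> : nrm c^-1 = (nrm c)^-1 by rewrite mulrC.
apply: (mulfI (lt0r_neq0 nc)); rewrite divff ?gt_eqF// -nrmcM divff//.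
by rewrite /nrm normr1.
Qed.

Lemma opnormN T : bounded_operator T -> opnorm (- T) = opnorm T.
Proof. by move=> bT; rewrite -scaleN1r opnormZ// nrmN /nrm normr1 /= mul1r. Qed.

Lemma opnormB S T : bounded_operator S -> bounded_operator T -> opnorm (S - T) = opnorm (T - S).
Proof. by move=> bS bT; rewrite -opnormN ?opprB//; exact: bounded_sub. Qed.

Lemma opnorm_eq0 T : bounded_operator T -> opnorm T = 0 -> T = 0.
Proof.
move=> bT T0; apply/funext => x; apply: nrm_eq0; apply/eqP.
by rewrite eq_le nrm_ge0 andbT (le_trans (opnormP bT x))// T0 mul0r.
Qed.

Lemma opnorm_adjoint T : bounded_operator T -> opnorm (adjoint T) = opnorm T.
Proof.
have h S : bounded_operator S -> opnorm (adjoint S) <= opnorm S.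
  move=> bS; apply: opnorm_le; first exact: opnorm_ge0.
  by apply: nrm_adjoint => //; [exact: opnorm_ge0|exact: opnormP].
move=> bT; apply/eqP; rewrite eq_le h//=.
by rewrite -{1}(adjointK bT) h//; exact: bounded_adjoint.
Qed.

Lemma opnorm_id_le1 : opnorm (idfun : H -> H) <= 1.
Proof. by apply: opnorm_le => // x; rewrite mul1r. Qed.

Lemma bounded_complete (u : nat -> H -> H) : (forall n, bounded_operator (u n)) ->
  (forall e : R, 0 < e -> exists n0 : nat, forall m n : nat,
     (n0 <= m)%N -> (n0 <= n)%N -> opnorm (u m - u n) < e) ->
  exists2 T, bounded_operator T &
    forall e : R, 0 < e -> exists n0 : nat, forall n : nat,
     (n0 <= n)%N -> opnorm (u n - T) < e.
Proof.
move=> bu cu.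
have bd m n : bounded_operator (u m - u n) by exact: bounded_sub.
have /choice[T hT] x : exists l, forall e : R, 0 < e -> exists n0 : nat, forall n : nat,
     (n0 <= n)%N -> nrm (u n x - l) < e.
  apply: complete_seq => e e0.
  have X0 : 0 < nrm x + 1 by rewrite ltr_wpDl ?nrm_ge0.
  have [n0 h] := cu (e / (nrm x + 1)) ltac:(by rewrite divr_gt0).
  exists n0 => m n hm hn; have := opnormP (bd m n) x; rewrite !fctE.
  move=> /le_lt_trans; apply.
  apply: (@le_lt_trans _ _ (opnorm (u m - u n) * (nrm x + 1))).
    by rewrite ler_wpM2l ?opnorm_ge0// lerDl.
  by rewrite -ltr_pdivlMr// h.
have lim_uniq (x a b : H) (M : R) : 0 <= M -> (forall e : R, 0 < e -> nrm (a - b) <= M * e) -> a = b.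
  move=> M0 h; apply/eqP; rewrite -subr_eq0; apply/eqP/nrm_eq0/eqP.
  rewrite eq_le nrm_ge0 andbT; apply: le_add_eps => e e0; rewrite add0r.
  apply: (le_trans (h (e / (M + 1)) _)); first by rewrite divr_gt0// ltr_wpDl.
  have M1 : 0 < M + 1 by rewrite ltr_wpDl.
  by rewrite mulrCA ler_piMr ?(ltW e0)// ler_pdivrMr// mul1r lerDl.
have TD x y : T (x + y) = T x + T y.
  apply: (@lim_uniq x _ _ 3) => // e e0.
  have [n1 h1] := hT x e e0; have [n2 h2] := hT y e e0; have [n3 h3] := hT (x + y) e e0.
  pose n := (n1 + n2 + n3)%N.
  have := h1 n ltac:(by rewrite /n -addnA leq_addr).
  have := h2 n ltac:(by rewrite /n addnAC leq_addl).
  have := h3 n ltac:(by rewrite /n leq_addl).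
  have -> : T (x + y) - (T x + T y) =
      - (u n (x + y) - T (x + y)) + (u n x - T x) + (u n y - T y).
    by rewrite (bopD (bu n)) opprB -!addrA (addrA (u n x)) [u n x - _ + _]addrACA addKr opprD.
  have := nrmD (- (u n (x + y) - T (x + y)) + (u n x - T x)) (u n y - T y).
  have := nrmD (- (u n (x + y) - T (x + y))) (u n x - T x).
  rewrite nrmN; lra.
have TZ (c : R[i]) x : T (c *: x) = c *: T x.
  apply: (@lim_uniq x _ _ (1 + nrm c)) => [|e e0]; first by rewrite addr_ge0 ?nrm_ge0.
  have [n1 h1] := hT x e e0; have [n2 h2] := hT (c *: x) e e0.
  pose n := (n1 + n2)%N.
  have := h1 n ltac:(by rewrite leq_addr).
  have := h2 n ltac:(by rewrite leq_addl).
  have -> : T (c *: x) - c *: T x = - (u n (c *: x) - T (c *: x)) + c *: (u n x - T x).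
    by rewrite (bopZ (bu n)) scalerBr opprB addrA addrNK.
  move=> a1 a2; apply: le_trans (nrmD _ _) _.
  rewrite nrmN nrmZ mulrDl mul1r; apply: lerD; first exact: ltW.
  by rewrite ler_wpM2l ?nrm_ge0// ltW.
(* The bound [e * nrm x] on [u n x - u m x] holds for all [x] at once and survives the pointwise
   limit in [m]. *)
have unif (e : R) : 0 < e -> exists n0 : nat, forall n : nat, (n0 <= n)%N ->
    forall x, nrm (u n x - T x) <= e * nrm x.
  move=> e0; have [n0 h0] := cu e e0; exists n0 => n hn x.
  apply: le_add_eps => d d0; have [n1 h1] := hT x d d0.
  pose m := (n0 + n1)%N.
  have -> : u n x - T x = (u n - u m) x + (u m x - T x) by rewrite !fctE addrA addrNK.
  apply: le_trans (nrmD _ _) _; apply: lerD; last by rewrite ltW// h1// leq_addl.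
  apply: le_trans (opnormP (bd _ _) _) _.
  by rewrite ler_wpM2r ?nrm_ge0// ltW// h0// leq_addr.
have bT : bounded_operator T.
  apply/bounded_operatorP; split=> //.
  have [n0 /(_ n0 (leqnn _)) h] := unif 1 ltr01.
  exists (opnorm (u n0) + 1); first by rewrite addr_ge0 ?opnorm_ge0.
  move=> x; have -> : T x = u n0 x - (u n0 x - T x) by rewrite opprB addrC addrNK.
  apply: le_trans (nrmD _ _) _; rewrite nrmN mulrDl lerD//; exact: opnormP.
exists T => // e e0; have [n0 h] := unif (e / 2) ltac:(by rewrite divr_gt0).
exists n0 => n hn; apply: (@le_lt_trans _ _ (e / 2)); last by lra.
apply: opnorm_le; [lra|]; exact: h.
Qed.

Lemma vform_Dl n (x y z : 'I_n -> H) :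
  \sum_i dot ((x + y) i) (z i) = \sum_i dot (x i) (z i) + \sum_i dot (y i) (z i).
Proof. by rewrite -big_split; apply: eq_bigr => i _; rewrite fctE dotDl. Qed.

Lemma vform_Zl n (c : R[i]) (x y : 'I_n -> H) :
  \sum_i dot ((c *: x) i) (y i) = c * \sum_i dot (x i) (y i).
Proof. by rewrite mulr_sumr; apply: eq_bigr => i _; rewrite fctE dotZl. Qed.

Lemma vform_C n (x y : 'I_n -> H) :
  \sum_i dot (y i) (x i) = conjc (\sum_i dot (x i) (y i)).
Proof.
rewrite (big_morph (@conjc R) (@conjcD R) (conjc0 R)).
by apply: eq_bigr => i _; rewrite dotC.
Qed.

Lemma vform_xx n (x : 'I_n -> H) : \sum_i dot (x i) (x i) = (vsq x)%:C.
Proof. by rewrite rmorph_sum; apply: eq_bigr => i _; rewrite dotxx. Qed.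

Lemma vform_ge0 n (x : 'I_n -> H) : 0 <= complex.Re (\sum_i dot (x i) (x i)).
Proof. by rewrite vform_xx /= vsq_ge0. Qed.

Definition vform n : psd_form ('I_n -> H) :=
  PsdForm (@vform_Dl n) (@vform_Zl n) (@vform_C n) (@vform_ge0 n).

Lemma pnrm_vform n (x : 'I_n -> H) : pnrm (vform n) x ^+ 2 = vsq x.
Proof. by rewrite pnrm_sqr /= vform_xx. Qed.

Definition mxadj m n (a : 'M[H -> H]_(m, n)) : 'M[H -> H]_(n, m) :=
  \matrix_(j, i) adjoint (a i j).

Lemma mxadjP m n (a : 'M[H -> H]_(m, n)) : bounded_mx a -> forall xi eta,
  vform m (mxop a xi) eta = vform n xi (mxop (mxadj a) eta).
Proof.
move=> ba xi eta; rewrite /= /mxop.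
under eq_bigr do rewrite dot_suml.
under [RHS]eq_bigr do rewrite dot_sumr.
rewrite exchange_big; apply: eq_bigr => j _; apply: eq_bigr => i _.
by rewrite mxE adjointP.
Qed.

Lemma bounded_mxadj m n (a : 'M[H -> H]_(m, n)) : bounded_mx a -> bounded_mx (mxadj a).
Proof. by move=> ba i j; rewrite mxE; exact: bounded_adjoint. Qed.

Lemma mxadjK m n (a : 'M[H -> H]_(m, n)) : bounded_mx a -> mxadj (mxadj a) = a.
Proof. by move=> ba; apply/matrixP => i j; rewrite !mxE adjointK. Qed.

Lemma mx_opnorm_adj m n (a : 'M[H -> H]_(m, n)) : bounded_mx a ->
  mx_opnorm (mxadj a) = mx_opnorm a.
Proof.
have h p q (b : 'M[H -> H]_(p, q)) : bounded_mx b -> mx_opnorm (mxadj b) <= mx_opnorm b.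
  move=> bb; apply: mx_opnorm_le; first exact: mx_opnorm_ge0.
  move=> eta; rewrite -!pnrm_vform -exprMn ler_pXn2r ?nnegrE ?mulr_ge0 ?pnrm_ge0 ?mx_opnorm_ge0//.
  set z := mxop (mxadj b) eta.
  have := cauchy_schwarz (vform p) (mxop b z) eta.
  rewrite mxadjP// -/z (pform_real (vform q)) -pnrm_sqr nrmc_real ger0_norm ?sqr_ge0//.
  have : pnrm (vform p) (mxop b z) <= mx_opnorm b * pnrm (vform q) z.
    rewrite -(@ler_pXn2r _ 2) ?nnegrE ?mulr_ge0 ?pnrm_ge0 ?mx_opnorm_ge0//.
    by rewrite exprMn !pnrm_vform; exact: mx_opnormP.
  have := pnrm_ge0 (vform p) eta; have := pnrm_ge0 (vform q) z; have := mx_opnorm_ge0 b.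
  set s := pnrm _ z; set t := pnrm _ eta; set w := pnrm _ _; set M := mx_opnorm b.
  move=> M0 s0 t0 h1 h2.
  have : s * s <= (M * t) * s by rewrite -expr2; nra.
  move: s0; rewrite le_eqVlt => /predU1P[<- _|s0]; first by rewrite mulr_ge0.
  by rewrite ler_pM2r.
move=> ba; apply/eqP; rewrite eq_le h//=.
by rewrite -{1}(mxadjK ba) h//; exact: bounded_mxadj.
Qed.

End OpNormTheory.

Section CompletelyContractive.
Context {R : realType} {H K : hilbertType R}.
Variables (A : set (H -> H)) (f : (H -> H) -> (K -> K)).
Hypotheses (A0 : A 0) (f0 : f 0 = 0) (bA : A `<=` bounded_operator)
  (bf : forall T, A T -> bounded_operator (f T)) (cf : completely_contractive A f).

(* Complete contractivity concerns square matrices; a rectangular one is padded with zeros. *)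
Lemma rect_contractive m n (a : 'M[H -> H]_(m, n)) : (forall i j, A (a i j)) ->
  mx_opnorm (map_mx f a) <= mx_opnorm a.
Proof.
move=> Aa.
pose b : 'M[H -> H]_(m + n) := block_mx 0 a 0 0.
have Ab i j : A (b i j).
  rewrite /b; case: (split_ordP i) => k ->; case: (split_ordP j) => l ->;
    by rewrite ?(block_mxEul, block_mxEur, block_mxEdl, block_mxEdr) ?mxE.
have fb : map_mx f b = block_mx 0 (map_mx f a) 0 0.
  rewrite /b map_block_mx; congr block_mx; apply/matrixP => i j; by rewrite !mxE.
have vsqD (E : hilbertType R) (xi : 'I_(m + n) -> E) :
    vsq xi = vsq (xi \o lshift n) + vsq (xi \o @rshift m n).
  by rewrite /vsq big_split_ord.
have opl (E : hilbertType R) (c : 'M[E -> E]_(m, n)) (xi : 'I_(m + n) -> E) :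
    mxop (block_mx 0 c 0 0) xi \o lshift n = mxop c (xi \o @rshift m n).
  apply/funext => i; rewrite /mxop /= big_split_ord /= big1 ?add0r.
    by apply: eq_bigr => j _; rewrite block_mxEur.
  by move=> j _; rewrite block_mxEul mxE.
have opr (E : hilbertType R) (c : 'M[E -> E]_(m, n)) (xi : 'I_(m + n) -> E) :
    mxop (block_mx 0 c 0 0) xi \o @rshift m n = 0.
  apply/funext => i; rewrite /mxop /= big_split_ord /= !big1 ?addr0//.
    by move=> j _; rewrite block_mxEdr mxE.
  by move=> j _; rewrite block_mxEdl mxE.
have vsq0 (E : hilbertType R) p : vsq (0 : 'I_p -> E) = 0.
  by rewrite /vsq big1// => i _; rewrite nrm0 expr0n.
have opb : mx_opnorm b <= mx_opnorm a.
  apply: mx_opnorm_le; first exact: mx_opnorm_ge0.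
  move=> xi; rewrite (vsqD _ (mxop b xi)) /b opl opr vsq0 addr0.
  apply: le_trans (mx_opnormP _ _) _; first by move=> i j; exact: bA.
  by rewrite ler_wpM2l ?sqr_ge0// (vsqD _ xi) lerDr vsq_ge0.
apply: le_trans opb; apply: le_trans (cf Ab).
apply: mx_opnorm_le; first exact: mx_opnorm_ge0.
(* Extending [eta] by zero isolates the nonzero corner of the padded matrix. *)
move=> eta; pose xi (k : 'I_(m + n)) : K := match fintype.split k with inl _ => 0 | inr j => eta j end.
have xir : xi \o @rshift m n = eta.
  apply/funext => j; rewrite /xi /=; case: fintype.splitP => k /= hk.
    by have := ltn_ord k; rewrite -hk ltnNge leq_addr.
  by congr eta; apply: val_inj; apply: (@addnI m).
have xil : xi \o lshift n = 0.
  apply/funext => j; rewrite /xi /=; case: fintype.splitP => k //= hk.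
  by have := ltn_ord j; rewrite hk ltnNge leq_addr.
have bb : bounded_mx (map_mx f b) by move=> i j; rewrite mxE; exact: bf.
have := mx_opnormP bb xi.
by rewrite (vsqD _ (mxop _ xi)) (vsqD _ xi) {1 2}fb opl opr xir xil !vsq0 add0r addr0.
Qed.

End CompletelyContractive.

(** * Banach *-algebras *)

Section BanachStar.
Context {R : realType} {F : algType R[i]}.
Variables (N : F -> R) (s : F -> F).
Hypotheses (nN : complete_algebra_norm N) (iN : isometric_involution N s).
Implicit Types (x y z h : F).

Lemma can0 : N 0 = 0.
Proof.
by have := canZ nN 0 0; rewrite scaler0 normr0 mul0r => -[].
Qed.

Lemma canZn (c : R[i]) x : N (c *: x) = nrm c * N x.
Proof. by have := canZ nN c x; rewrite normE -rmorphM => -[]. Qed.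

Lemma canZr (r : R) x : N (r%:C *: x) = `|r| * N x.
Proof. by rewrite canZn nrmc_real. Qed.

Lemma canN x : N (- x) = N x.
Proof. by rewrite -scaleN1r canZn nrmN /nrm normr1 mul1r. Qed.

Lemma canB x y : N (x - y) = N (y - x).
Proof. by rewrite -canN opprB. Qed.

Lemma can_ge0 x : 0 <= N x.
Proof.
have := canD nN x (- x); rewrite subrr can0 canN -mulr2n.
by rewrite pmulrn_lge0.
Qed.

Lemma can_dist x y z : N (x - z) <= N (x - y) + N (y - z).
Proof. by have := canD nN (x - y) (y - z); rewrite addrA addrNK. Qed.

Lemma can_lim_eq x y (M : R) : (forall e : R, 0 < e -> N (x - y) <= M * e) -> x = y.
Proof.
move=> h; apply/eqP; rewrite -subr_eq0; apply/eqP/(can_eq0 nN)/eqP.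
rewrite eq_le can_ge0 andbT; apply: le_add_eps => e e0; rewrite add0r.
have M1 : 0 < `|M| + 1 by rewrite ltr_wpDl.
apply: (le_trans (h (e / (`|M| + 1)) _)); first by rewrite divr_gt0.
apply: (@le_trans _ _ (`|M| * (e / (`|M| + 1)))).
  by rewrite ler_wpM2r ?ler_norm// ltW// divr_gt0.
by rewrite mulrCA ler_piMr ?(ltW e0)// ler_pdivrMr// mul1r lerDl.
Qed.

Lemma inv0 : s 0 = 0.
Proof. by have := invZ iN 0 0; rewrite conjc0 !scale0r. Qed.

Lemma inv1 : s 1 = 1.
Proof. by have := invM iN 1 (s 1); rewrite mul1r (Defs.invK iN) mul1r => <-. Qed.

Lemma invN x : s (- x) = - s x.
Proof. by rewrite -scaleN1r (invZ iN) conjcN conjc1 scaleN1r. Qed.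

Lemma invB x y : s (x - y) = s x - s y.
Proof. by rewrite (invD iN) invN. Qed.

Lemma invZr (r : R) x : s (r%:C *: x) = r%:C *: s x.
Proof. by rewrite (invZ iN) conjc_real. Qed.

Lemma inv_sum I (r : seq I) (P : pred I) (f : I -> F) :
  s (\sum_(i <- r | P i) f i) = \sum_(i <- r | P i) s (f i).
Proof. by apply: (big_morph s) => [x y|]; [exact: (invD iN)|exact: inv0]. Qed.

Section SquareRoot.
Variable h : F.
Hypotheses (sh : s h = h) (h1 : N h < 1).

Let phi y : F := (2^-1 : R)%:C *: (h + y * y).

(** [y y - z z = y (y - z) + (y - z) z] holds without commutation. On the ball of radius [N h < 1]
    it makes [phi] a contraction. *)
Let phi_lip (M : R) y z : N y <= M -> N z <= M -> N (phi y - phi z) <= M * N (y - z).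
Proof.
move=> yM zM; rewrite /phi -scalerBr canZr ger0_norm ?invr_ge0//.
have -> : h + y * y - (h + z * z) = y * (y - z) + (y - z) * z.
  by rewrite opprD addrACA subrr add0r mulrBr mulrBl addrA addrNK.
rewrite mulrC ler_pdivrMr// mulr_natr mulr2n; apply: le_trans (canD nN _ _) _.
apply: lerD; apply: le_trans (canM nN _ _) _; first by rewrite ler_wpM2r ?can_ge0.
by rewrite mulrC ler_wpM2r ?can_ge0.
Qed.

Let u n : F := iter n phi 0.

Let u_bound n : N (u n) <= N h.
Proof.
elim: n => [|n IH] /=; first by rewrite can0 can_ge0.
rewrite /phi canZr ger0_norm ?invr_ge0// mulrC ler_pdivrMr//.
apply: le_trans (canD nN _ _) _; rewrite mulr_natr mulr2n lerD2l.
apply: le_trans (canM nN _ _) _; rewrite (le_trans (ler_pM _ _ IH IH)) ?can_ge0//.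
by rewrite ler_piMr ?can_ge0// ltW.
Qed.

Let u_star n : s (u n) = u n.
Proof.
elim: n => [|n IH] /=; first exact: inv0.
by rewrite /phi invZr (invD iN) (invM iN) IH sh.
Qed.

Let u_contract n k : N (u (n + k)%N - u n) <= N h ^+ n.
Proof.
elim: n => [|n IH]; first by rewrite subr0 expr0 (le_trans (u_bound _))// ltW.
rewrite addSn /= exprS (le_trans (phi_lip (u_bound _) (u_bound _)))//.
by rewrite ler_wpM2l ?can_ge0.
Qed.

Let h_exp (e : R) : 0 < e -> exists n0 : nat, forall n, (n0 <= n)%N -> N h ^+ n < e.
Proof.
move=> e0; have : `|N h| < 1 by rewrite ger0_norm ?can_ge0.
move=> /cvg_expr/cvgrPdist_lt/(_ _ e0)[n0 _ H]; exists n0 => n hn.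
by have := H n hn; rewrite sub0r normrN ger0_norm// exprn_ge0// can_ge0.
Qed.

(* The limit of y := (h + y ^ 2) / 2 is 1 - sqrt (1 - h). *)
Lemma selfadjoint_sqrt : exists2 y, s y = y & 1 - h = y * y.
Proof.
have [l ul] : exists l, forall e : R, 0 < e -> exists n0 : nat, forall n : nat,
     (n0 <= n)%N -> N (u n - l) < e.
  apply: (can_complete nN) => e e0; have [n0 hn0] := h_exp e0; exists n0 => m n hm hn.
  have [mn|/ltnW nm] := leqP m n.
    rewrite canB -(subnKC mn); apply: le_lt_trans (u_contract _ _) _; exact: hn0.
  rewrite -(subnKC nm); apply: le_lt_trans (u_contract _ _) _; exact: hn0.
have sl : s l = l.
  apply: (@can_lim_eq _ _ 2) => e e0; have [n0 /(_ n0 (leqnn _)) hl] := ul e e0.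
  apply: le_trans (can_dist _ (u n0) _) _.
  rewrite -[X in N (s l - X)]u_star -invB (inv_norm iN) canB; lra.
(* [N l + 1] bounds both [l] and the late [u n]. Continuity of [phi] at [l] is all that is wanted
   here, so this larger Lipschitz constant does no harm. *)
have pl : l = phi l.
  apply: (@can_lim_eq _ _ (1 + (N l + 1))) => e e0.
  have [n0 h0] := ul e e0; have [n2 h2] := ul 1 ltr01; pose n := (n0 + n2)%N.
  have a1 := h0 n.+1 (leqW (leq_addr _ _)); have a2 := h2 n (leq_addl _ _).
  have a3 := h0 n (leq_addr _ _).
  apply: le_trans (can_dist _ (u n.+1) _) _; rewrite mulrDl mul1r.
  apply: lerD; first by rewrite canB ltW.
  have Nl : 0 <= N l by exact: can_ge0.
  apply: le_trans (@phi_lip (N l + 1) _ _ _ _) _; last 1 first.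
  - by rewrite ler_wpM2l ?addr_ge0// ltW.
  - have := can_dist (u n) l 0; rewrite !subr0; lra.
  - by rewrite lerDl.
exists (1 - l); first by rewrite invB inv1 sl.
have hE : h = l + l - l * l.
  have /(congr1 (fun z => (2 : R)%:C *: z)) := pl.
  rewrite /phi scalerA -rmorphM divff// scale1r => e2.
  rewrite -{1}(addrK (l * l) h) -e2; congr (_ - _).
  by rewrite (_ : 2%:C = 1 + 1) ?scalerDl ?scale1r// rmorphD rmorph1.
by rewrite mulrBl !mulrBr !mul1r mulr1 {1}hE -[RHS]addrA -opprD addrA.
Qed.

End SquareRoot.
End BanachStar.

(** * The seminorm gamma *)

Section SumsOfSquares.
Context {R : realType} {F : algType R[i]}.
Variables (N : F -> R) (s : F -> F).
Hypothesis iN : isometric_involution N s.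
Implicit Types (x y z h : F) (t u : R).

(** Positivity of 1-by-1 matrices, with lists in place of columns: for a column [y], the product
    [y# y] is the sum of [s z * z] over the entries [z] of [y]. *)
Definition sos x : Prop := exists zs : seq F, x = \sum_(z <- zs) s z * z.

Lemma sos0 : sos 0.
Proof. by exists [::]; rewrite big_nil. Qed.

Lemma sos_sqr x : sos (s x * x).
Proof. by exists [:: x]; rewrite big_seq1. Qed.

Lemma sosD x y : sos x -> sos y -> sos (x + y).
Proof. by move=> [xs ->] [ys ->]; exists (xs ++ ys); rewrite big_cat. Qed.

Lemma sos_sum I (r : seq I) (P : pred I) (f : I -> F) :
  (forall i, P i -> sos (f i)) -> sos (\sum_(i <- r | P i) f i).
Proof. by move=> h; apply: big_ind => //; [exact: sos0|exact: sosD]. Qed.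

Lemma sosZ t x : 0 <= t -> sos x -> sos (t%:C *: x).
Proof.
move=> t0 [zs ->]; exists [seq (Num.sqrt t)%:C *: z | z <- zs].
rewrite big_map scaler_sumr; apply: eq_bigr => z _.
by rewrite (invZr iN) -scalerAl -scalerAr scalerA -rmorphM -expr2 sqr_sqrtr.
Qed.

Lemma sosZ_gt t x : 0 < t -> sos (t%:C *: x) -> sos x.
Proof.
move=> t0 h; have := @sosZ t^-1 _ _ h.
rewrite scalerA -rmorphM mulVf ?gt_eqF// scale1r; apply.
by rewrite invr_ge0 ltW.
Qed.

Lemma sos_conj x y : sos x -> sos (s y * x * y).
Proof.
move=> [zs ->]; exists [seq z * y | z <- zs].
rewrite big_map mulr_sumr mulr_suml; apply: eq_bigr => z _.
by rewrite (invM iN) !mulrA.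
Qed.

Lemma sos_real t : 0 <= t -> sos (t%:C)%:A.
Proof. by move=> t0; apply: sosZ => //; rewrite -[1]mulr1 -{1}(inv1 iN); exact: sos_sqr. Qed.

Lemma mx_starM m n p (a : 'M[F]_(m, n)) (b : 'M[F]_(n, p)) :
  mx_star s (a *m b) = mx_star s b *m mx_star s a.
Proof.
apply/matrixP => i j; rewrite !mxE (inv_sum iN); apply: eq_bigr => k _.
by rewrite !mxE (invM iN).
Qed.

Lemma mx_starK m n (a : 'M[F]_(m, n)) : mx_star s (mx_star s a) = a.
Proof. by apply/matrixP => i j; rewrite !mxE (Defs.invK iN). Qed.

Lemma mx_star_scalar x : mx_star s (x%:M : 'M[F]_1) = (s x)%:M.
Proof. by apply/matrixP => i j; rewrite !mxE !ord1 eqxx !mulr1n. Qed.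

Lemma mx_star_row (a b : 'M[F]_1) : mx_star s (row_mx a b) = col_mx (mx_star s a) (mx_star s b).
Proof. by rewrite /mx_star map_row_mx tr_row_mx. Qed.

Lemma mx_star_col (a b : 'M[F]_1) : mx_star s (col_mx a b) = row_mx (mx_star s a) (mx_star s b).
Proof. by rewrite /mx_star map_col_mx tr_col_mx. Qed.

Lemma mx_positive_compress n (M : 'M[F]_n) (v : 'cV[F]_n) : mx_positive s M ->
  sos ((mx_star s v *m M *m v) 0 0).
Proof.
move=> [m [k [z [_ ->]]]]; rewrite mulmx_sumr mulmx_suml summxE.
apply: sos_sum => i _; rewrite mulmxA -mx_starM -mulmxA mxE.
apply: sos_sum => j _; rewrite !mxE; exact: sos_sqr.
Qed.

Lemma mx_positive_rows n (rs : seq 'rV[F]_n) :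
  mx_positive s (\sum_(r <- rs) mx_star s r *m r).
Proof.
exists (size rs), (fun=> 1%N), (fun i => nth 0 rs i); split=> //.
by rewrite (big_nth 0) big_mkord.
Qed.

(** The compression by the column [(u, v)], written out. Different columns give, up to a positive
    factor, positivity of [t^2 - x# x], of [t^2 - x x#] and of [2 t - (x + x#)], and the triangle
    inequality. *)
Lemma mx_positive_compress2 (a b c d u v : F) :
  mx_positive s (block_mx a%:M b%:M c%:M d%:M : 'M[F]_(1 + 1)) ->
  sos (s u * a * u + s v * c * u + (s u * b * v + s v * d * v)).
Proof.
move=> /(@mx_positive_compress _ _ (col_mx u%:M v%:M)).
rewrite mx_star_col !mx_star_scalar mul_row_block mul_row_col !mulmxDl -!scalar_mxM.
by rewrite !mxE !eqxx !mulr1n.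
Qed.

(* t [t x; x# t] = (t, x)# (t, x) + (0 (+) (t^2 - x# x)). *)
Lemma gamma_boundsE x :
  gamma_bounds s x = [set t | 0 < t /\ sos ((t ^+ 2)%:C%:A - s x * x)].
Proof.
apply/seteqP; split=> t /= [t0 h]; split=> //.
  move: h => /(@mx_positive_compress2 _ _ _ _ (- x) (t%:C)%:A) h.
  apply: (sosZ_gt t0); move: h; rewrite (invN iN) (invZr iN) (inv1 iN).
  rewrite -!(scalerAl, scalerAr) !mulr1 !mul1r !mulrN !mulNr opprK scalerA !scalerN.
  by rewrite subrr add0r addrC scalerBr !scalerA -!rmorphM.
set b := s x * x in h *; set B := block_mx _ _ _ _.
have [zs hz] := h.
pose rs := row_mx (t%:C)%:A%:M x%:M :: [seq row_mx 0 z%:M | z <- zs] : seq 'rV[F]_(1 + 1).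
have hB : (t%:C)%:A%:M *m B = \sum_(r <- rs) mx_star s r *m r.
  rewrite big_cons big_map.
  have -> : \sum_(z <- zs) mx_star s (row_mx 0 z%:M) *m row_mx 0 z%:M
      = block_mx 0 0 0 (\sum_(z <- zs) s z * z)%:M :> 'M[F]_(1 + 1).
    elim: zs {hz rs} => [|z zs IH]; first by rewrite !big_nil raddf0 block_mx0.
    rewrite !big_cons IH mx_star_row mx_star_scalar mul_col_row !mulmx0 -scalar_mxM.
    rewrite (_ : mx_star s 0 = 0); last by apply/matrixP => i j; rewrite !mxE (inv0 iN).
    by rewrite !mul0mx add_block_mx !addr0 raddfD.
  rewrite -hz mx_star_row !mx_star_scalar mul_col_row -!scalar_mxM add_block_mx !addr0.
  rewrite -raddfD addrC subrK (invZr iN) (inv1 iN) /=.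
  rewrite /B scalar_mx_block mulmx_block !mul0mx !addr0 !add0r -!scalar_mxM.
  rewrite -!(scalerAl, scalerAr) !mul1r mulr1 !scalerA -rmorphM -expr2.
  by [].
have : mx_positive s ((t%:C)%:A%:M *m B) by rewrite hB; exact: mx_positive_rows.
move=> [m [k [z [k0 zE]]]].
(* [B] was multiplied by [t]; the factor [1 / t] that undoes this is absorbed as [r ^+ 2] into the
   squares. *)
pose r := Num.sqrt t^-1.
exists m, k, (fun i => ((r%:C)%:A)%:M *m z i); split=> //.
have -> : B = (((t^-1)%:C)%:A)%:M *m ((t%:C)%:A%:M *m B).
  by rewrite mulmxA -scalar_mxM -scalerAl mul1r scalerA -rmorphM mulVf ?gt_eqF// scale1r mul1mx.
rewrite zE mulmx_sumr; apply: eq_bigr => i _.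
have scE c p q (a : 'M[F]_(p, q)) : (c%:A)%:M *m a = map_mx (fun y => c *: y) a.
  by apply/matrixP => i1 j1; rewrite mul_scalar_mx !mxE -scalerAl mul1r.
rewrite !scE; apply/matrixP => i1 j1; rewrite !mxE scaler_sumr; apply: eq_bigr => l _.
rewrite !mxE (invZr iN) -scalerAl -scalerAr scalerA -rmorphM -expr2 sqr_sqrtr//.
by rewrite invr_ge0 ltW.
Qed.

End SumsOfSquares.

Section Gamma.
Context {R : realType} {F : algType R[i]}.
Variables (N : F -> R) (s : F -> F).
Hypotheses (nN : complete_algebra_norm N) (iN : isometric_involution N s).
Implicit Types (x y z h : F) (t u : R).

Local Notation gb := (gamma_bounds s).
Local Notation gam := (gamma s).

Let gbE x t : gb x t <-> 0 < t /\ sos s ((t ^+ 2)%:C%:A - s x * x).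
Proof. by rewrite (gamma_boundsE iN). Qed.

Lemma gamma_bounds_le x t u : gb x t -> t <= u -> gb x u.
Proof.
move=> /gbE[t0 h] tu; apply/gbE; split; first exact: lt_le_trans tu.
have -> : (u ^+ 2)%:C%:A - s x * x = (u ^+ 2 - t ^+ 2)%:C%:A + ((t ^+ 2)%:C%:A - s x * x).
  by rewrite addrA -scalerDl -rmorphD subrK.
apply: sosD => //; apply: (sos_real iN).
by rewrite subr_ge0 ler_pXn2r ?nnegrE ?(ltW t0)// (le_trans (ltW t0)).
Qed.

Lemma gamma_boundsN x t : N x < t -> gb x t.
Proof.
move=> xt; have t0 : 0 < t by apply: le_lt_trans xt; exact: can_ge0.
apply/gbE; split=> //.
pose y := (t^-1)%:C *: x.
have sy : s (s y * y) = s y * y by rewrite (invM iN) (Defs.invK iN).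
have Ny : N y < 1.
  rewrite /y (canZr nN) ger0_norm ?invr_ge0 ?(ltW t0)//.
  by rewrite mulrC ltr_pdivrMr// mul1r.
have [|w sw e] := selfadjoint_sqrt nN iN sy.
  apply: le_lt_trans (canM nN _ _) _; rewrite (inv_norm iN).
  by rewrite mulr_ilt1 ?(can_ge0 nN).
have -> : (t ^+ 2)%:C%:A - s x * x = (t ^+ 2)%:C *: (s w * w).
  rewrite sw -e scalerBr /y (invZr iN) -scalerAl -scalerAr !scalerA -!rmorphM.
  by rewrite expr2 mulfK ?gt_eqF// mulfV ?gt_eqF// rmorph1 scale1r.
by apply: (sosZ iN); [exact: sqr_ge0|exact: sos_sqr].
Qed.

Lemma gamma_bounds_neq0 x : gb x !=set0.
Proof. by exists (N x + 1); apply: gamma_boundsN; rewrite ltrDl. Qed.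

Lemma gamma_bounds_lb x : has_lbound (gb x).
Proof. by exists 0 => t /gbE[/ltW]. Qed.

Lemma gamma_ge0 x : 0 <= gam x.
Proof. by apply: lb_le_inf; [exact: gamma_bounds_neq0|move=> t /gbE[/ltW]]. Qed.

Lemma gamma_le x t : gb x t -> gam x <= t.
Proof. by move=> h; apply: ge_inf => //; exact: gamma_bounds_lb. Qed.

Lemma gamma_lt x t : gam x < t -> gb x t.
Proof. by move=> /(inf_lt (gamma_bounds_neq0 x))[u hu /ltW]; exact: gamma_bounds_le. Qed.

Lemma gamma_leP x t : 0 <= t -> (forall u, t < u -> gb x u) -> gam x <= t.
Proof.
move=> t0 h; apply: le_add_eps => e e0; apply: gamma_le; apply: h.
by rewrite ltrDl.
Qed.

Lemma gamma_le_norm x : gam x <= N x.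
Proof. by apply: gamma_leP => [|u]; [exact: can_ge0|exact: gamma_boundsN]. Qed.

Lemma gamma_compress x t (u v : F) : gb x t ->
  sos s (s u * (t%:C)%:A * u + s v * s x * u + (s u * x * v + s v * (t%:C)%:A * v)).
Proof. by move=> [t0]; exact: (mx_positive_compress2 iN). Qed.

Lemma gamma_bounds_star x t : gb x t -> gb (s x) t.
Proof.
move=> h; have t0 : 0 < t by case/gbE: h.
apply/gbE; split=> //; apply: (sosZ_gt iN t0).
have := gamma_compress ((t%:C)%:A) (- s x) h.
rewrite (invZr iN) (inv1 iN) (invN iN) !(Defs.invK iN).
rewrite -!(scalerAl, scalerAr) !mulr1 !mul1r !mulrN !mulNr opprK !scalerA !scalerN.
by rewrite addrA subrK scalerBr !scalerA -!rmorphM.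
Qed.

Lemma gamma_star x : gam (s x) = gam x.
Proof.
have h y : gam (s y) <= gam y.
  by apply: gamma_leP => [|u /gamma_lt]; [exact: gamma_ge0|exact: gamma_bounds_star].
by apply/eqP; rewrite eq_le h -{1}(Defs.invK iN x) h.
Qed.

Lemma gamma_bounds_re x t : gb x t -> sos s ((t *+ 2)%:C%:A - (x + s x)).
Proof.
move=> h; have := gamma_compress 1 (- 1) h.
rewrite (invN iN) (inv1 iN) !(mulN1r, mulrN1, mul1r, mulr1, opprK).
by rewrite [- x + _]addrC addrACA -opprD (addrC (s x)) mulr2n rmorphD scalerDl.
Qed.

Lemma gamma_bounds_scale (c : R[i]) x t : gb x t -> c != 0 -> gb (c *: x) (nrm c * t).
Proof.
move=> /gbE[t0 h] c0.
have nc : 0 < nrm c.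
  by rewrite lt_def nrm_ge0 andbT; apply: contra_neq c0 => /nrm_eq0.
apply/gbE; split; first exact: mulr_gt0.
rewrite (invZ iN) -scalerAl -scalerAr scalerA (mulrC (conjc c)) mulcJ.
rewrite exprMn rmorphM -scalerA -scalerBr.
by apply: (sosZ iN) => //; exact: sqr_ge0.
Qed.

Lemma gammaZ (c : R[i]) x : gam (c *: x) = nrm c * gam x.
Proof.
have g0 : gam 0 = 0.
  apply/eqP; rewrite eq_le gamma_ge0 andbT.
  by rewrite (le_trans (gamma_le_norm 0))// (can0 nN).
have [->|c0] := eqVneq c 0; first by rewrite scale0r nrm0 mul0r.
have nc (d : R[i]) : d != 0 -> 0 < nrm d.
  by move=> d0; rewrite lt_def nrm_ge0 andbT; apply: contra_neq d0 => /nrm_eq0.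
have h (d : R[i]) y : d != 0 -> gam (d *: y) <= nrm d * gam y.
  move=> d0; apply: gamma_leP; first by rewrite mulr_ge0 ?nrm_ge0 ?gamma_ge0.
  move=> u; rewrite mulrC -ltr_pdivlMr ?nc// => /gamma_lt/gamma_bounds_scale/(_ d0).
  by rewrite mulrCA divff ?mulr1// gt_eqF// nc.
apply/eqP; rewrite eq_le h//= -ler_pdivlMl ?nc//.
have := h c^-1 (c *: x); rewrite scalerA mulVf// scale1r invr_eq0 => /(_ c0).
suff -> : nrm c^-1 = (nrm c)^-1 by [].
apply: (mulfI (lt0r_neq0 (nc _ c0))); rewrite divff ?gt_eqF ?nc// -nrmcM divff//.
by rewrite /nrm normr1.
Qed.

(** The two positive blocks add up to the block of [x + y] with [t + u] on the diagonal. Compressing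
    each of them by the same column [(- (x + y), t + u)] performs this addition inside [sos]. *)
Lemma gamma_boundsD x y t u : gb x t -> gb y u -> gb (x + y) (t + u).
Proof.
move=> /gbE[t0 hx] /gbE[u0 hy]; apply/gbE; split; first exact: addr_gt0.
have := sosD (gamma_compress (- (x + y)) ((t + u)%:C)%:A (proj2 (gbE x t) (conj t0 hx)))
  (gamma_compress (- (x + y)) ((t + u)%:C)%:A (proj2 (gbE y u) (conj u0 hy))).
set U := - (x + y); set V := ((t + u)%:C)%:A.
have -> : s U * t%:C%:A * U + s V * s x * U + (s U * x * V + s V * t%:C%:A * V)
    + (s U * u%:C%:A * U + s V * s y * U + (s U * y * V + s V * u%:C%:A * V))
  = s U * (t + u)%:C%:A * U + s V * s (x + y) * U
    + (s U * (x + y) * V + s V * (t + u)%:C%:A * V).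
  rewrite (invD iN) rmorphD scalerDl !mulrDr !(mulrDl _ _ U) !(mulrDl _ _ V).
  by rewrite (addrACA (_ * t%:C%:A * U + _)) (addrACA (_ * t%:C%:A * U)) (addrACA (_ * x * V)).
move=> h; apply: (@sosZ_gt _ _ _ _ iN (t + u)); first exact: addr_gt0.
move: h; rewrite /U /V; set r := t + u; set z := x + y.
rewrite (invN iN) (invZr iN) (inv1 iN).
rewrite -!(scalerAl, scalerAr) !mulr1 !mul1r !mulrN !mulNr opprK scalerA !scalerN.
by rewrite subrr add0r addrC scalerBr !scalerA -!rmorphM.
Qed.

Lemma gammaD x y : gam (x + y) <= gam x + gam y.
Proof.
apply: le_add_eps => e e0.
have -> : gam x + gam y + e = (gam x + e / 2) + (gam y + e / 2) by lra.
by apply: gamma_le; apply: gamma_boundsD; apply: gamma_lt; rewrite ltrDl divr_gt0.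
Qed.

Lemma gamma_boundsM x y t u : gb x t -> gb y u -> gb (x * y) (t * u).
Proof.
move=> /gbE[t0 hx] /gbE[u0 hy]; apply/gbE; split; first exact: mulr_gt0.
have -> : ((t * u) ^+ 2)%:C%:A - s (x * y) * (x * y)
   = (t ^+ 2)%:C *: ((u ^+ 2)%:C%:A - s y * y) + s y * ((t ^+ 2)%:C%:A - s x * x) * y.
  rewrite (invM iN) mulrBr mulrBl -scalerAr mulr1 -scalerAl scalerBr scalerA -rmorphM.
  by rewrite -exprMn !mulrA addrA subrK.
apply: sosD; last exact: (sos_conj iN).
by apply: (sosZ iN) => //; exact: sqr_ge0.
Qed.

Lemma gammaM x y : gam (x * y) <= gam x * gam y.
Proof.
have gx := gamma_ge0 x; have gy := gamma_ge0 y.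
apply: le_add_eps => e e0.
pose d := Num.min 1 (e / (gam x + gam y + 1)).
have D0 : 0 < gam x + gam y + 1 by rewrite ltr_wpDl// addr_ge0.
have d0 : 0 < d by rewrite lt_min ltr01 divr_gt0.
have d1 : d <= 1 by rewrite ge_min lexx.
have d2 : d * (gam x + gam y + 1) <= e by rewrite -ler_pdivlMr// ge_min lexx orbT.
apply: (@le_trans _ _ ((gam x + d) * (gam y + d))).
  by apply: gamma_le; apply: gamma_boundsM; apply: gamma_lt; rewrite ltrDl.
have : d * d <= d by rewrite ler_piMr// ltW.
move: d2 d1 d0; clearbody d; nra.
Qed.

(** Compressing the block of the selfadjoint element [x# x] by the column [(1, -1)] leaves
    [2 (t - x# x)]. This is the hard half of the C*-identity. *)
Lemma gamma_bounds_sq x t : gb (s x * x) t -> gb x (Num.sqrt t).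
Proof.
move=> h; have t0 : 0 < t by case/gbE: h.
apply/gbE; rewrite sqrtr_gt0 sqr_sqrtr ?ltW//; split=> //.
have := gamma_bounds_re h; rewrite (invM iN) (Defs.invK iN).
rewrite mulr2n rmorphD scalerDl opprD addrACA => h2.
by apply: (@sosZ_gt _ _ _ _ iN 2) => //; rewrite (_ : 2%:C = 1 + 1) ?scalerDl ?scale1r// rmorphD rmorph1.
Qed.

Lemma gamma_cstar x : gam (s x * x) = gam x ^+ 2.
Proof.
apply/eqP; rewrite eq_le; apply/andP; split.
  by rewrite (le_trans (gammaM _ _))// gamma_star expr2.
apply: le_add_eps => e e0.
have /gamma_lt/gamma_bounds_sq/gamma_le h : gam (s x * x) < gam (s x * x) + e by rewrite ltrDl.
have g0 : 0 <= gam (s x * x) + e by rewrite addr_ge0 ?gamma_ge0 ?ltW.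
by rewrite -(sqr_sqrtr g0) ler_pXn2r ?nnegrE ?sqrtr_ge0 ?gamma_ge0.
Qed.

Lemma gamma_cstar_seminorm : cstar_seminorm s gam.
Proof.
split; [exact: gamma_ge0|exact: gammaD| |exact: gammaM|exact: gamma_cstar].
by move=> c x; rewrite gammaZ normE rmorphM.
Qed.

End Gamma.

(** * States and the GNS construction *)

Section State.
Context {R : realType} {F : algType R[i]}.
Variables (N : F -> R) (s : F -> F).
Hypotheses (nN : complete_algebra_norm N) (iN : isometric_involution N s).
Implicit Types (x y z h : F) (t u r : R) (Q : set F).

Local Notation gb := (gamma_bounds s).
Local Notation gam := (gamma s).

Record real_cone Q : Prop := {
  coneD : forall x y, Q x -> Q y -> Q (x + y);
  coneZ : forall t x, 0 <= t -> Q x -> Q (t%:C *: x) }.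

(** Elements whose real part is a sum of squares. Every [x - s x] lies in [P0] together with its
    negative, so a functional that is nonnegative on [P0] is invariant under [s]. *)
Let P0 : set F := [set x | sos s (x + s x)].

Let P0_sos x : sos s x -> s x = x -> P0 x.
Proof. by move=> h e; rewrite /P0 /= e; exact: sosD. Qed.

Let P0_real t : 0 <= t -> P0 (t%:C)%:A.
Proof.
by move=> t0; apply: P0_sos; [exact: (sos_real iN)|rewrite (invZr iN) (inv1 iN)].
Qed.

Section FromMaximalCone.
Variable Q : set F.
Hypotheses (cQ : real_cone Q) (QP : P0 `<=` Q) (Q1 : ~ Q (- 1))
  (totQ : forall x, Q x \/ Q (- x)).

Let Qreal r : Q (r%:C)%:A -> 0 <= r.
Proof.
move=> h; rewrite leNgt; apply/negP => r0; apply: Q1.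
have := @coneZ _ cQ (- r^-1) _ _ h; rewrite scalerA -rmorphM mulNr mulVf ?lt_eqF//.
by rewrite rmorphN rmorph1 scaleN1r; apply; rewrite oppr_ge0 invr_le0 ltW.
Qed.

Let S x : set R := [set r | Q ((r%:C)%:A - x)].

Let Sgb x t : gb x t -> S x t.
Proof.
move=> h; apply: QP; rewrite /P0 /= (invB iN) (invZr iN) (inv1 iN).
by have := gamma_bounds_re iN h; rewrite mulr2n rmorphD scalerDl addrACA opprD.
Qed.

Let gbN x t : gb x t -> gb (- x) t.
Proof.
by rewrite !(gamma_boundsE iN) /= (invN iN) mulrNN.
Qed.

Let S_lb x t r : gb x t -> S x r -> - t <= r.
Proof.
move=> /gbN/Sgb h1 h2; rewrite -subr_ge0 opprK; apply: Qreal.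
have := coneD cQ h2 h1; rewrite opprK addrACA addNr addr0.
by rewrite -scalerDl -rmorphD.
Qed.

(** Any [t] in [gamma_bounds s x] puts [t - x] and [t + x] into [Q]: the first makes [S x] nonempty,
    the second bounds it below because [Q] omits -1. *)
Let S_inf x : has_inf (S x).
Proof.
have [t ht] := gamma_bounds_neq0 nN iN x; split; first by exists t; exact: Sgb.
by exists (- t) => r; exact: S_lb.
Qed.

Let f x : R := inf (S x).

Let S_up x r u : S x r -> r <= u -> S x u.
Proof.
move=> h ru; have := coneD cQ h (QP (P0_real (ltac:(by rewrite subr_ge0) : 0 <= u - r))).
by rewrite addrAC -scalerDl -rmorphD (addrC r) subrK.
Qed.

Let f_le x r : S x r -> f x <= r.
Proof. by move=> h; apply: ge_inf => //; case: (S_inf x). Qed.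

Let f_lt x r : f x < r -> S x r.
Proof.
by move=> /(inf_lt (proj1 (S_inf x)))[u hu /ltW]; exact: S_up.
Qed.

(** By totality, [x - r] itself lies in [Q] for [r] below the cut. So [f x] is also a supremum,
    which makes [f] superadditive. *)
Let f_gt x r : r < f x -> Q (x - (r%:C)%:A).
Proof.
move=> h; rewrite -opprB; case: (totQ ((r%:C)%:A - x)) => // /f_le.
by rewrite leNgt h.
Qed.

Let f_ge x r : Q (x - (r%:C)%:A) -> r <= f x.
Proof.
move=> h; apply: lb_le_inf => [|u hu]; first by case: (S_inf x).
rewrite -subr_ge0; apply: Qreal; have := coneD cQ hu h.
by rewrite addrA subrK -scalerBl -rmorphB.
Qed.

Let fD x y : f (x + y) = f x + f y.
Proof.
apply/eqP; rewrite eq_le; apply/andP; split.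
  apply: le_add_eps => e e0.
  have -> : f x + f y + e = (f x + e / 2) + (f y + e / 2) by lra.
  apply: f_le; rewrite /S /= rmorphD scalerDl opprD addrACA.
  by apply: (coneD cQ); apply: f_lt; rewrite ltrDl divr_gt0.
rewrite -lerBrDr; apply: le_add_eps => e e0; rewrite -lerBlDr lerBrDr.
have -> : f x - e + f y = (f x - e / 2) + (f y - e / 2) by lra.
apply: f_ge; rewrite rmorphD scalerDl opprD addrACA.
by apply: (coneD cQ); apply: f_gt; rewrite gtrDl oppr_lt0 divr_gt0.
Qed.

Let f0 : f 0 = 0.
Proof. by apply: (addrI (f 0)); rewrite -fD !addr0. Qed.

Let fN x : f (- x) = - f x.
Proof. by apply/eqP; rewrite -addr_eq0 -fD addNr f0. Qed.

Let f_pos x : Q x -> 0 <= f x.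
Proof. by move=> h; apply: f_ge; rewrite rmorph0 scale0r subr0. Qed.

Let fZ t x : f (t%:C *: x) = t * f x.
Proof.
have h u y : 0 < u -> f (u%:C *: y) <= u * f y.
  move=> u0; apply: le_add_eps => e e0.
  have -> : u * f y + e = u * (f y + e / u) by rewrite mulrDr mulrCA divff ?mulr1// gt_eqF.
  apply: f_le; rewrite /S /= rmorphM -scalerA -scalerBr; apply: (coneZ cQ); first exact: ltW.
  by apply: f_lt; rewrite ltrDl divr_gt0.
have hp u y : 0 < u -> f (u%:C *: y) = u * f y.
  move=> u0; apply/eqP; rewrite eq_le h//= -ler_pdivlMl//.
  have := h u^-1 (u%:C *: y); rewrite scalerA -rmorphM mulVf ?gt_eqF// scale1r.
  by apply; rewrite invr_gt0.
have [t0|t0|->] := ltrgtP t 0; last by rewrite rmorph0 scale0r f0 mul0r.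
  have := hp (- t) x; rewrite oppr_gt0 => /(_ t0); rewrite rmorphN scaleNr fN mulNr.
  exact: oppr_inj.
exact: hp.
Qed.

Let f1 : f 1 = 1.
Proof.
apply/eqP; rewrite eq_le; apply/andP; split.
  by apply: f_le; rewrite /S /= rmorph1 scale1r subrr -(scale0r (1 : F)) -(rmorph0 (real_complex R)); exact: QP (P0_real _).
apply: f_ge; rewrite rmorph1 scale1r subrr -(scale0r (1 : F)) -(rmorph0 (real_complex R)).
exact: QP (P0_real _).
Qed.

(* The state is f x = inf {r | r - x in Q}; the totality of Q makes it additive. *)
Lemma cone_state : exists f : F -> R,
  [/\ forall x y, f (x + y) = f x + f y, forall t x, f (t%:C *: x) = t * f x,
      f 1 = 1, forall x, f (s x) = f x & forall x, Q x -> 0 <= f x].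
Proof.
exists f; split=> // x.
apply/eqP; rewrite -subr_eq0 -fN -fD eq_le f_pos ?andbT.
  rewrite -oppr_ge0 -fN; apply: f_pos; apply: QP.
  rewrite /P0 /= (invN iN) (invB iN) (Defs.invK iN) !opprB addrA subrK subrr; exact: sos0.
by apply: QP; rewrite /P0 /= (invB iN) (Defs.invK iN) addrA subrK subrr; exact: sos0.
Qed.

End FromMaximalCone.

Lemma extend_cone (C0 : set F) : real_cone C0 -> P0 `<=` C0 -> ~ C0 (- 1) ->
  exists Q, [/\ real_cone Q, C0 `<=` Q, ~ Q (- 1) & forall x, Q x \/ Q (- x)].
Proof.
move=> cC PC C1.
(* The condition is put on the union of [C0] and [X], so that the empty chain is bounded by [C0]
   itself. *)
pose good (X : set F) := real_cone (C0 `|` X) /\ ~ (C0 `|` X) (- 1).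
have [|X [[cX X1] Xmax]] := @Zorn_bigcup _ good.
  move=> G Ggood Gtot.
  have [[X0 GX0]|noX] := pselect (exists X, G X); last first.
    have -> : \bigcup_(X in G) X = set0.
      by apply/seteqP; split=> // x [X GX]; case: noX; exists X.
    by rewrite /good setU0.
  have inX x : (C0 `|` \bigcup_(X in G) X) x -> exists2 X, G X & (C0 `|` X) x.
    by move=> [h|[X GX h]]; [exists X0 => //; left|exists X => //; right].
  have upX X x : G X -> (C0 `|` X) x -> (C0 `|` \bigcup_(X in G) X) x.
    by move=> GX [h|h]; [left|right; exists X].
  split; last by move=> /inX[X /Ggood[]].
  split=> [x y /inX[X GX hx] /inX[Y GY hy]|t x t0 /inX[X GX hx]]; last first.
    by apply: (upX X) => //; case: (Ggood _ GX) => c _; exact: (coneZ c).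
  have [XY|YX] := Gtot _ _ GX GY.
    apply: (upX Y) => //; case: (Ggood _ GY) => c _; apply: (coneD c) => //.
    by case: hx => [|/XY]; [left|right].
  apply: (upX X) => //; case: (Ggood _ GX) => c _; apply: (coneD c) => //.
  by case: hy => [|/YX]; [left|right].
exists (C0 `|` X); split=> //.
set Q := C0 `|` X in cX X1 *.
have Q0 : Q 0.
  by left; apply: PC; rewrite /P0 /= (inv0 iN) addr0; exact: sos0.
(* Adjoining the ray of [x] to [Q] gives a strictly larger cone, which by maximality must contain
   -1. *)
have step x : ~ Q x -> exists q r, [/\ Q q, 0 < r & - 1 = q + r%:C *: x].
  move=> nQx.
  pose Y := [set y | exists q r, [/\ Q q, 0 <= r & y = q + r%:C *: x]].
  have QY : Q `<=` Y by move=> q hq; exists q, 0; rewrite rmorph0 scale0r addr0.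
  have cY : real_cone Y.
    split=> [y z [q [r [hq r0 ->]]] [q' [r' [hq' r0' ->]]]|t y t0 [q [r [hq r0 ->]]]].
      exists (q + q'), (r + r'); rewrite addr_ge0//; split=> //; first exact: (coneD cX).
      by rewrite rmorphD scalerDl addrACA.
    exists (t%:C *: q), (t * r); rewrite mulr_ge0//; split=> //; first exact: (coneZ cX).
    by rewrite scalerDr scalerA rmorphM.
  have C0Y : C0 `|` Y = Y.
    by apply/setUidPr => y hy; apply: QY; left.
  have [[q [r [hq r0 e]]]|nY1] := pselect (Y (- 1)).
    exists q, r; split=> //; rewrite lt_def r0 andbT; apply/eqP => r00.
    by apply: X1; rewrite e r00 rmorph0 scale0r addr0.
  exfalso; apply: (Xmax Y); last by rewrite /good C0Y.
  split; last by move=> YX; apply: nQx; right; apply: YX; exists 0, 1; rewrite rmorph1 scale1r add0r.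
  by move=> y hy; apply: QY; right.
move=> x; have [?|/step[q [r [hq r0 e]]]] := pselect (Q x); first by left.
have [?|/step[q' [r' [hq' r0' e']]]] := pselect (Q (- x)); first by right.
exfalso; apply: X1.
(* From [-1 = q + r x] and [-1 = q' - r' x], this combination eliminates [x] and puts [- (r' + r)]
   into [Q]. *)
have h : Q (r'%:C *: q + r%:C *: q').
  by apply: (coneD cX); apply: (coneZ cX) => //; exact: ltW.
have : r'%:C *: q + r%:C *: q' = - ((r' + r)%:C *: 1).
  have -> : q = - 1 - r%:C *: x by rewrite e addrK.
  have -> : q' = - 1 + r'%:C *: x by rewrite e' scalerN subrK.
  rewrite scalerBr scalerDr !scalerA mulrC addrACA addNr addr0 !scalerN.
  by rewrite -opprD -scalerDl rmorphD.
move=> E; rewrite E in h.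
have rr : 0 < r' + r by exact: addr_gt0.
have := @coneZ _ cX (r' + r)^-1 _ _ h.
rewrite scalerN scalerA -rmorphM mulVf ?gt_eqF// scale1r; apply.
by rewrite invr_ge0 ltW.
Qed.

Lemma gamma_state x0 : 0 < gam x0 -> exists f : F -> R,
  [/\ forall x y, f (x + y) = f x + f y, forall t x, f (t%:C *: x) = t * f x,
      f 1 = 1 /\ (forall x, f (s x) = f x), forall x, 0 <= f (s x * x) &
      gam x0 ^+ 2 <= f (s x0 * x0)].
Proof.
move=> g0; set h := s x0 * x0; set g := gam x0 ^+ 2.
have sh : s h = h by rewrite /h (invM iN) (Defs.invK iN).
have notsos g' : g' < g -> ~ sos s (g'%:C%:A - h).
  (* [m] is positive, as an element of [gamma_bounds] must be, and still below [g]; so [Num.sqrt m]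
     would be a bound below [gamma s x0]. *)
  move=> g'g hs; pose m := Num.max g' (g / 2).
  have gg : 0 < g by rewrite exprn_gt0.
  have m0 : 0 < m by rewrite lt_max divr_gt0 ?orbT.
  have mg : m < g by rewrite gt_max g'g /=; lra.
  have : gb x0 (Num.sqrt m).
    rewrite (gamma_boundsE iN) /= sqrtr_gt0 sqr_sqrtr ?ltW//; split=> //.
    rewrite -(subrK g' m) rmorphD scalerDl -addrA; apply: sosD => //.
    by apply: (sos_real iN); rewrite subr_ge0 le_max lexx.
  move/gamma_le => /(_ _ iN); apply/negP.
  by rewrite -ltNge -(@ltr_pXn2r _ 2) ?nnegrE ?sqrtr_ge0 ?(ltW g0)// sqr_sqrtr ?(ltW m0).
pose hc := h - (g%:C)%:A.
pose C0 := [set x | exists p r, [/\ P0 p, 0 <= r & x = p + r%:C *: hc]].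
have cP : real_cone P0.
  split=> [x y hx hy|t x t0 hx]; rewrite /P0 /=.
    by rewrite (invD iN) addrACA; exact: sosD.
  by rewrite (invZr iN) -scalerDr; exact: (sosZ iN).
have cC : real_cone C0.
  split=> [y z [q [r [hq r0 ->]]] [q' [r' [hq' r0' ->]]]|t y t0 [q [r [hq r0 ->]]]].
    exists (q + q'), (r + r'); rewrite addr_ge0//; split=> //; first exact: (coneD cP).
    by rewrite rmorphD scalerDl addrACA.
  exists (t%:C *: q), (t * r); rewrite mulr_ge0//; split=> //; first exact: (coneZ cP).
  by rewrite scalerDr scalerA rmorphM.
have PC : P0 `<=` C0 by move=> p hp; exists p, 0; rewrite rmorph0 scale0r addr0.
(* If [r = 0] then [p = -1], and adding [t^2 p] to [t^2 - h] leaves [- h], against [notsos 0]. If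
   [r > 0] then [p] is [r] times [(g - 1/r) - h], against [notsos (g - 1/r)]. *)
have C1 : ~ C0 (- 1).
  move=> [p [r [hp r0 e]]].
  have pE : p = - 1 - r%:C *: hc by rewrite e addrK.
  have sp : s p = p by rewrite pE (invB iN) (invN iN) (inv1 iN) (invZr iN) /hc (invB iN) sh (invZr iN) (inv1 iN).
  have {hp} hp : sos s p.
    move: hp; rewrite /P0 /= sp => hp; apply: (@sosZ_gt _ _ _ _ iN 2) => //.
    by rewrite (_ : 2%:C = 1 + 1) ?scalerDl ?scale1r// rmorphD rmorph1.
  move: r0; rewrite le_eqVlt => /predU1P[r0|r0].
    apply: (notsos 0); first by rewrite exprn_gt0.
    have [t] := gamma_bounds_neq0 nN iN x0; rewrite (gamma_boundsE iN) /= => -[t0 ht].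
    have := sosD ht (sosZ iN (sqr_ge0 t) hp).
    rewrite pE -r0 rmorph0 !scale0r subr0 scalerN addrAC subrr add0r.
    by [].
  apply: (notsos (g - r^-1)); first by rewrite gtrDl oppr_lt0 invr_gt0.
  apply: (sosZ_gt iN r0); move: hp; rewrite pE /hc.
  congr sos; rewrite !scalerBr !scalerA -!rmorphM mulrBr mulfV ?gt_eqF//.
  by rewrite rmorphB rmorph1 scalerBl scale1r opprB addrA (addrC (- 1)).
have [Q [cQ CQ Q1 Qtot]] := extend_cone cC PC C1.
have [f [fD fZ f1 fs fQ]] := cone_state cQ (subset_trans PC CQ) Q1 Qtot.
exists f; split=> //.
  move=> x; apply: fQ; apply: CQ; apply: PC; apply: P0_sos; first exact: sos_sqr.
  by rewrite (invM iN) (Defs.invK iN).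
have : 0 <= f hc.
  by apply: fQ; apply: CQ; exists 0, 1; rewrite rmorph1 scale1r add0r; split=> //;
    rewrite /P0 /= (inv0 iN) addr0; exact: sos0.
have fN x : f (- x) = - f x.
  by have := fZ (-1) x; rewrite rmorphN rmorph1 scaleN1r mulN1r.
by rewrite /hc fD fN fZ f1 mulr1 subr_ge0.
Qed.

End State.

(** * Polarization and extension of identities by density *)

Section Polarization.
Context {K : numFieldType} {E : normedModType K}.
Variable i : K.

(** The polarization formula for a form linear in the first variable, when [i] is the imaginary
    unit. Written with norms alone, it is continuous before any inner product is known. *)
Definition polar (f g : E) : K :=
  4^-1 * (`|f + g| ^+ 2 - `|f - g| ^+ 2
          + i * (`|f + i *: g| ^+ 2 - `|f - i *: g| ^+ 2)).

Lemma polar_cvg (u v : nat -> E) (f g : E) : u @ \oo --> f -> v @ \oo --> g ->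
  (fun n => polar (u n) (v n)) @ \oo --> polar f g.
Proof.
move=> uf vg.
have sq (w : nat -> E) (l : E) : w @ \oo --> l -> (fun n => `|w n| ^+ 2) @ \oo --> `|l| ^+ 2.
  by move=> wl; rewrite expr2; under eq_fun do rewrite expr2; apply: cvgM; exact: cvg_norm.
have iv : (fun n => i *: v n) @ \oo --> i *: g by apply: cvgZr.
rewrite /polar; apply: cvgM; first exact: cvg_cst.
apply: cvgD; first by apply: cvgB; apply: sq; [exact: cvgD|exact: cvgB].
apply: cvgM; first exact: cvg_cst.
by apply: cvgB; apply: sq; [exact: cvgD|exact: cvgB].
Qed.

Variable D : set E.
Hypothesis Dd : forall f : E, exists2 u : nat -> E, (forall n, D (u n)) & u @ \oo --> f.

Lemma polarDl_dense :
  (forall x y z, D x -> D y -> D z -> polar (x + y) z = polar x z + polar y z) ->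
  forall x y z, polar (x + y) z = polar x z + polar y z.
Proof.
move=> h x y z; have [u Du ux] := Dd x; have [v Dv vy] := Dd y; have [w Dw wz] := Dd z.
have h1 : (fun n => polar (u n + v n) (w n)) @ \oo --> polar (x + y) z.
  by apply: polar_cvg => //; exact: cvgD.
have h2 : (fun n => polar (u n + v n) (w n)) @ \oo --> polar x z + polar y z.
  by under eq_fun do rewrite h//; apply: cvgD; exact: polar_cvg.
by apply: (cvg_unique _ h1 h2); exact: norm_hausdorff.
Qed.

Lemma polarZl_dense :
  (forall c x z, D x -> D z -> polar (c *: x) z = c * polar x z) ->
  forall c x z, polar (c *: x) z = c * polar x z.
Proof.
move=> h c x z; have [u Du ux] := Dd x; have [w Dw wz] := Dd z.
have h1 : (fun n => polar (c *: u n) (w n)) @ \oo --> polar (c *: x) z.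
  by apply: polar_cvg => //; exact: cvgZr.
have h2 : (fun n => polar (c *: u n) (w n)) @ \oo --> c * polar x z.
  by under eq_fun do rewrite h//; apply: cvgM; [exact: cvg_cst|exact: polar_cvg].
by apply: (cvg_unique _ h1 h2); exact: norm_hausdorff.
Qed.

End Polarization.

Section CompleteFilters.
Context {R : realType}.

Lemma real_complete_seq (u : nat -> R) :
  (forall e : R, 0 < e -> exists n0 : nat, forall m n : nat,
     (n0 <= m)%N -> (n0 <= n)%N -> `|u m - u n| < e) ->
  exists l, forall e : R, 0 < e -> exists n0 : nat, forall n : nat,
     (n0 <= n)%N -> `|u n - l| < e.
Proof.
move=> cu.
have /cauchy_cvgP/cvg_ex[l ul] : cauchy (u @ \oo).
  apply/cauchy_ballP => e e0; have [n0 hn0] := cu _ e0.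
  exists (u @` [set n | (n0 <= n)%N], u @` [set n | (n0 <= n)%N]).
    split; exists n0 => // n /= hn; by exists n.
  by move=> [_ _] [/= [m hm <-] [n hn <-]]; apply: hn0.
exists l => e e0; move/cvgrPdist_lt : ul => /(_ _ e0)[n0 _ hn0].
by exists n0 => n hn; rewrite distrC; exact: hn0.
Qed.

Lemma complex_complete_seq (u : nat -> R[i]) :
  (forall e : R, 0 < e -> exists n0 : nat, forall m n : nat,
     (n0 <= m)%N -> (n0 <= n)%N -> nrm (u m - u n) < e) ->
  exists l, forall e : R, 0 < e -> exists n0 : nat, forall n : nat,
     (n0 <= n)%N -> nrm (u n - l) < e.
Proof.
move=> cu.
have reN (z : R[i]) : `|complex.Re z| <= nrm z by rewrite -lecR -normE; exact: normc_ge_Re.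
have imN (z : R[i]) : `|complex.Im z| <= nrm z.
  by have := reN (z * 'i%C); rewrite nrmcM nrmc_i mulr1 ReiNIm normrN.
have [|a ha] := @real_complete_seq (fun n => complex.Re (u n)).
  move=> e /cu[n0 h]; exists n0 => m n hm hn; apply: le_lt_trans (h m n hm hn).
  by apply: le_trans (reN _); rewrite raddfB.
have [|b hb] := @real_complete_seq (fun n => complex.Im (u n)).
  move=> e /cu[n0 h]; exists n0 => m n hm hn; apply: le_lt_trans (h m n hm hn).
  by apply: le_trans (imN _); rewrite raddfB.
exists (a +i* b) => e e0.
have [n1 h1] := ha (e / 2) ltac:(by rewrite divr_gt0).
have [n2 h2] := hb (e / 2) ltac:(by rewrite divr_gt0).
exists (maxn n1 n2) => n; rewrite geq_max => /andP[/h1 k1 /h2 k2].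
have -> : u n - (a +i* b) = (complex.Re (u n) - a)%:C + 'i%C * (complex.Im (u n) - b)%:C.
  by rewrite [LHS]complexE; case: (u n) => p q.
apply: le_lt_trans (nrmD _ _) _; rewrite nrmcM nrmc_i mul1r !nrmc_real; lra.
Qed.

(** Choose in each step a ball of radius [1 / (n + 1)] that belongs to [G]. Two such balls meet, so
    their centers form a Cauchy sequence, and its limit is a limit of [G]. *)
Lemma seq_complete_filter (E : normedModType R[i]) :
  (forall u : nat -> E, (forall e : R, 0 < e -> exists n0 : nat, forall m n : nat,
     (n0 <= m)%N -> (n0 <= n)%N -> nrm (u m - u n) < e) ->
  exists l, forall e : R, 0 < e -> exists n0 : nat, forall n : nat,
     (n0 <= n)%N -> nrm (u n - l) < e) ->
  forall G : set_system E, ProperFilter G -> cauchy G -> cvg G.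
Proof.
move=> Ec G PG /cauchyP cG.
have ballE (x y : E) (r : R) : ball x r%:C y <-> nrm (x - y) < r.
  by rewrite -ball_normE /ball_ /= normE ltcR.
have /choice[a aP] n : exists x : E, G (ball x (n.+1%:R^-1 : R)%:C).
  by apply: cG; rewrite ltcR invr_gt0.
have [|l al] := Ec a.
  move=> e e0; have [n0 hn0] := small_inv (ltac:(by rewrite divr_gt0) : 0 < e / 2 :> R).
  exists n0 => m n /hn0 hm /hn0 hn.
  have [z [/= /ballE z1 /ballE z2]] := filter_ex (filterI (aP m) (aP n)).
  have -> : a m - a n = (a m - z) + (z - a n) by rewrite addrA subrK.
  apply: le_lt_trans (nrmD _ _) _; rewrite (nrmB z).
  by rewrite (splitr e) ltrD// ?(lt_trans z1)// (lt_trans z2).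
apply/cvg_ex; exists l; apply/cvg_ballP => e e0.
have er : e = (complex.Re e)%:C by rewrite RRe_real// gtr0_real.
have e0' : 0 < complex.Re e by rewrite -ltcR -er.
rewrite er; set d := complex.Re e in e0' *.
have [n1 h1] := small_inv (ltac:(by rewrite divr_gt0) : 0 < d / 2 :> R).
have [n2 h2] := al (d / 2) ltac:(by rewrite divr_gt0).
have := h1 (maxn n1 n2) (leq_maxl _ _); have := h2 (maxn n1 n2) (leq_maxr _ _).
move: (maxn n1 n2) => n k2 k1.
apply: filterS (aP n) => z /ballE hz; apply/ballE.
have -> : l - z = (l - a n) + (a n - z) by rewrite addrA subrK.
apply: le_lt_trans (nrmD _ _) _; rewrite (nrmB l).
by rewrite (splitr d) ltrD// (lt_trans hz).
Qed.

End CompleteFilters.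

(** * The Hilbert space of a semidefinite form *)

Section Completion.
Context {R : realType} {V : lmodType R[i]}.
Variable B : psd_form V.

(* The completion of V for the seminorm of B is realized as the closure, in the
   space of bounded conjugate-linear functionals, of the functionals B x. *)
Definition approximable (f : V -> R[i]) : Prop :=
  forall e : R, 0 < e -> exists x, forall y, nrm (f y - B x y) <= e * pnrm B y.

Definition approx_pred : {pred V -> R[i]} := [pred f | `[< approximable f >]].

Lemma approx_submod : submod_closed approx_pred.
Proof.
split.
  by apply/asboolP => e e0; exists 0 => y; rewrite pform0l subr0 nrm0 mulr_ge0 ?pnrm_ge0 ?ltW.
move=> c f g /asboolP hf /asboolP hg; apply/asboolP => e e0.
have n0 : 0 < nrm c + 1 by rewrite ltr_wpDl ?nrm_ge0.
have [x hx] := hf (e / 2 / (nrm c + 1)) ltac:(by rewrite !divr_gt0).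
have [z hz] := hg (e / 2) ltac:(by rewrite !divr_gt0).
exists (c *: x + z) => y; rewrite !fctE pformDl pformZl opprD addrACA.
apply: le_trans (nrmD _ _) _.
have -> : c *: f y - c * B x y = c * (f y - B x y) by rewrite mulrBr.
rewrite nrmcM.
have := hz y; have := ler_wpM2l (nrm_ge0 c) (hx y).
have := pnrm_ge0 B y; set p := pnrm B y; set a := nrm (f y - _); set b := nrm (g y - _).
move=> p0 h1 h2.
have : nrm c * (e / 2 / (nrm c + 1) * p) <= e / 2 * p.
  rewrite [leLHS]mulrA ler_wpM2r// mulrCA ler_piMr ?divr_ge0 ?(ltW e0)//.
  by rewrite ler_pdivrMr// mul1r lerDl.
lra.
Qed.

HB.instance Definition _ := GRing.isSubmodClosed.Build R[i] (V -> R[i]) approx_pred approx_submod.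

Record completion := Completion { cfun : V -> R[i]; cfunP : cfun \in approx_pred }.

HB.instance Definition _ := [isSub for cfun].
HB.instance Definition _ := [Choice of completion by <:].
HB.instance Definition _ := [SubChoice_isSubLmodule of completion by <:].

Implicit Types (f g : completion).

Lemma cfunD f g y : cfun (f + g) y = cfun f y + cfun g y.
Proof. by []. Qed.

Lemma cfunZ c f y : cfun (c *: f) y = c * cfun f y.
Proof. by []. Qed.

Lemma cfun_approx f (e : R) : 0 < e -> exists x, forall y,
  nrm (cfun f y - B x y) <= e * pnrm B y.
Proof. by have /asboolP := cfunP f; apply. Qed.

Definition cbounds f : set R := [set c | 0 <= c /\ forall y, nrm (cfun f y) <= c * pnrm B y].
Definition cnorm f : R := inf (cbounds f).

Let cb_lb f : has_lbound (cbounds f).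
Proof. by exists 0 => c []. Qed.

Let cb_inf f : has_inf (cbounds f).
Proof.
split=> //; have [x hx] := cfun_approx f ltr01.
exists (1 + pnrm B x); split; first by rewrite addr_ge0 ?pnrm_ge0.
move=> y; have -> : cfun f y = (cfun f y - B x y) + B x y by rewrite subrK.
by rewrite (le_trans (nrmD _ _))// mulrDl lerD ?hx ?cauchy_schwarz.
Qed.

Lemma cnorm_ge0 f : 0 <= cnorm f.
Proof. by apply: lb_le_inf; [case: (cb_inf f)|move=> c []]. Qed.

Lemma cnorm_le f (c : R) : 0 <= c -> (forall y, nrm (cfun f y) <= c * pnrm B y) -> cnorm f <= c.
Proof. by move=> c0 h; apply: ge_inf. Qed.

Lemma cnormP f y : nrm (cfun f y) <= cnorm f * pnrm B y.
Proof.
apply: le_add_eps => e e0.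
have p0 := pnrm_ge0 B y.
have d0 : 0 < e / (pnrm B y + 1) by rewrite divr_gt0// ltr_wpDl.
have [c [c0 hc] lc] := inf_adherent d0 (cb_inf f).
apply: (le_trans (hc y)); apply: (@le_trans _ _ ((cnorm f + e / (pnrm B y + 1)) * pnrm B y)).
  by rewrite ler_wpM2r// ltW.
rewrite mulrDl lerD2l mulrAC -mulrA ler_piMr ?(ltW e0)//.
by rewrite ler_pdivrMr ?mul1r ?lerDl// ltr_wpDl.
Qed.

Lemma cnormD f g : cnorm (f + g) <= cnorm f + cnorm g.
Proof.
apply: cnorm_le => [|y]; first by rewrite addr_ge0 ?cnorm_ge0.
by rewrite cfunD (le_trans (nrmD _ _))// mulrDl lerD ?cnormP.
Qed.

Lemma cnorm_eq0 f : cnorm f = 0 -> f = 0.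
Proof.
move=> f0; apply/val_inj/funext => y; apply: nrm_eq0; apply/eqP.
by rewrite eq_le nrm_ge0 andbT (le_trans (cnormP f y))// f0 mul0r.
Qed.

Lemma cnormZ (c : R[i]) f : cnorm (c *: f) = nrm c * cnorm f.
Proof.
have h (d : R[i]) g : cnorm (d *: g) <= nrm d * cnorm g.
  apply: cnorm_le => [|y]; first by rewrite mulr_ge0 ?nrm_ge0 ?cnorm_ge0.
  by rewrite cfunZ nrmcM -mulrA ler_wpM2l ?nrm_ge0 ?cnormP.
apply/eqP; rewrite eq_le h//=; have [->|c0] := eqVneq c 0.
  by rewrite nrm0 mul0r cnorm_ge0.
have nc : 0 < nrm c.
  by rewrite lt_def nrm_ge0 andbT; apply: contra_neq c0 => /nrm_eq0.
rewrite mulrC -ler_pdivlMr//.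
have := h c^-1 (c *: f); rewrite scalerA mulVf// scale1r.
suff -> : nrm c^-1 = (nrm c)^-1 by rewrite mulrC.
apply: (mulfI (lt0r_neq0 nc)); rewrite divff ?gt_eqF// -nrmcM divff//.
by rewrite /nrm normr1.
Qed.

Let normC f : R[i] := (cnorm f)%:C.

Let normCD f g : normC (f + g) <= normC f + normC g.
Proof. by rewrite -rmorphD lecR cnormD. Qed.

Let normCZ (c : R[i]) f : normC (c *: f) = `|c| * normC f.
Proof. by rewrite /normC cnormZ normE rmorphM. Qed.

Let normC_eq0 f : normC f = 0 -> f = 0.
Proof. by move=> -[] /cnorm_eq0. Qed.

HB.instance Definition _ := Lmodule_isNormed.Build R[i] completion normCD normCZ normC_eq0.

Lemma nrm_cnorm f : nrm f = cnorm f.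
Proof. by []. Qed.

Let completion_seq (u : nat -> completion) :
  (forall e : R, 0 < e -> exists n0 : nat, forall m n : nat,
     (n0 <= m)%N -> (n0 <= n)%N -> nrm (u m - u n) < e) ->
  exists l, forall e : R, 0 < e -> exists n0 : nat, forall n : nat,
     (n0 <= n)%N -> nrm (u n - l) < e.
Proof.
move=> cu.
have cP m n y : nrm (cfun (u m) y - cfun (u n) y) <= nrm (u m - u n) * pnrm B y.
  exact: (cnormP (u m - u n)).
have /choice[g gP] y : exists l, forall e : R, 0 < e -> exists n0 : nat, forall n : nat,
     (n0 <= n)%N -> nrm (cfun (u n) y - l) < e.
  apply: complex_complete_seq => e e0.
  have p0 : 0 < pnrm B y + 1 by rewrite ltr_wpDl ?pnrm_ge0.
  have [n0 h] := cu (e / (pnrm B y + 1)) ltac:(by rewrite divr_gt0).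
  exists n0 => m n hm hn; apply: le_lt_trans (cP m n y) _.
  apply: (@le_lt_trans _ _ (nrm (u m - u n) * (pnrm B y + 1))).
    by rewrite ler_wpM2l ?nrm_ge0// lerDl.
  by rewrite -ltr_pdivlMr// h.
have unif (e : R) : 0 < e -> exists n0 : nat, forall n : nat, (n0 <= n)%N ->
    forall y, nrm (cfun (u n) y - g y) <= e * pnrm B y.
  move=> e0; have [n0 h0] := cu e e0; exists n0 => n hn y.
  apply: le_add_eps => d d0; have [n1 h1] := gP y d d0.
  pose m := (n0 + n1)%N.
  have -> : cfun (u n) y - g y = (cfun (u n) y - cfun (u m) y) + (cfun (u m) y - g y).
    by rewrite addrA subrK.
  apply: le_trans (nrmD _ _) _; apply: lerD; last by rewrite ltW// h1// leq_addl.
  apply: le_trans (cP _ _ _) _.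
  by rewrite ler_wpM2r ?pnrm_ge0// ltW// h0// leq_addr.
have gA : g \in approx_pred.
  apply/asboolP => e e0.
  have [n0 /(_ n0 (leqnn _)) h] := unif (e / 2) ltac:(by rewrite divr_gt0).
  have [x hx] := cfun_approx (u n0) (ltac:(by rewrite divr_gt0) : 0 < e / 2).
  exists x => y.
  have -> : g y - B x y = - (cfun (u n0) y - g y) + (cfun (u n0) y - B x y).
    by rewrite opprB addrA subrK.
  apply: le_trans (nrmD _ _) _; rewrite nrmN; have := h y; have := hx y; lra.
exists (Completion gA) => e e0; have [n0 h] := unif (e / 2) ltac:(by rewrite divr_gt0).
exists n0 => n hn; apply: (@le_lt_trans _ _ (e / 2)); last by lra.
rewrite nrm_cnorm; apply: cnorm_le; first by rewrite divr_ge0// ltW.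
exact: h.
Qed.

HB.instance Definition _ := Uniform_isComplete.Build completion (seq_complete_filter completion_seq).

Lemma inc_approx x : (B x : V -> R[i]) \in approx_pred.
Proof.
by apply/asboolP => e e0; exists x => y; rewrite subrr nrm0 mulr_ge0 ?pnrm_ge0 ?ltW.
Qed.

Definition inc x : completion := Completion (inc_approx x).

Lemma incD x y : inc (x + y) = inc x + inc y.
Proof. by apply/val_inj/funext => z; rewrite /= pformDl. Qed.

Lemma incZ c x : inc (c *: x) = c *: inc x.
Proof. by apply/val_inj/funext => z; rewrite /= pformZl. Qed.

Lemma incN x : inc (- x) = - inc x.
Proof. by rewrite -scaleN1r incZ scaleN1r. Qed.

Lemma nrm_inc x : nrm (inc x) = pnrm B x.
Proof.
rewrite nrm_cnorm; apply/eqP; rewrite eq_le; apply/andP; split.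
  by apply: cnorm_le => [|y]; [exact: pnrm_ge0|exact: cauchy_schwarz].
have := cnormP (inc x) x.
rewrite /= (pform_real B x) nrmc_real -pnrm_sqr ger0_norm ?sqr_ge0// expr2.
have [p0|p0 _] := ltP 0 (pnrm B x); first by rewrite ler_pM2r.
exact: le_trans p0 (cnorm_ge0 _).
Qed.

Lemma inc_dense f (e : R) : 0 < e -> exists x, nrm (f - inc x) <= e.
Proof.
move=> e0; have [x hx] := cfun_approx f e0; exists x.
by rewrite nrm_cnorm; apply: cnorm_le => //; exact: ltW.
Qed.

Lemma inc_cvg (f : completion) : exists2 u : nat -> completion, (forall n, range inc (u n)) & u @ \oo --> f.
Proof.
have /choice[u hu] n : exists x, nrm (f - inc x) <= n.+1%:R^-1.
  by apply: inc_dense; rewrite invr_gt0.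
exists (inc \o u); first by move=> n; exists (u n).
apply/cvgrPdist_lt => e e0.
have er : e = (complex.Re e)%:C by rewrite RRe_real// gtr0_real.
have e0' : 0 < complex.Re e by rewrite -ltcR -er.
have [n0 h] := small_inv e0'; exists n0 => // n /= hn.
by rewrite normE er ltcR; apply: le_lt_trans (hu n) (h n hn).
Qed.

(** On functionals the inner product is obtained from the norm by polarization. It agrees with [B]
    on the dense range of [inc], from which linearity passes to limits; symmetry and the value on
    the diagonal are identities of the formula itself. *)
Definition cdot f g : R[i] := polar 'i%C f g.

Lemma cdot_inc x y : cdot (inc x) (inc y) = B x y.
Proof.
rewrite /cdot /polar -!incZ -!incN -!incD !normE !nrm_inc -!rmorphXn /=.
rewrite !pnrm_sqrD !pnrmN !pnrm_sqrZ nrmc_i !pformNr !pformZr.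
case: (B x y) => a b /=.
set p := pnrm B x; set q := pnrm B y.
rewrite (_ : 4^-1 = (4^-1 : R)%:C); last by rewrite fmorphV rmorph_nat.
by apply/eqP; rewrite eq_complex /=; apply/andP; split; apply/eqP; field.
Qed.

Lemma cdotDl f g h : cdot (f + g) h = cdot f h + cdot g h.
Proof.
move: f g h; apply: (polarDl_dense inc_cvg) => _ _ _ [x _ <-] [y _ <-] [z _ <-].
by rewrite -incD -!/(cdot _ _) !cdot_inc pformDl.
Qed.

Lemma cdotZl c f g : cdot (c *: f) g = c * cdot f g.
Proof.
move: c f g; apply: (polarZl_dense inc_cvg) => c _ _ [x _ <-] [z _ <-].
by rewrite -incZ -!/(cdot _ _) !cdot_inc pformZl.
Qed.

Lemma cdotC f g : cdot g f = conjc (cdot f g).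
Proof.
rewrite /cdot /polar (addrC g f) !normE.
have e1 : nrm (g + 'i%C *: f) = nrm (f - 'i%C *: g).
  have -> : g + 'i%C *: f = 'i%C *: (f - 'i%C *: g).
    by rewrite scalerBr scalerA -expr2 sqr_i scaleN1r opprK addrC.
  by rewrite nrmZ nrmc_i mul1r.
have e2 : nrm (g - 'i%C *: f) = nrm (f + 'i%C *: g).
  have -> : g - 'i%C *: f = - ('i%C *: (f + 'i%C *: g)).
    by rewrite scalerDr scalerA -expr2 sqr_i scaleN1r opprB.
  by rewrite nrmN nrmZ nrmc_i mul1r.
rewrite e1 e2 (nrmB g f) -!rmorphXn.
rewrite (_ : 4^-1 = (4^-1 : R)%:C); last by rewrite fmorphV rmorph_nat.
by apply/eqP; rewrite eq_complex /=; apply/andP; split; apply/eqP; ring.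
Qed.

Lemma cdot_norm f : cdot f f = `|f| ^+ 2.
Proof.
have eD c : nrm (f + c *: f) ^+ 2 = nrm (1 + c) ^+ 2 * nrm f ^+ 2.
  by rewrite -exprMn -nrmZ scalerDl scale1r.
have eB c : nrm (f - c *: f) ^+ 2 = nrm (1 - c) ^+ 2 * nrm f ^+ 2.
  by rewrite -exprMn -nrmZ scalerBl scale1r.
have := eD 1; rewrite scale1r (nrmc_sqr (1 + 1)) => e1.
have := eD 'i%C; rewrite (nrmc_sqr (1 + _)) => e2.
have := eB 'i%C; rewrite (nrmc_sqr (1 - _)) => e3.
rewrite /cdot /polar subrr !normE nrm0 -!rmorphXn e1 e2 e3.
rewrite (_ : 4^-1 = (4^-1 : R)%:C); last by rewrite fmorphV rmorph_nat.
by apply/eqP; rewrite eq_complex /=; apply/andP; split; apply/eqP; field.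
Qed.

HB.instance Definition _ := isHilbert.Build R completion cdotDl cdotZl cdotC cdot_norm.

Lemma dot_inc x y : dot (inc x : completion) (inc y) = B x y.
Proof. exact: cdot_inc. Qed.

End Completion.

Section CompletionExtra.
Context {R : realType} {V : lmodType R[i]}.
Variable B : psd_form V.
Implicit Types (f g : completion B).

(** Conjugate-linearity is inherited from the approximating functionals [B x]. It is what makes
    [gns_rep] linear in the algebra variable. *)
Lemma cfun_addr f y z : cfun f (y + z) = cfun f y + cfun f z.
Proof.
apply/eqP; rewrite -subr_eq0; apply/eqP/nrm_eq0/eqP; rewrite eq_le nrm_ge0 andbT.
apply: le_add_eps => e e0; rewrite add0r.
pose M := pnrm B (y + z) + (pnrm B y + pnrm B z) + 1.
have M0 : 0 < M by rewrite ltr_wpDl// !addr_ge0 ?pnrm_ge0.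
have [x hx] := cfun_approx f (ltac:(by rewrite divr_gt0) : 0 < e / M).
have -> : cfun f (y + z) - (cfun f y + cfun f z) = (cfun f (y + z) - B x (y + z))
    - ((cfun f y - B x y) + (cfun f z - B x z)) by rewrite pformDr; ring.
apply: (@le_trans _ _ (e / M * (M - 1))).
  rewrite addrK mulrDr; apply: le_trans (nrmD _ _) _; rewrite nrmN lerD ?hx//.
  by apply: le_trans (nrmD _ _) _; rewrite mulrDr lerD.
by rewrite mulrAC ler_pdivrMr// ler_wpM2l ?(ltW e0)// gerBl.
Qed.

Lemma cfun_scaler f c y : cfun f (c *: y) = conjc c * cfun f y.
Proof.
apply/eqP; rewrite -subr_eq0; apply/eqP/nrm_eq0/eqP; rewrite eq_le nrm_ge0 andbT.
apply: le_add_eps => e e0; rewrite add0r.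
pose M := pnrm B (c *: y) + nrm c * pnrm B y + 1.
have M0 : 0 < M by rewrite ltr_wpDl// !addr_ge0 ?mulr_ge0 ?nrm_ge0 ?pnrm_ge0.
have [x hx] := cfun_approx f (ltac:(by rewrite divr_gt0) : 0 < e / M).
have -> : cfun f (c *: y) - conjc c * cfun f y = (cfun f (c *: y) - B x (c *: y))
    - conjc c * (cfun f y - B x y) by rewrite pformZr; ring.
apply: (@le_trans _ _ (e / M * (M - 1))).
  rewrite addrK (mulrDr (e / M)); apply: le_trans (nrmD _ _) _; rewrite nrmN lerD ?hx//.
  by rewrite nrmcM nrmcJ mulrCA ler_wpM2l ?nrm_ge0.
by rewrite mulrAC ler_pdivrMr// ler_wpM2l ?(ltW e0)// gerBl.
Qed.

Lemma dense_eq0 (l : completion B -> R[i]) (M : R) : 0 <= M ->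
  (forall f g, l (f - g) = l f - l g) -> (forall f, nrm (l f) <= M * nrm f) ->
  (forall x, l (inc B x) = 0) -> forall f, l f = 0.
Proof.
move=> M0 lB lM l0 f; apply: nrm_eq0; apply/eqP; rewrite eq_le nrm_ge0 andbT.
apply: le_add_eps => e e0; rewrite add0r.
have M1 : 0 < M + 1 by rewrite ltr_wpDl.
have [x hx] := inc_dense f (ltac:(by rewrite divr_gt0) : 0 < e / (M + 1)).
have -> : l f = l (f - inc B x) by rewrite lB l0 subr0.
apply: le_trans (lM _) _; apply: (@le_trans _ _ ((M + 1) * (e / (M + 1)))).
  by apply: ler_pM => //; rewrite ?nrm_ge0// lerDl.
by rewrite mulrC divfK ?gt_eqF.
Qed.

End CompletionExtra.

Record star_rep (R : realType) (F : algType R[i]) (N : F -> R) (s : F -> F)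
    (K : hilbertType R) (pi : F -> K -> K) : Prop := {
  srep_bounded : forall x, bounded_operator (pi x);
  srepD : forall x y, pi (x + y) = pi x + pi y;
  srepZ : forall (c : R[i]) x, pi (c *: x) = c *: pi x;
  srepM : forall x y, pi (x * y) = pi x \o pi y;
  srep1 : pi 1 = idfun;
  srep_star : forall x, adjoint (pi x) = pi (s x);
  srep_norm : forall x v, nrm (pi x v) <= N x * nrm v }.

Lemma dotBl (R : realType) (K : hilbertType R) (x y z : K) : dot (x - y) z = dot x z - dot y z.
Proof. by rewrite dotDl dotNl. Qed.

Lemma dotBr (R : realType) (K : hilbertType R) (x y z : K) : dot x (y - z) = dot x y - dot x z.
Proof. by rewrite dotDr dotNr. Qed.

Lemma bopB (R : realType) (K : hilbertType R) (T : K -> K) : bounded_operator T ->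
  forall x y, T (x - y) = T x - T y.
Proof. by move=> bT x y; rewrite (bopD bT) (bopN bT). Qed.

Lemma subrACA (V : zmodType) (a b c d : V) : a - b - (c - d) = a - c - (b - d).
Proof. by rewrite !opprB addrACA [RHS]addrACA [- b + _]addrC. Qed.

(** * The GNS representation of a state *)

Section GNS.
Context {R : realType} {F : algType R[i]}.
Variables (N : F -> R) (s : F -> F).
Hypotheses (nN : complete_algebra_norm N) (iN : isometric_involution N s).
Implicit Types (x y z : F) (t : R).

Variable f : F -> R.
Hypotheses (fD : forall x y, f (x + y) = f x + f y)
  (fZ : forall t x, f (t%:C *: x) = t * f x) (f1 : f 1 = 1)
  (fs : forall x, f (s x) = f x) (fpos : forall x, 0 <= f (s x * x)).

Let fN x : f (- x) = - f x.
Proof. by have := fZ (-1) x; rewrite rmorphN rmorph1 scaleN1r mulN1r. Qed.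

(** The complex-linear functional with real part [f]. *)
Let phi x : R[i] := f x +i* (- f ('i%C *: x)).

Let phiD x y : phi (x + y) = phi x + phi y.
Proof. by rewrite /phi scalerDr !fD opprD. Qed.

Let phiZ c x : phi (c *: x) = c * phi x.
Proof.
have fc z : f (c *: z) = complex.Re c * f z + complex.Im c * f ('i%C *: z).
  by rewrite {1}(complexE c) scalerDl fD fZ (mulrC 'i%C) -scalerA fZ.
rewrite /phi scalerA (mulrC 'i%C) -scalerA !fc scalerA -expr2 sqr_i scaleN1r fN.
case: c {fc} => a b /=; congr (_ +i* _); ring.
Qed.

Let phi_s x : phi (s x) = conjc (phi x).
Proof.
rewrite /phi /= fs; congr (_ +i* _).
rewrite -[RHS]opprK; congr (- _); rewrite opprK -fs (invZ iN) (Defs.invK iN).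
have -> : conjc 'i%C = - 'i%C :> R[i] by simpc.
by rewrite scaleNr fN.
Qed.

Let B x y := phi (s y * x).

Let B_Dl x y z : B (x + y) z = B x z + B y z.
Proof. by rewrite /B mulrDr phiD. Qed.

Let B_Zl c x y : B (c *: x) y = c * B x y.
Proof. by rewrite /B -scalerAr phiZ. Qed.

Let B_C x y : B y x = conjc (B x y).
Proof. by rewrite /B -phi_s (invM iN) (Defs.invK iN). Qed.

Let B_ge0 x : 0 <= complex.Re (B x x).
Proof. exact: fpos. Qed.

Definition gns_form : psd_form F := PsdForm B_Dl B_Zl B_C B_ge0.

Local Notation K := (completion gns_form).

Let f_sos x : sos s x -> 0 <= f x.
Proof.
move=> [zs ->]; rewrite (big_morph f fD (_ : f 0 = 0)); first exact: sumr_ge0.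
by apply: (addrI (f 0)); rewrite -fD !addr0.
Qed.

Let pnrm_f x : pnrm gns_form x ^+ 2 = f (s x * x).
Proof. by rewrite pnrm_sqr. Qed.

(** [f] is nonnegative on [y# (t^2 - x# x) y], a conjugate of a sum of squares. Left multiplication
    by [x] is thus bounded by [t]. *)
Let pnrmM x y t : gamma_bounds s x t -> pnrm gns_form (x * y) <= t * pnrm gns_form y.
Proof.
rewrite (gamma_boundsE iN) => -[t0 ht].
apply: sqr_le_lemma; first by rewrite mulr_ge0 ?pnrm_ge0 ?ltW.
rewrite exprMn !pnrm_f -subr_ge0.
have := f_sos (sos_conj iN y ht).
rewrite mulrBr mulrBl fD fN -scalerAr mulr1 -scalerAl fZ (invM iN).
by rewrite !mulrA.
Qed.

Let act x (v : K) : F -> R[i] := fun y => cfun v (s x * y).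

Let act_approx x v : act x v \in approx_pred gns_form.
Proof.
apply/asboolP => e e0.
have [t ht] := gamma_bounds_neq0 nN iN (s x).
have t0 : 0 < t by case: ht.
have [a ha] := cfun_approx v (ltac:(by rewrite divr_gt0) : 0 < e / t).
exists (x * a) => y; rewrite /act.
have -> : gns_form (x * a) y = gns_form a (s x * y).
  by rewrite /= /B (invM iN) (Defs.invK iN) mulrA.
apply: le_trans (ha _) _.
by rewrite mulrAC ler_pdivrMr// -mulrA ler_wpM2l ?(ltW e0)// mulrC pnrmM.
Qed.

(* On functionals, x acts by precomposition with left multiplication by x#, so no extension
   by continuity is needed. *)
Definition gns_rep x (v : K) : K := Completion (act_approx x v).

Let rep_bound x t : gamma_bounds s x t -> forall v, nrm (gns_rep x v) <= t * nrm v.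
Proof.
move=> /(gamma_bounds_star iN) ht v.
have t0 : 0 < t by case: ht.
rewrite nrm_cnorm; apply: cnorm_le; first by rewrite mulr_ge0 ?nrm_ge0 ?ltW.
move=> y; apply: le_trans (cnormP v (s x * y)) _; rewrite -nrm_cnorm (mulrC t) -mulrA.
by rewrite ler_wpM2l ?nrm_ge0// pnrmM.
Qed.

Let rep_bounded x : bounded_operator (gns_rep x).
Proof.
apply/bounded_operatorP; split.
- by move=> u v; apply/val_inj/funext => y.
- by move=> c v; apply/val_inj/funext => y.
have [t ht] := gamma_bounds_neq0 nN iN x; exists t; last exact: rep_bound.
by case: ht => /ltW.
Qed.

Lemma gns_rep_inc x a : gns_rep x (inc gns_form a) = inc gns_form (x * a).
Proof.
apply/val_inj/funext => y; rewrite /= /act /= /B (invM iN) (Defs.invK iN).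
by rewrite mulrA.
Qed.

(** On vectors of the range of [inc] this is associativity together with [s (s x * b) = s b * x];
    density then extends it one variable at a time. *)
Let rep_star x (u v : K) : dot (gns_rep x u) v = dot u (gns_rep (s x) v).
Proof.
have bT := rep_bounded x; have bS := rep_bounded (s x).
have [M M0 hM] := bop_bound bT; have [M' M'0 hM'] := bop_bound bS.
have bnd (a b : K) : nrm (dot (gns_rep x a) b - dot a (gns_rep (s x) b)) <= (M + M') * (nrm a * nrm b).
  apply: le_trans (nrmD _ _) _; rewrite nrmN mulrDl lerD//.
    apply: le_trans (dot_cauchy_schwarz _ _) _.
    by rewrite mulrA ler_wpM2r ?nrm_ge0.
  apply: le_trans (dot_cauchy_schwarz _ _) _.
  by rewrite mulrCA ler_wpM2l ?nrm_ge0.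
have step b : dot (gns_rep x u) (inc gns_form b) = dot u (gns_rep (s x) (inc gns_form b)).
  apply/eqP; rewrite -subr_eq0; apply/eqP.
  apply: (@dense_eq0 _ _ gns_form (fun a => dot (gns_rep x a) (inc gns_form b) - dot a (gns_rep (s x) (inc gns_form b)))
     ((M + M') * nrm (inc gns_form b))).
  - by rewrite mulr_ge0 ?addr_ge0 ?nrm_ge0.
  - by move=> a c; rewrite (bopB bT) dotBl (dotBl a); exact: subrACA.
  - by move=> a; rewrite -mulrA (mulrC (nrm (inc _ _))); exact: bnd.
  - move=> a; rewrite !gns_rep_inc !dot_inc /= /B (invM iN) (Defs.invK iN) mulrA.
    by rewrite subrr.
apply/eqP; rewrite -subr_eq0; apply/eqP.
apply: (@dense_eq0 _ _ gns_form (fun b => dot (gns_rep x u) b - dot u (gns_rep (s x) b))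
   ((M + M') * nrm u)).
- by rewrite mulr_ge0 ?addr_ge0 ?nrm_ge0.
- by move=> a c; rewrite (bopB bS) 2!dotBr; exact: subrACA.
- by move=> a; rewrite -mulrA; exact: bnd.
- by move=> a; rewrite step subrr.
Qed.

Lemma gns_star_rep : star_rep N s gns_rep.
Proof.
split.
- exact: rep_bounded.
- move=> x y; apply/funext => v; apply/val_inj/funext => z.
  by rewrite /= /act (invD iN) mulrDl cfun_addr.
- move=> c x; apply/funext => v; apply/val_inj/funext => z.
  by rewrite /= /act (invZ iN) -scalerAl cfun_scaler conjcK.
- move=> x y; apply/funext => v; apply/val_inj/funext => z.
  by rewrite /= /act /= /act (invM iN) mulrA.
- by apply/funext => v; apply/val_inj/funext => z; rewrite /= /act (inv1 iN) mul1r.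
- by move=> x; apply: adjoint_unique; [exact: rep_bounded|exact: rep_star].
- move=> x v; apply: le_add_eps => e e0.
  have n1 : 0 < nrm v + 1 by rewrite ltr_wpDl ?nrm_ge0.
  apply: le_trans (rep_bound (gamma_boundsN nN iN _) v) _.
    by instantiate (1 := N x + e / (nrm v + 1)); rewrite ltrDl divr_gt0.
  rewrite mulrDl lerD2l mulrAC ler_pdivrMr// ler_wpM2l ?(ltW e0)//.
  by rewrite lerDl.
Qed.

Lemma nrm_gns_vector x : nrm (gns_rep x (inc gns_form 1)) ^+ 2 = f (s x * x).
Proof. by rewrite gns_rep_inc mulr1 nrm_inc pnrm_f. Qed.

Lemma nrm_gns_unit : nrm (inc gns_form 1) = 1.
Proof.
apply/eqP; rewrite -(@eqrXn2 _ 2) ?nrm_ge0// nrm_inc pnrm_f (inv1 iN) mulr1 f1.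
by rewrite expr1n.
Qed.

End GNS.

Lemma exists_gns (R : realType) (F : algType R[i]) (N : F -> R) (s : F -> F)
    (nN : complete_algebra_norm N) (iN : isometric_involution N s) (x0 : F) :
  0 < gamma s x0 -> exists (K : hilbertType R) (pi : F -> K -> K) (xi : K),
    [/\ star_rep N s pi, nrm xi = 1 & gamma s x0 <= nrm (pi x0 xi)].
Proof.
move=> g0; have [f [fD fZ [f1 fs] fpos fg]] := gamma_state nN iN g0.
exists (completion (gns_form iN fD fZ fs fpos)), (@gns_rep R F N s nN iN f fD fZ fs fpos), (inc _ 1); split.
- exact: gns_star_rep.
- exact: nrm_gns_unit.
rewrite -(@ler_pXn2r _ 2) ?nnegrE ?nrm_ge0 ?(ltW g0)//.
by rewrite nrm_gns_vector.
Qed.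

(** * Representations of the free product *)

Section PowerBound.
Context {R : realType}.

Lemma bernoulli_le (d : R) n : 0 <= d -> 1 + n%:R * d <= (1 + d) ^+ n.
Proof.
move=> d0; elim: n => [|n IH]; first by rewrite mul0r addr0 expr0.
rewrite exprS -natr1; have n0 : 0 <= n%:R * d * d by rewrite !mulr_ge0 ?ler0n.
have := ler_wpM2l (ltac:(by rewrite addr_ge0) : 0 <= 1 + d) IH.
move: n0; set m := n%:R * d; have -> : (n%:R + 1) * d = m + d by rewrite mulrDl mul1r.
nra.
Qed.

(** A constant disappears under high roots. If [g > q], then by Bernoulli's inequality the powers
    [(g / q) ^+ (2 ^ k)] are unbounded, so no [C] can dominate them. *)
Lemma power_bound (g q C : R) : 0 <= g -> 0 <= q ->
  (forall k, g ^+ (2 ^ k) <= C * q ^+ (2 ^ k)) -> g <= q.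
Proof.
move=> g0 q0 h; rewrite leNgt; apply/negP => qg.
have gp : 0 < g by exact: le_lt_trans qg.
move: q0; rewrite le_eqVlt => /predU1P[q0|q0].
  by have := h 0; rewrite expn0 !expr1 -q0 mulr0 leNgt gp.
pose d := g / q - 1.
have d0 : 0 < d by rewrite subr_gt0 ltr_pdivlMr// mul1r.
have bd k : k%:R * d <= C.
  have := h k; rewrite -ler_pdivrMr ?exprn_gt0// -expr_div_n => h1.
  apply: le_trans h1; have -> : g / q = 1 + d by rewrite /d addrC subrK.
  apply: le_trans (bernoulli_le _ (ltW d0)).
  apply: (@le_trans _ _ ((2 ^ k)%:R * d)); last by rewrite lerDr.
  by rewrite ler_wpM2r ?(ltW d0)// ler_nat ltnW// ltn_expl.
have C0 : 0 <= C by have := bd 0%N; rewrite mul0r.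
have := bd (Num.bound (C / d)); rewrite -ler_pdivlMr// leNgt archi_boundP//.
by rewrite divr_ge0// ltW.
Qed.

End PowerBound.

Section FreeProductNorm.
Context {R : realType} {H : hilbertType R}.
Variables (A : set (H -> H)) (hA : unital_operator_algebra A).
Variables (P : algType R[i]) (iA iA' : (H -> H) -> P).
Hypothesis afp : is_algebraic_free_product A iA iA'.

Lemma opalg_bop T : A T -> bounded_operator T.
Proof. by case: hA => -[+ _ _ _ _ _] _; apply. Qed.

Lemma opalg_zero : A 0.
Proof. by case: hA => -[_ + _ _ _ _] _. Qed.

Lemma opalg_id : A idfun.
Proof. by case: hA. Qed.

Lemma adjoint_alg_bop T : adjoint_algebra A T -> bounded_operator T.
Proof. by move=> [S /opalg_bop bS <-]; exact: bounded_adjoint. Qed.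

Lemma adjoint_algP T : adjoint_algebra A T -> A (adjoint T).
Proof. by move=> [S AS <-]; rewrite adjointK//; exact: opalg_bop. Qed.

Lemma adjoint_alg_zero : adjoint_algebra A 0.
Proof. by exists 0; [exact: opalg_zero|exact: adjoint_0]. Qed.

Lemma adjoint_alg_id : adjoint_algebra A idfun.
Proof. by exists idfun; [exact: opalg_id|exact: adjoint_id]. Qed.

Lemma uhom0 (B : set (H -> H)) (X : algType R[i]) (f : (H -> H) -> X) :
  unital_hom B f -> B 0 -> f 0 = 0.
Proof. by move=> uf B0; have := uhomZ uf 0 B0; rewrite !scale0r. Qed.

Lemma iA0 : iA 0 = 0.
Proof. by apply: (uhom0 (afp_homl afp)); exact: opalg_zero. Qed.

Lemma iA'0 : iA' 0 = 0.
Proof. by apply: (uhom0 (afp_homr afp)); exact: adjoint_alg_zero. Qed.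

Lemma oaf_ge0 m n (x : 'M[P]_(m, n)) c : oa_factorization A iA iA' x c -> 0 <= c.
Proof. by elim=> *; [exact: mx_opnorm_ge0|exact: mx_opnorm_ge0|exact: mulr_ge0]. Qed.

Lemma oa_norm_le m n (x : 'M[P]_(m, n)) c :
  oa_factorization A iA iA' x c -> oa_norm A iA iA' x <= c.
Proof. by move=> h; apply: ge_inf => //; exists 0 => d /oaf_ge0. Qed.

(** Entries of matrix units over [A]. [H -> H] carries only its pointwise structure, so identity and
    unit matrices of operators are assembled from [idfun] and [0]. *)
Definition id_entry (b : bool) : H -> H := if b then idfun else 0.

Lemma iA_id_entry b : iA (id_entry b) = b%:R.
Proof. by case: b; [exact: uhom1 (afp_homl afp)|exact: iA0]. Qed.

Lemma A_id_entry b : A (id_entry b).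
Proof. by case: b; [exact: opalg_id|exact: opalg_zero]. Qed.

Lemma oaf_row_unit m (i : 'I_m) :
  exists2 c, oa_factorization A iA iA' (delta_mx 0 i : 'rV[P]_m) c & c <= 1.
Proof.
pose a : 'rV[H -> H]_m := \row_j id_entry (j == i).
exists (mx_opnorm a).
  have -> : delta_mx 0 i = map_mx iA a :> 'rV[P]_m.
    by apply/matrixP => k j; rewrite !mxE ord1 eqxx /= iA_id_entry.
  by apply: OAleft => k j; rewrite mxE; exact: A_id_entry.
apply: mx_opnorm_le => // xi; rewrite vsq1 expr1n mul1r /mxop.
rewrite (bigD1 i)//= mxE eqxx /= big1 ?addr0; last first.
  by move=> j ji; rewrite mxE (negbTE ji).
by rewrite /vsq (bigD1 i)//= lerDl; apply: sumr_ge0 => j _; exact: sqr_ge0.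
Qed.

Lemma oaf_col_unit m (i : 'I_m) :
  exists2 c, oa_factorization A iA iA' (delta_mx i 0 : 'cV[P]_m) c & c <= 1.
Proof.
pose a : 'cV[H -> H]_m := \col_j id_entry (j == i).
exists (mx_opnorm a).
  have -> : delta_mx i 0 = map_mx iA a :> 'cV[P]_m.
    by apply/matrixP => j k; rewrite !mxE ord1 eqxx andbT iA_id_entry.
  by apply: OAleft => j k; rewrite mxE; exact: A_id_entry.
apply: mx_opnorm_le => // xi; rewrite vsq1 expr1n mul1r /vsq.
rewrite (bigD1 i)//= /mxop big_ord1 mxE eqxx /= big1 ?addr0//.
by move=> j ji; rewrite big_ord1 mxE (negbTE ji) nrm0 expr0n.
Qed.

(** An entry is the matrix compressed by a row and a column matrix unit, two further factors of norm
    at most 1. In this way the norm of single elements controls factorizations of matrices. *)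
Lemma oa_norm_entry m n (x : 'M[P]_(m, n)) c i j : oa_factorization A iA iA' x c ->
  oa_norm A iA iA' (const_mx (x i j) : 'M[P]_1) <= c.
Proof.
move=> h; have [c1 h1 c11] := oaf_row_unit i; have [c2 h2 c21] := oaf_col_unit j.
have -> : const_mx (x i j) = delta_mx 0 i *m x *m delta_mx j 0 :> 'M[P]_1.
  by rewrite -rowE -colE; apply/matrixP => p q; rewrite !mxE.
apply: le_trans (oa_norm_le (OAmul (OAmul h1 h) h2)) _.
have c0 := oaf_ge0 h; have c10 := oaf_ge0 h1; have c20 := oaf_ge0 h2.
apply: (@le_trans _ _ (c1 * c)); first by rewrite ler_piMr// mulr_ge0.
by rewrite ler_piMl.
Qed.

End FreeProductNorm.

Section RepContractive.
Context {R : realType} {H : hilbertType R}.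
Variables (A : set (H -> H)) (hA : unital_operator_algebra A).
Variables (F : algType R[i]) (N : F -> R) (s : F -> F) (jA jA' : (H -> H) -> F).
Hypothesis hF : is_oa_free_product A N s jA jA'.
Variables (K : hilbertType R) (pi : F -> K -> K).
Hypothesis pirep : star_rep N s pi.

Let iN := ofp_involution hF.

Definition mxact m n (X : 'M[F]_(m, n)) (xi : 'I_n -> K) : 'I_m -> K := mxop (map_mx pi X) xi.

Let pi0 : pi 0 = 0.
Proof. by have := srepZ pirep 0 0; rewrite !scale0r. Qed.

Let pi_sum I (r : seq I) (Q : pred I) (f : I -> F) v :
  pi (\sum_(i <- r | Q i) f i) v = \sum_(i <- r | Q i) pi (f i) v.
Proof.
apply: (big_morph (fun x => pi x v)) => [x y|]; first by rewrite (srepD pirep).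
by rewrite pi0.
Qed.

Lemma mxact_mul m n p (X : 'M[F]_(m, n)) (Y : 'M[F]_(n, p)) xi :
  mxact (X *m Y) xi = mxact X (mxact Y xi).
Proof.
apply/funext => i; rewrite /mxact /mxop.
transitivity (\sum_(j < p) \sum_(l < n) pi (X i l) (pi (Y l j) (xi j))).
  by apply: eq_bigr => j _; rewrite !mxE pi_sum; apply: eq_bigr => l _; rewrite (srepM pirep).
rewrite exchange_big; apply: eq_bigr => l _; rewrite !mxE (bop_sum (srep_bounded pirep _)).
by apply: eq_bigr => j _; rewrite !mxE.
Qed.

Lemma mxact_star m n (X : 'M[F]_(m, n)) xi eta :
  vform m (mxact X xi) eta = vform n xi (mxact (mx_star s X) eta).
Proof.
rewrite /mxact mxadjP; last by move=> i j; rewrite mxE; exact: (srep_bounded pirep).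
congr (vform n xi (mxop _ eta)); apply/matrixP => i j; rewrite !mxE.
exact: (srep_star pirep).
Qed.

(* With b_0 = a# a and b_(l+1) = b_l^2, Cauchy-Schwarz gives <b_l xi, xi>^2 <=
   <b_(l+1) xi, xi> |xi|^2, while <b_l xi, xi> = O(|a|^(2^(l+1))). *)
Lemma rep_completely_contractive : completely_contractive A (pi \o jA).
Proof.
move=> n a Aa; have ba : bounded_mx a by move=> i j; exact: (opalg_bop hA).
have [P [iA [iA' [k [afp [jAE jA'E] Nk _]]]]] := ofp_completion hF.
set c := mx_opnorm a; have c0 : 0 <= c by exact: mx_opnorm_ge0.
pose b := fix b k := if k is k'.+1 then b k' *m b k' else mx_star s (map_mx jA a) *m map_mx jA a.
have bstar l : mx_star s (b l) = b l.
  elim: l => [|l IH] /=; first by rewrite (mx_starM iN) (mx_starK iN).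
  by rewrite (mx_starM iN) IH.
(* [b l] lifts to the algebraic free product as a product of [2 ^ l] copies of [a# a], so the
   definition of [oa_norm] applies to its entries. *)
have bfact l : exists2 p : 'M[P]_n, oa_factorization A iA iA' p ((c ^+ 2) ^+ (2 ^ l)) & b l = map_mx k p.
  elim: l => [|l [p hp bp]] /=; last first.
    exists (p *m p); last by rewrite map_mxM bp.
    by rewrite expnS mul2n -addnn exprD; exact: OAmul.
  exists (map_mx iA' (mxadj a) *m map_mx iA a).
    rewrite expn0 expr1 expr2 /c -{1}(mx_opnorm_adj ba); apply: OAmul; last exact: OAleft.
    by apply: OAright => i j; rewrite mxE; exists (a j i).
  rewrite map_mxM; congr (_ *m _); apply/matrixP => i j; rewrite !mxE.
    by rewrite (ofp_star hF)// jA'E//; exists (a j i).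
  by rewrite jAE.
have bent l i j : N (b l i j) <= (c ^+ 2) ^+ (2 ^ l).
  have [p hp ->] := bfact l; rewrite mxE Nk.
  exact: (oa_norm_entry hA afp _ _ hp).
have -> : map_mx (pi \o jA) a = map_mx pi (map_mx jA a) by rewrite map_mx_comp.
apply: mx_opnorm_le => // xi; rewrite -/(mxact _ _).
pose f l := complex.Re (vform n (mxact (b l) xi) xi).
pose v := vsq xi; have v0 : 0 <= v := vsq_ge0 _.
have fS l : f l.+1 = vsq (mxact (b l) xi).
  by rewrite /f -[b l.+1]/(b l *m b l) mxact_mul mxact_star bstar -pnrm_vform pnrm_sqr.
have f_0 : f 0%N = vsq (mxact (map_mx jA a) xi).
  by rewrite /f -[b 0%N]/(_ *m _) mxact_mul mxact_star (mx_starK iN) -pnrm_vform pnrm_sqr.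
have f0 l : 0 <= f l by case: l => [|l]; rewrite ?fS ?f_0 vsq_ge0.
have fsq l : f l ^+ 2 <= f l.+1 * v.
  have := cauchy_schwarz (vform n) (mxact (b l) xi) xi.
  have h1 : f l <= nrm (vform n (mxact (b l) xi) xi) := nrmc_ge_Re _.
  move=> /(le_trans h1) h2; rewrite fS /v -!pnrm_vform -exprMn.
  by rewrite ler_pXn2r ?nnegrE ?mulr_ge0 ?pnrm_ge0.
(* A crude constant from the entrywise bounds, independent of [l]; [power_bound] removes it. *)
pose C := \sum_i \sum_j nrm (xi j) * nrm (xi i).
have fb l : f l <= C * (c ^+ 2) ^+ (2 ^ l).
  apply: le_trans (nrmc_ge_Re _) _; rewrite /= mulr_suml.
  apply: le_trans (nrm_sum _ _ _) _; apply: ler_sum => i _.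
  rewrite /mxact /mxop dot_suml mulr_suml.
  apply: le_trans (nrm_sum _ _ _) _; apply: ler_sum => j _.
  apply: le_trans (dot_cauchy_schwarz _ _) _; rewrite mxE mulrAC.
  rewrite ler_wpM2r ?nrm_ge0//; apply: le_trans (srep_norm pirep _ _) _.
  by rewrite mulrC ler_wpM2l ?nrm_ge0 ?bent.
rewrite -f_0 -/v.
move: v0; rewrite le_eqVlt => /predU1P[v0|v0].
  have := fsq 0%N; rewrite -v0 mulr0 => h; rewrite mulr0.
  by apply: sqr_le_lemma => //; rewrite expr0n.
rewrite -ler_pdivrMr//.
apply: (@power_bound _ _ _ (C / v)); rewrite ?divr_ge0 ?sqr_ge0 ?(ltW v0)// => l.
apply: (@le_trans _ _ (f l / v)); last first.
  by rewrite mulrAC ler_wpM2r ?invr_ge0 ?(ltW v0).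
(* Squaring the induction hypothesis and applying [fsq] gives [(f 0 / v) ^+ (2 ^ l) <= f l / v]. *)
elim: l => [|l IH]; first by rewrite expn0 expr1.
rewrite expnS mulnC exprM; apply: (@le_trans _ _ ((f l / v) ^+ 2)).
  by rewrite ler_pXn2r ?nnegrE ?exprn_ge0 ?divr_ge0 ?(ltW v0).
by rewrite expr_div_n ler_pdivrMr ?exprn_gt0// expr2 mulrA divfK ?gt_eqF// -expr2.
Qed.

End RepContractive.

(** * Subalgebras and induction over the algebraic free product *)

Section Subalgebra.
Context {R : realType} {P : algType R[i]}.

Record unital_subalgebra (S : set P) : Prop := {
  usub1 : S 1;
  usubZD : forall c x y, S x -> S y -> S (c *: x + y);
  usubM : forall x y, S x -> S y -> S (x * y) }.

Variables (S : set P) (hS : unital_subalgebra S).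

(** Indexed by the proof [hS], so that the closure instance can be attached to the predicate. *)
Definition sub_pred of unital_subalgebra S : {pred P} := [pred x | `[< S x >]].

Lemma sub_pred_closed : subalg_closed (sub_pred hS).
Proof.
split.
- by apply/asboolP; exact: (usub1 hS).
- by move=> c x y /asboolP hx /asboolP hy; apply/asboolP; exact: (usubZD hS).
- by move=> x y /asboolP hx /asboolP hy; apply/asboolP; exact: (usubM hS).
Qed.

HB.instance Definition _ := GRing.isSubalgClosed.Build R[i] P (sub_pred hS) sub_pred_closed.

Record subalg := Subalg { subalg_val : P; subalgP : subalg_val \in sub_pred hS }.

HB.instance Definition _ := [isSub for subalg_val].
HB.instance Definition _ := [Choice of subalg by <:].
HB.instance Definition _ := [SubChoice_isSubAlgebra of subalg by <:].

Let val_zmod : zmod_morphism subalg_val.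
Proof. by []. Qed.

Let val_monoid : monoid_morphism subalg_val.
Proof. by []. Qed.

Let val_scalable : scalable subalg_val.
Proof. by []. Qed.

HB.instance Definition _ := GRing.isZmodMorphism.Build subalg P subalg_val val_zmod.
HB.instance Definition _ := GRing.isMonoidMorphism.Build subalg P subalg_val val_monoid.
HB.instance Definition _ := GRing.isScalable.Build R[i] subalg P *:%R subalg_val val_scalable.

End Subalgebra.

Section FreeProductInduction.
Context {R : realType} {H : hilbertType R}.
Variables (A : set (H -> H)) (hA : unital_operator_algebra A).
Variables (P : algType R[i]) (iA iA' : (H -> H) -> P).
Hypothesis afp : is_algebraic_free_product A iA iA'.

Lemma adjoint_algD S T : adjoint_algebra A S -> adjoint_algebra A T -> adjoint_algebra A (S + T).
Proof.
move=> [S' AS <-] [T' AT <-]; exists (S' + T'); first by case: hA => -[_ _ + _ _ _] _; apply.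
by rewrite adjointD//; exact: (opalg_bop hA).
Qed.

Lemma adjoint_algZ (c : R[i]) T : adjoint_algebra A T -> adjoint_algebra A (c *: T).
Proof.
move=> [T' AT <-]; exists (conjc c *: T'); first by case: hA => -[_ _ _ + _ _] _; apply.
by rewrite adjointZ ?conjcK//; exact: (opalg_bop hA).
Qed.

Lemma adjoint_algM S T : adjoint_algebra A S -> adjoint_algebra A T -> adjoint_algebra A (S \o T).
Proof.
move=> [S' AS <-] [T' AT <-]; exists (T' \o S'); first by case: hA => -[_ _ _ _ + _] _; apply.
by rewrite adjointM//; exact: (opalg_bop hA).
Qed.

(* The inclusion of a subalgebra S containing both factors has a section, given by the
   universal property, so it is onto. *)
Lemma free_product_ind (S : set P) : unital_subalgebra S ->
  (forall a, A a -> S (iA a)) -> (forall b, adjoint_algebra A b -> S (iA' b)) ->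
  forall p, S p.
Proof.
move=> hS SA SA'.
(* The default [1] is a value outside [S] only; [ins] is evaluated on elements of [S]. *)
pose ins (x : P) : subalg hS := insubd (1 : subalg hS) x.
have insK x : S x -> subalg_val (ins x) = x by move=> Sx; rewrite /ins [LHS]insubdK//; apply/asboolP.
have uins (B : set (H -> H)) f : unital_hom B f -> (forall a, B a -> S (f a)) ->
    (forall T U, B T -> B U -> B (T + U)) -> (forall (c : R[i]) T, B T -> B (c *: T)) ->
    (forall T U, B T -> B U -> B (T \o U)) -> unital_hom B (ins \o f).
  move=> uf Bf BD BZ BM; split=> [|T U hT hU|c T hT|T U hT hU]; apply: val_inj => /=.
  - by rewrite (uhom1 uf) insK//; exact: (usub1 hS).
  - have h1 := Bf _ hT; have h2 := Bf _ hU; have h3 := Bf _ (BD _ _ hT hU).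
    by rewrite !insK// (uhomD uf).
  - have h1 := Bf _ hT; have h3 := Bf _ (BZ c _ hT).
    by rewrite !insK// (uhomZ uf).
  - have h1 := Bf _ hT; have h2 := Bf _ hU; have h3 := Bf _ (BM _ _ hT hU).
    by rewrite !insK// (uhomM uf).
have [h [hl hr] _] := afp_universal afp
  (uins _ _ (afp_homl afp) SA (opalgD hA.1) (opalgZ hA.1) (opalgM hA.1))
  (uins _ _ (afp_homr afp) SA' adjoint_algD adjoint_algZ adjoint_algM)
  (fun d dd => congr1 ins (afp_agree afp dd)).
(* Uniqueness with target [P] itself: the identity and the inclusion composed with [h] both extend
   [iA] and [iA']. *)
have [h0 _ h0u] := afp_universal afp (afp_homl afp) (afp_homr afp) (afp_agree afp).
pose g : {lrmorphism P -> P} := @subalg_val _ _ _ hS \o h.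
have gh0 : g =1 h0.
  by apply: h0u; split=> [a Aa|b Ab]; rewrite /g /= ?hl ?hr//= insK//; [exact: SA|exact: SA'].
have idh0 : (idfun : {lrmorphism P -> P}) =1 h0 by exact: h0u.
move=> p; have -> : p = subalg_val (h p) by rewrite -[LHS]/(idfun p) idh0 -gh0.
by have /asboolP := subalgP (h p).
Qed.

End FreeProductInduction.

(** * Concrete C*-algebras as abstract Banach *-algebras *)

Section OperatorAlgType.
Context {R : realType} {L : hilbertType R}.

(** The unit may differ from [idfun], as [j idfun] may be a proper projection of [L]. It must be
    nonzero because the algebras of the universal property are nontrivial rings. *)
Record unital_cstar := UnitalCstar {
  uc_set : set (L -> L);
  uc_one : L -> L;
  uc_cstar : cstar_algebra uc_set;
  uc_one_in : uc_set uc_one;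
  uc_mul1 : forall T, uc_set T -> uc_one \o T = T;
  uc_1mul : forall T, uc_set T -> T \o uc_one = T;
  uc_neq0 : uc_one <> 0 }.

Variable C : unital_cstar.

Lemma uc_bounded T : uc_set C T -> bounded_operator T.
Proof. by case: (uc_cstar C) => -[+ _ _ _ _ _] _; apply. Qed.

Definition uc_pred : {pred L -> L} := [pred T | `[< uc_set C T >]].

Lemma uc_submod : submod_closed uc_pred.
Proof.
case: (uc_cstar C) => -[_ C0 CD CZ _ _] _; split; first exact/asboolP.
by move=> c S T /asboolP hS /asboolP hT; apply/asboolP; apply: CD => //; exact: CZ.
Qed.

HB.instance Definition _ := GRing.isSubmodClosed.Build R[i] (L -> L) uc_pred uc_submod.

Record op := Op { op_val : L -> L; opP : op_val \in uc_pred }.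

HB.instance Definition _ := [isSub for op_val].
HB.instance Definition _ := [Choice of op by <:].
HB.instance Definition _ := [SubChoice_isSubLmodule of op by <:].

Implicit Types (x y z : op).

Lemma op_in x : uc_set C (op_val x).
Proof. by have /asboolP := opP x. Qed.

Lemma op_bounded x : bounded_operator (op_val x).
Proof. exact: uc_bounded (op_in x). Qed.

Definition mkop T (hT : uc_set C T) : op := Op (introT (asboolP _) hT : T \in uc_pred).

Definition op_one : op := mkop (uc_one_in C).
Definition op_mul x y : op := mkop (opalgM (uc_cstar C).1 (op_in x) (op_in y)).
Definition op_star x : op := mkop ((uc_cstar C).2 _ (op_in x)).

Let op_mulA : associative op_mul.
Proof. by move=> x y z; exact: val_inj. Qed.

Let op_mul1 : left_id op_one op_mul.
Proof. by move=> x; apply: val_inj; apply: uc_mul1; exact: op_in. Qed.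

Let op_1mul : right_id op_one op_mul.
Proof. by move=> x; apply: val_inj; apply: uc_1mul; exact: op_in. Qed.

Let op_mulDl : left_distributive op_mul +%R.
Proof. by move=> x y z; exact: val_inj. Qed.

Let op_mulDr : right_distributive op_mul +%R.
Proof.
move=> x y z; apply/val_inj/funext => v /=.
exact: (bopD (op_bounded x)).
Qed.

Let op_one_neq0 : op_one != 0.
Proof. by apply/eqP => /(congr1 op_val) /=; exact: uc_neq0. Qed.

HB.instance Definition _ := GRing.Zmodule_isNzRing.Build op
  op_mulA op_mul1 op_1mul op_mulDl op_mulDr op_one_neq0.

Let op_scaleAl (c : R[i]) x y : c *: (x * y) = (c *: x) * y.
Proof. exact: val_inj. Qed.

HB.instance Definition _ := GRing.Lmodule_isLalgebra.Build R[i] op op_scaleAl.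

Let op_scaleAr (c : R[i]) x y : c *: (x * y) = x * (c *: y).
Proof. by apply/val_inj/funext => v; exact: (esym (bopZ (op_bounded x) c (op_val y v))). Qed.

HB.instance Definition _ := GRing.Lalgebra_isAlgebra.Build R[i] op op_scaleAr.

Definition op_norm x : R := opnorm (op_val x).

(** Norm closedness of the algebra becomes completeness, so [selfadjoint_sqrt] can be used inside
    it. *)
Lemma op_complete_norm : complete_algebra_norm op_norm.
Proof.
split.
- by move=> x x0; apply: val_inj; apply: opnorm_eq0 => //; exact: op_bounded.
- by move=> x y; apply: opnormD; exact: op_bounded.
- by move=> c x; rewrite normE -rmorphM /op_norm -opnormZ//; exact: op_bounded.
- by move=> x y; apply: opnormM; exact: op_bounded.
move=> u cu.
have [T bT hT] := bounded_complete (fun n => op_bounded (u n)) cu.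
have CT : uc_set C T.
  apply: (opalg_closed (uc_cstar C).1) => // e e0; have [n0 /(_ n0 (leqnn _)) h] := hT e e0.
  by exists (op_val (u n0)); [exact: op_in|rewrite opnormB//; exact: op_bounded].
by exists (mkop CT).
Qed.

Lemma op_isometric_involution : isometric_involution op_norm op_star.
Proof.
split.
- by move=> x; apply: val_inj; apply: adjointK; exact: op_bounded.
- by move=> x y; apply: val_inj; apply: adjointD; exact: op_bounded.
- by move=> c x; apply: val_inj; apply: adjointZ; exact: op_bounded.
- by move=> x y; apply: val_inj; apply: adjointM; exact: op_bounded.
- by move=> x; apply: opnorm_adjoint; exact: op_bounded.
Qed.

(* Automatic contractivity of a unital *-homomorphism: e - T*T is a square when |T| < 1. *)
Lemma star_hom_contractive (K : hilbertType R) (pi : (L -> L) -> (K -> K)) :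
  operator_star_hom (uc_set C) pi -> (forall T, uc_set C T -> bounded_operator (pi T)) ->
  pi (uc_one C) = idfun ->
  forall T v, uc_set C T -> nrm (pi T v) <= opnorm T * nrm v.
Proof.
move=> [hpi pis] bpi pi1 T v CT; have bT := uc_bounded CT.
have CM := opalgM (uc_cstar C).1; have CZ := opalgZ (uc_cstar C).1; have CA := (uc_cstar C).2.
have lt1 S : uc_set C S -> opnorm S < 1 -> nrm (pi S v) <= nrm v.
  move=> CS S1; have bS := uc_bounded CS.
  pose x := mkop CS; pose h := op_star x * x.
  have [||y sy hy] := @selfadjoint_sqrt _ _ _ _ op_complete_norm op_isometric_involution h.
  - by rewrite /h (invM op_isometric_involution) (Defs.invK op_isometric_involution).
  - apply: le_lt_trans (canM op_complete_norm _ _) _; rewrite (inv_norm op_isometric_involution).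
    by rewrite mulr_ilt1 ?(can_ge0 op_complete_norm).
  have Cy := op_in y; have by_ := op_bounded y.
  (* Under [pi], and paired with [v], this says that [|v|^2] is the sum of [|pi S v|^2] and
     [|pi y v|^2]. *)
  have /(congr1 op_val) : 1 = op_star x * x + op_star y * y by rewrite sy -hy addrC subrK.
  rewrite -[op_val 1]/(uc_one C) -[op_val (_ + _)]/((adjoint S \o S) + (adjoint (op_val y) \o op_val y)).
  move=> /(congr1 pi).
  rewrite pi1 (ophomD hpi (CM _ _ (CA _ CS) CS) (CM _ _ (CA _ Cy) Cy)).
  rewrite (ophomM hpi (CA _ CS) CS) (ophomM hpi (CA _ Cy) Cy) (pis _ CS) (pis _ Cy).
  move=> /(congr1 (fun T => complex.Re (dot (T v) v))).
  have bS' := bpi _ CS; have by' := bpi _ Cy.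
  rewrite fctE dotDl raddfD /= (adjointPr bS') (adjointPr by').
  rewrite !dotxx /= => e; apply: sqr_le_lemma; first exact: nrm_ge0.
  by rewrite e lerDl sqr_ge0.
(* [lt1] asks for norm strictly below 1, so [T] is divided by an [r] slightly above its norm; the
   excess costs at most [e]. *)
apply: le_add_eps => e e0; set r := opnorm T + e / (nrm v + 1).
have v1 : 0 < nrm v + 1 by rewrite ltr_wpDl ?nrm_ge0.
have r0 : 0 < r by rewrite ltr_wpDl ?opnorm_ge0// divr_gt0.
have := lt1 ((r^-1)%:C *: T) (CZ _ _ CT).
rewrite opnormZ// nrmc_real ger0_norm ?invr_ge0 ?(ltW r0)//.
rewrite mulrC ltr_pdivrMr// mul1r ltrDl divr_gt0// => /(_ isT).
rewrite (ophomZ hpi)// fctE nrmZ nrmc_real ger0_norm ?invr_ge0 ?(ltW r0)//.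
rewrite ler_pdivrMl// /r mulrDl => /le_trans; apply.
by rewrite lerD2l mulrAC ler_pdivrMr// ler_wpM2l ?(ltW e0)// lerDl.
Qed.

End OperatorAlgType.

(** * Every element of the algebraic free product has a factorization *)

Section Factorizations.
Context {R : realType} {H : hilbertType R}.
Variables (A : set (H -> H)) (hA : unital_operator_algebra A).
Variables (P : algType R[i]) (iA iA' : (H -> H) -> P).
Hypothesis afp : is_algebraic_free_product A iA iA'.

Local Notation oaf := (oa_factorization A iA iA').

Let id_mx q : 'M[H -> H]_q := \matrix_(i, j) id_entry (i == j).

Let iA'_id_entry b : iA' (@id_entry R H b) = b%:R.
Proof. by case: b; [exact: uhom1 (afp_homr afp)|exact: (iA'0 hA afp)]. Qed.

Let map_id (f : (H -> H) -> P) q : (forall b, f (@id_entry R H b) = b%:R) ->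
  map_mx f (id_mx q) = 1%:M.
Proof. by move=> fE; apply/matrixP => i j; rewrite !mxE fE. Qed.

Let map_0 (f : (H -> H) -> P) m n : (forall b, f (@id_entry R H b) = b%:R) ->
  map_mx f (0 : 'M[H -> H]_(m, n)) = 0.
Proof. by move=> fE; apply/matrixP => i j; rewrite !mxE (fE false). Qed.

(** Both algebras contain the identity and 0, so padding by an identity block keeps each factor over
    its own algebra. The cost [c'] is left arbitrary: the purpose is existence in [oaf_exists]. *)
Lemma oaf_block_l q m n (x : 'M[P]_(m, n)) c : oaf x c ->
  exists c', oaf (block_mx x 0 0 (1%:M : 'M[P]_q)) c'.
Proof.
elim=> {m n x c} [m n a Aa|m n b Ab|m n p x y c d _ [c' hx] _ [d' hy]].
- exists (mx_opnorm (block_mx a 0 0 (id_mx q))).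
  have fE := iA_id_entry hA afp.
  rewrite -(map_id _ fE) -(map_0 _ _ fE) -(map_0 _ _ fE) -map_block_mx; apply: OAleft => i j.
  by case: (split_ordP i) => k ->; case: (split_ordP j) => l ->;
    rewrite ?(block_mxEul, block_mxEur, block_mxEdl, block_mxEdr) ?mxE//;
    [exact: (opalg_zero hA)|exact: (opalg_zero hA)|exact: A_id_entry].
- exists (mx_opnorm (block_mx b 0 0 (id_mx q))).
  rewrite -(map_id _ iA'_id_entry) -(map_0 _ _ iA'_id_entry) -(map_0 _ _ iA'_id_entry).
  rewrite -map_block_mx; apply: OAright => i j.
  case: (split_ordP i) => k ->; case: (split_ordP j) => l ->;
    rewrite ?(block_mxEul, block_mxEur, block_mxEdl, block_mxEdr) ?mxE//.
  - exact: (adjoint_alg_zero hA).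
  - exact: (adjoint_alg_zero hA).
  - by case: (k == l); [exact: (adjoint_alg_id hA)|exact: (adjoint_alg_zero hA)].
exists (c' * d').
have -> : block_mx (x *m y) 0 0 1%:M
    = block_mx x 0 0 1%:M *m block_mx y 0 0 1%:M :> 'M[P]_(m + q, p + q).
  by rewrite mulmx_block !mulmx0 !mul0mx !addr0 !add0r mulmx1.
exact: OAmul.
Qed.

Lemma oaf_block_r q m n (x : 'M[P]_(m, n)) c : oaf x c ->
  exists c', oaf (block_mx (1%:M : 'M[P]_q) 0 0 x) c'.
Proof.
elim=> {m n x c} [m n a Aa|m n b Ab|m n p x y c d _ [c' hx] _ [d' hy]].
- exists (mx_opnorm (block_mx (id_mx q) 0 0 a)).
  have fE := iA_id_entry hA afp.
  rewrite -(map_id _ fE) -(map_0 _ _ fE) -(map_0 _ _ fE) -map_block_mx; apply: OAleft => i j.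
  by case: (split_ordP i) => k ->; case: (split_ordP j) => l ->;
    rewrite ?(block_mxEul, block_mxEur, block_mxEdl, block_mxEdr) ?mxE//;
    [exact: A_id_entry|exact: (opalg_zero hA)|exact: (opalg_zero hA)].
- exists (mx_opnorm (block_mx (id_mx q) 0 0 b)).
  rewrite -(map_id _ iA'_id_entry) -(map_0 _ _ iA'_id_entry) -(map_0 _ _ iA'_id_entry).
  rewrite -map_block_mx; apply: OAright => i j.
  case: (split_ordP i) => k ->; case: (split_ordP j) => l ->;
    rewrite ?(block_mxEul, block_mxEur, block_mxEdl, block_mxEdr) ?mxE//.
  - by case: (k == l); [exact: (adjoint_alg_id hA)|exact: (adjoint_alg_zero hA)].
  - exact: (adjoint_alg_zero hA).
  - exact: (adjoint_alg_zero hA).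
exists (c' * d').
have -> : block_mx 1%:M 0 0 (x *m y)
    = block_mx 1%:M 0 0 x *m block_mx 1%:M 0 0 y :> 'M[P]_(q + m, q + p).
  by rewrite mulmx_block !mulmx0 !mul0mx !addr0 !add0r mulmx1.
exact: OAmul.
Qed.

(* [x + y] = [1 1] (x (+) 1) (1 (+) y) [1; 1] *)
Lemma oaf_exists p : exists c, oaf (const_mx p : 'M[P]_1) c.
Proof.
have scE (x : P) : const_mx x = x%:M :> 'M[P]_1.
  by apply/matrixP => i j; rewrite !mxE !ord1.
rewrite scE.
have sc a : A a -> exists c, oaf ((iA a)%:M : 'M[P]_1) c.
  move=> Aa; exists (mx_opnorm (const_mx a : 'M[H -> H]_1)).
  by rewrite -scE -map_const_mx; apply: OAleft => i j; rewrite mxE.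
have sc' b : adjoint_algebra A b -> exists c, oaf ((iA' b)%:M : 'M[P]_1) c.
  move=> Ab; exists (mx_opnorm (const_mx b : 'M[H -> H]_1)).
  by rewrite -scE -map_const_mx; apply: OAright => i j; rewrite mxE.
have cst m n (c : R[i]) : exists d, oaf (const_mx c%:A : 'M[P]_(m, n)) d.
  exists (mx_opnorm (const_mx (c *: idfun) : 'M[H -> H]_(m, n))).
  have -> : c%:A = iA (c *: idfun) :> P.
    by rewrite (uhomZ (afp_homl afp)) ?(uhom1 (afp_homl afp))//; exact: (opalg_id hA).
  rewrite -map_const_mx; apply: OAleft => i j; rewrite mxE.
  by apply: (opalgZ hA.1); exact: (opalg_id hA).
apply: (free_product_ind hA afp (S := [set x | exists c, oaf (x%:M : 'M[P]_1) c])) => //.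
split=> [|c x y [d hx] [d' hy]|x y [d hx] [d' hy]]; last 1 first.
- by exists (d * d'); rewrite scalar_mxM; exact: OAmul.
- by have := cst 1%N 1%N 1; rewrite scE scale1r.
have [d1 h1] := cst 1%N (1 + 1)%N 1; have [d2 h2] := cst (1 + 1)%N 1%N 1.
have [d3 h3] := oaf_block_l 1 hx; have [d4 h4] := oaf_block_r 1 hy.
(* The closure condition concerns [c *: x + y]; the scalar enters as one more factor, the diagonal
   block of [c] and 1. *)
have [d5 h5] := cst 1%N 1%N c; have [d6 h6] := oaf_block_l 1 h5.
exists (d1 * d6 * d3 * d4 * d2).
pose Bc := block_mx (const_mx c%:A) 0 0 1%:M : 'M[P]_(1 + 1).
pose Bx := block_mx x%:M 0 0 1%:M : 'M[P]_(1 + 1).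
pose By := block_mx 1%:M 0 0 y%:M : 'M[P]_(1 + 1).
suff -> : (c *: x + y)%:M = (const_mx 1%:A : 'M[P]_(1, 1 + 1)) *m Bc *m Bx *m By *m const_mx 1%:A.
  by do 4![apply: OAmul => //].
rewrite /Bc /Bx /By scale1r -row_mx_const -col_mx_const !scE !mul_row_block !mul_row_col.
rewrite !mulmx0 !add0r !addr0 !mul1mx !mulmx1 -scalar_mxM -raddfD.
by rewrite -scalerAl mul1r.
Qed.

End Factorizations.

(** * The maximal C*-algebra *)

Section MaximalCstar.
Context {R : realType} {H L : hilbertType R}.
Variables (A : set (H -> H)) (C : set (L -> L)) (j : (H -> H) -> (L -> L)).
Hypotheses (hA : unital_operator_algebra A) (hC : is_maximal_cstar A C j).

Let CO := (cmax_cstar hC).1.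
Let CA := (cmax_cstar hC).2.

Lemma cmax_bop T : C T -> bounded_operator T.
Proof. by case: CO => + _ _ _ _ _; apply. Qed.

Lemma cmax_bop_j a : A a -> bounded_operator (j a).
Proof. by move=> Aa; apply: cmax_bop; exact: (cmax_in hC). Qed.

Lemma cmax_opnorm a : A a -> opnorm (j a) = opnorm a.
Proof.
move=> Aa; have := cmax_isometric hC (a := const_mx a : 'M[H -> H]_1).
by rewrite map_const_mx; apply => i k; rewrite mxE.
Qed.

Local Notation e := (j idfun).

Let Aid := opalg_id hA.

Lemma cmax_unit_l a : A a -> e \o j a = j a.
Proof. by move=> Aa; rewrite -(ophomM (cmax_hom hC) Aid Aa). Qed.

Lemma cmax_unit_r a : A a -> j a \o e = j a.
Proof. by move=> Aa; rewrite -(ophomM (cmax_hom hC) Aa Aid). Qed.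

Lemma cmax_unit_contr v : nrm (e v) <= nrm v.
Proof.
apply: le_trans (opnormP (cmax_bop_j Aid) v) _.
by rewrite cmax_opnorm// ler_piMl ?nrm_ge0// opnorm_id_le1.
Qed.

(* A contractive idempotent is an orthogonal projection. *)
Lemma cmax_unit_adjoint : adjoint e = e.
Proof.
have be := cmax_bop_j Aid; have ee v : e (e v) = e v by rewrite -[LHS]/((e \o e) v) cmax_unit_l.
(* For [z] in the kernel of [e], contractivity at [e u + t z] gives [|e u| <= |e u + t z|] for all
   real [t], so the first-order term vanishes. Taking [z] to be [w] and [i w] covers both parts of
   the inner product. *)
have orth u w : e w = 0 -> dot (e u) w = 0.
  move=> ew0.
  have re z : e z = 0 -> complex.Re (dot (e u) z) = 0.
    move=> ez0; apply: (@quad_ge0_eq0 _ _ (nrm z ^+ 2)); first exact: sqr_ge0.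
    move=> t; have := cmax_unit_contr (e u + t%:C *: z).
    rewrite (bopD be) (bopZ be) ee ez0 scaler0 addr0.
    rewrite -(@ler_pXn2r _ 2) ?nnegrE ?nrm_ge0// nrm_sqrD dotZr conjc_real nrmZ nrmc_real.
    rewrite exprMn -normrX ger0_norm ?sqr_ge0//.
    have -> : complex.Re (t%:C * dot (e u) z) = t * complex.Re (dot (e u) z).
      by case: (dot _ _) => a b /=; rewrite mul0r subr0.
    lra.
  apply/eqP; rewrite eq_complex re//= eqxx /=.
  have := re ('i%C *: w); rewrite (bopZ be) ew0 scaler0 => /(_ erefl).
  by rewrite dotZr; case: (dot _ _) => a b /=; rewrite mul0r sub0r mulN1r opprK => ->.
apply: adjoint_unique => // x y.
have e1 : dot (e x) y = dot (e x) (e y).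
  apply/eqP; rewrite -subr_eq0 -dotBr orth//.
  by rewrite (bopB be) ee subrr.
have e2 : dot x (e y) = dot (e x) (e y).
  apply/eqP; rewrite -subr_eq0 -dotBl dotC orth ?conjc0//.
  by rewrite (bopB be) ee subrr.
by rewrite e1 e2.
Qed.

(** The elements of [C] on which [e] acts as a two-sided unit form a C*-algebra containing every
    [j a], and [C] is generated by these. *)
Lemma cmax_unit T : C T -> e \o T = T /\ T \o e = T.
Proof.
pose D : set (L -> L) := [set T | C T /\ (e \o T = T /\ T \o e = T)].
suff : C `<=` D by move=> CD /CD[].
clear T.
have be := cmax_bop_j Aid.
apply: (cmax_generated hC); last first.
  by move=> a Aa; split; [exact: (cmax_in hC)|rewrite cmax_unit_l// cmax_unit_r].
case: CO => bC C0 CD CZ CM Ccl.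
split; last first.
  move=> T [CT [h1 h2]]; have bT := bC _ CT; split; first exact: CA.
  by split; rewrite -{1}cmax_unit_adjoint -adjointM ?h1 ?h2.
split.
- by move=> T [/bC].
- by split=> //; split; apply/funext => v //=; rewrite (bop0 be).
- move=> S T [CS [h1 h2]] [CT [h3 h4]]; split; first exact: CD.
  split; last by rewrite -[LHS]/((S \o e) + (T \o e)) h2 h4.
  apply/funext => v; rewrite /= !fctE (bopD be).
  by rewrite -[e (S v)]/((e \o S) v) -[e (T v)]/((e \o T) v) h1 h3.
- move=> c T [CT [h1 h2]]; split; first exact: CZ.
  split; last by rewrite -[LHS]/(c *: (T \o e)) h2.
  by apply/funext => v; rewrite /= !fctE (bopZ be) -[e (T v)]/((e \o T) v) h1.
- move=> S T [CS [h1 h2]] [CT [h3 h4]]; split; first exact: CM.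
  by split; [rewrite compA h1|rewrite -compA h4].
move=> T bT hT.
have CT : C T by apply: Ccl => // d /hT[S [CS _] h]; exists S.
(* The factor 2 counts [e (T - S)] and [T - S], the two terms left when [T] is replaced by a nearby
   [S] fixed by [e]. *)
have lim S : bounded_operator S -> (forall d : R, 0 < d -> opnorm S <= 2 * d) -> S = 0.
  move=> bS h; apply: opnorm_eq0 => //; apply/eqP; rewrite eq_le opnorm_ge0 andbT.
  apply: le_add_eps => d d0; rewrite add0r.
  by have := h (d / 2) ltac:(by rewrite divr_gt0); rewrite mulrC divfK.
split=> //; split; apply/eqP; rewrite -subr_eq0; apply/eqP; apply: lim.
- by apply: bounded_sub => //; exact: bounded_comp.
- move=> d /hT[S [CS [h1 h2]] TS]; have bS := bC _ CS.
  have bTS : bounded_operator (T - S) by exact: bounded_sub.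
  have -> : (e \o T) - T = (e \o (T - S)) - (T - S).
    apply/funext => v; rewrite !fctE /= (bopB be) -[e (S v)]/((e \o S) v) h1.
    by rewrite subrACA subrr subr0.
  apply: le_trans (opnormD _ _) _; [exact: bounded_comp|by rewrite -scaleN1r; exact: bounded_scale|].
  rewrite opnormN// mulr_natl mulr2n; apply: lerD; last exact: ltW.
  apply: le_trans (opnormM _ _) _ => //.
  by rewrite (le_trans _ (ltW TS))// ler_piMl ?opnorm_ge0// cmax_opnorm// opnorm_id_le1.
- by apply: bounded_sub => //; exact: bounded_comp.
- move=> d /hT[S [CS [h1 h2]] TS]; have bS := bC _ CS.
  have bTS : bounded_operator (T - S) by exact: bounded_sub.
  have -> : (T \o e) - T = ((T - S) \o e) - (T - S).
    apply/funext => v; rewrite !fctE /= -[S (e v)]/((S \o e) v) h2.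
    by rewrite subrACA subrr subr0.
  apply: le_trans (opnormD _ _) _; [exact: bounded_comp|by rewrite -scaleN1r; exact: bounded_scale|].
  rewrite opnormN// mulr_natl mulr2n; apply: lerD; last exact: ltW.
  apply: le_trans (opnormM _ _) _ => //.
  by rewrite (le_trans _ (ltW TS))// ler_piMr ?opnorm_ge0// cmax_opnorm// opnorm_id_le1.
Qed.

Lemma linear_bound_eq0 (b K : R) : (forall t, t * b <= K) -> b = 0.
Proof.
move=> h; apply/eqP; apply/negPn/negP => b0.
by have := h ((K + 1) / b); rewrite divfK// leNgt ltrDl ltr01.
Qed.

(* |h + it|^2 <= |h|^2 + t^2 for h = h*, which forces j h to have real numerical range. *)
Lemma cmax_selfadjoint h : A h -> adjoint h = h -> adjoint (j h) = j h.
Proof.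
move=> Ah hh; have bh := opalg_bop hA Ah; have bjh := cmax_bop_j Ah.
have be := cmax_bop_j Aid.
(* [j] sends the scalar operator [c] to [c e], which acts as a scalar only on the range of [e];
   hence the passage from [v] to [w]. *)
apply: selfadjoint_real_range => // v; pose w := e v.
have -> : dot (j h v) v = dot (j h w) w.
  rewrite -[in LHS](cmax_unit_l Ah) -[in LHS](cmax_unit_r Ah) /=.
  by rewrite (adjointP be) cmax_unit_adjoint.
have ew : e w = w by rewrite -[LHS]/((e \o e) v) cmax_unit_l.
apply: (@linear_bound_eq0 _ (opnorm h ^+ 2 * nrm w ^+ 2)) => t.
(* The half is chosen so that the cross term [2 Re (conj c * dot (j h w) w)] is exactly [t] times
   the imaginary part. *)
pose c : R[i] := 0 +i* (t / 2).
have nc : nrm c ^+ 2 = (t / 2) ^+ 2 by rewrite nrmc_sqr /= expr0n add0r.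
have Ac : A (c *: idfun) by apply: (opalgZ hA.1).
have Ahc : A (h + c *: idfun) by exact: (opalgD hA.1).
have real x : complex.Im (dot (h x) x) = 0.
  have := adjointP bh x x; rewrite hh (dotC (h x) x).
  by case: (dot (h x) x) => a b /= [] e1; lra.
have bd : opnorm (h + c *: idfun) ^+ 2 <= opnorm h ^+ 2 + (t / 2) ^+ 2.
  have X0 : 0 <= opnorm h ^+ 2 + (t / 2) ^+ 2 by rewrite addr_ge0 ?sqr_ge0.
  rewrite -(sqr_sqrtr X0) ler_pXn2r ?nnegrE ?opnorm_ge0 ?sqrtr_ge0//.
  apply: opnorm_le => [|x]; first exact: sqrtr_ge0.
  rewrite -(@ler_pXn2r _ 2) ?nnegrE ?mulr_ge0 ?sqrtr_ge0 ?nrm_ge0// exprMn sqr_sqrtr//.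
  rewrite !fctE nrm_sqrD nrmZ exprMn nc dotZr mulrDl lerD2r.
  have -> : complex.Re (conjc c * dot (h x) x) = 0.
    have := real x; case: (dot (h x) x) => a b /= ->; ring.
  rewrite mul0rn addr0 -exprMn ler_pXn2r ?nnegrE ?mulr_ge0 ?nrm_ge0 ?opnorm_ge0//.
  exact: opnormP.
have := opnormP (cmax_bop_j Ahc) w; rewrite cmax_opnorm//.
have -> : j (h + c *: idfun) w = j h w + c *: w.
  by rewrite (ophomD (cmax_hom hC) Ah Ac) (ophomZ (cmax_hom hC) c Aid) !fctE ew.
rewrite -(@ler_pXn2r _ 2) ?nnegrE ?mulr_ge0 ?nrm_ge0 ?opnorm_ge0// exprMn.
rewrite nrm_sqrD nrmZ exprMn nc dotZr => e1.
have e2 := ler_wpM2r (sqr_ge0 (nrm w)) bd.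
have : complex.Re (conjc c * dot (j h w) w) *+ 2 = t * complex.Im (dot (j h w) w).
  by case: (dot (j h w) w) => a b /=; rewrite mul0r sub0r mulNr opprK; field.
have := sqr_ge0 (nrm (j h w)).
move: e1 e2; set X := complex.Re _; set Y := t * _; rewrite mulrDl; lra.
Qed.

(** [d + adjoint d] and [i (d - adjoint d)] are selfadjoint elements of [A]. Selfadjointness of
    their images gives two linear equations for the adjoints of [j d] and [j (adjoint d)]. *)
Lemma cmax_diagonal d : A d -> A (adjoint d) -> j d = adjoint (j (adjoint d)).
Proof.
move=> Ad Ad'; have bd := opalg_bop hA Ad; have bd' := opalg_bop hA Ad'.
have bj := cmax_bop_j Ad; have bj' := cmax_bop_j Ad'.
have jD := ophomD (cmax_hom hC); have jZ := ophomZ (cmax_hom hC).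
have AD' : A (d + adjoint d) by exact: (opalgD hA.1).
have := cmax_selfadjoint AD'; rewrite adjointD// adjointK// addrC => /(_ erefl).
rewrite jD// adjointD// => e1.
pose d2 := 'i%C *: d + (- 'i%C) *: adjoint d.
have Ad1 : A ('i%C *: d) by exact: (opalgZ hA.1).
have Ad3 : A ((- 'i%C) *: adjoint d) by exact: (opalgZ hA.1).
have ci : conjc 'i%C = - 'i%C :> R[i] by simpc.
have s2 : adjoint d2 = d2.
  rewrite /d2 adjointD ?adjointZ ?adjointK//; [|exact: bounded_scale..].
  by rewrite conjcN ci opprK addrC.
have := cmax_selfadjoint (opalgD hA.1 Ad1 Ad3) s2.
rewrite jD// !jZ// adjointD ?adjointZ//; [|exact: bounded_scale..].
rewrite conjcN ci opprK => e2.
have e3 : adjoint (j d) - adjoint (j (adjoint d)) = - j d + j (adjoint d).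
  have /(congr1 (fun T => 'i%C *: T)) := e2.
  rewrite !scalerDr !scalerA -!expr2 !mulrN -!expr2 sqr_i opprK !scaleN1r !scale1r.
  by [].
apply: (@scalerI _ _ (2 : R[i])); first by rewrite pnatr_eq0.
rewrite !scaler_nat !mulr2n.
set a := adjoint (j d) in e1 e3; set b := adjoint _ in e1 e3 *.
have -> : b + b = (a + b) - (a - b) by rewrite opprB (addrC a) addrACA subrr addr0.
by rewrite e1 e3 opprD opprK addrACA subrr addr0.
Qed.

End MaximalCstar.

(** * Continuity of products and closures of *-algebras *)

Section ProductEstimates.
Context {R : realType}.

Lemma small_factor (K e : R) : 0 <= K -> 0 < e ->
  exists2 d : R, 0 < d & d <= 1 /\ d * K < e.
Proof.
move=> K0 e0; have K1 : 0 < K + 1 by rewrite ltr_wpDl.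
exists (Num.min 1 (e / (K + 1))); first by rewrite lt_min ltr01 divr_gt0.
split; first by rewrite ge_min lexx.
apply: (@le_lt_trans _ _ (e / (K + 1) * K)).
  by rewrite ler_wpM2r// ge_min lexx orbT.
by rewrite mulrAC ltr_pdivrMr// ltr_pM2l// ltrDl.
Qed.

(** The arithmetic common to both continuity statements below: [a], [b], [c] are the norms of [x],
    [y], [y'], and [u], [v] those of [x - x'], [y - y']. *)
Lemma prod_estimate (a b c u v d e : R) : 0 <= a -> 0 <= b -> 0 <= c -> 0 <= u ->
  0 < d -> d <= 1 -> d * (a + b + 1) < e -> u < d -> v < d -> c <= b + d ->
  a * v + u * c < e.
Proof.
move=> a0 b0 c0 u0 d0 d1 de ud vd cb.
have h1 : a * v <= a * d by rewrite ler_wpM2l// ltW.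
have h2 : u * c <= d * (b + d) by apply: ler_pM => //; exact: ltW.
have h3 : d * d <= d by rewrite ler_piMr// ltW.
nra.
Qed.

Lemma can_mul_close (F : algType R[i]) (N : F -> R) (x y : F) (e : R) :
  complete_algebra_norm N -> 0 < e ->
  exists2 d : R, 0 < d & forall x' y', N (x - x') < d -> N (y - y') < d ->
    N (x * y - x' * y') < e.
Proof.
move=> nN e0; have Nx := can_ge0 nN x; have Ny := can_ge0 nN y.
have [d d0 [d1 dK]] := small_factor (ltac:(by rewrite !addr_ge0) : 0 <= N x + N y + 1) e0.
exists d => // x' y' xx yy.
have -> : x * y - x' * y' = x * (y - y') + (x - x') * y'.
  by rewrite mulrBr mulrBl addrA subrK.
apply: le_lt_trans (canD nN _ _) _.
apply: le_lt_trans (lerD (canM nN _ _) (canM nN _ _)) _.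
apply: (prod_estimate _ _ _ _ d0 d1 dK) => //; try exact: (can_ge0 nN).
by have := canB nN y y'; have := can_dist nN y' y 0; rewrite !subr0; lra.
Qed.

Lemma comp_close (L : hilbertType R) (S T : L -> L) (e : R) :
  bounded_operator S -> bounded_operator T -> 0 < e ->
  exists2 d : R, 0 < d & forall S' T', bounded_operator S' -> bounded_operator T' ->
    opnorm (S - S') < d -> opnorm (T - T') < d -> opnorm ((S \o T) - (S' \o T')) < e.
Proof.
move=> bS bT e0; have NS := opnorm_ge0 S; have NT := opnorm_ge0 T.
have [d d0 [d1 dK]] := small_factor (ltac:(by rewrite !addr_ge0) : 0 <= opnorm S + opnorm T + 1) e0.
exists d => // S' T' bS' bT' SS TT.
have bSp := bounded_sub bS bS'; have bTq := bounded_sub bT bT'.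
have -> : (S \o T) - (S' \o T') = (S \o (T - T')) + ((S - S') \o T').
  by apply/funext => v; rewrite !fctE /= (bopB bS) addrA subrK.
apply: le_lt_trans (opnormD (bounded_comp bS bTq) (bounded_comp bSp bT')) _.
apply: le_lt_trans (lerD (opnormM bS bTq) (opnormM bSp bT')) _.
apply: (prod_estimate _ _ _ _ d0 d1 dK) => //; try exact: opnorm_ge0.
have -> : T' = T + (T' - T) by rewrite addrC subrK.
apply: le_trans (opnormD bT (bounded_sub bT' bT)) _.
by rewrite lerD2l opnormB// ltW.
Qed.

(** The target for which the maximality of [C] is invoked, namely where GNS representations live. *)
Lemma bounded_cstar (K : hilbertType R) : cstar_algebra (@bounded_operator R K).
Proof.
split; last by move=> T; exact: bounded_adjoint.
split=> //.
- exact: bounded_0.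
- by move=> S T; exact: bounded_add.
- by move=> c T; exact: bounded_scale.
- by move=> S T; exact: bounded_comp.
Qed.

Lemma closure_cstar (L : hilbertType R) (D : set (L -> L)) :
  D `<=` bounded_operator -> D 0 ->
  (forall S T, D S -> D T -> D (S + T)) -> (forall (c : R[i]) T, D T -> D (c *: T)) ->
  (forall S T, D S -> D T -> D (S \o T)) -> (forall T, D T -> D (adjoint T)) ->
  cstar_algebra [set T : L -> L | bounded_operator T /\
    forall e : R, 0 < e -> exists2 S, D S & opnorm (T - S) < e].
Proof.
move=> bD D0 DD DZ DM DA; split; last first.
  move=> T [bT hT]; split; first exact: bounded_adjoint.
  move=> e /hT[S DS TS]; exists (adjoint S); first exact: DA.
  have bS := bD _ DS.
  have -> : adjoint T - adjoint S = adjoint (T - S).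
    have bNS : bounded_operator (- S) by rewrite -scaleN1r; exact: bounded_scale.
    by rewrite (adjointD bT bNS) -(scaleN1r S) (adjointZ _ bS) conjcN conjc1 scaleN1r.
  by rewrite opnorm_adjoint//; exact: bounded_sub.
split.
- by move=> T [].
- split; first exact: bounded_0.
  move=> e e0; exists 0 => //; apply: le_lt_trans e0.
  by apply: opnorm_le => // v; rewrite !fctE subr0 nrm0 mul0r.
- move=> S T [bS hS] [bT hT]; split=> [|e e0]; first exact: bounded_add.
  have [S' DS SS] := hS (e / 2) ltac:(by rewrite divr_gt0).
  have [T' DT TT] := hT (e / 2) ltac:(by rewrite divr_gt0).
  exists (S' + T'); first exact: DD.
  have b1 := bounded_sub bS (bD _ DS); have b2 := bounded_sub bT (bD _ DT).
  rewrite opprD addrACA; apply: le_lt_trans (opnormD b1 b2) _.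
  by rewrite (splitr e) ltrD.
- move=> c T [bT hT]; split=> [|e e0]; first exact: bounded_scale.
  have c0 : 0 < nrm c + 1 by rewrite ltr_wpDl ?nrm_ge0.
  have [S DS TS] := hT (e / (nrm c + 1)) ltac:(by rewrite divr_gt0).
  exists (c *: S); first exact: DZ.
  rewrite -scalerBr opnormZ; last by apply: bounded_sub => //; exact: bD.
  move: TS; rewrite ltr_pdivlMr//; apply: le_lt_trans.
  by rewrite mulrC ler_wpM2l ?opnorm_ge0// lerDl.
- move=> S T [bS hS] [bT hT]; split=> [|e e0]; first exact: bounded_comp.
  have [d d0 hd] := comp_close bS bT e0.
  have [S' DS SS] := hS d d0; have [T' DT TT] := hT d d0.
  by exists (S' \o T'); [exact: DM|apply: hd => //; exact: bD].
- move=> T bT hT; split=> // e e0.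
  have [S [bS hS] TS] := hT (e / 2) ltac:(by rewrite divr_gt0).
  have [S' DS SS] := hS (e / 2) ltac:(by rewrite divr_gt0).
  exists S' => //; have -> : T - S' = (T - S) + (S - S') by rewrite addrA subrK.
  have b1 := bounded_sub bT bS; have b2 := bounded_sub bS (bD _ DS).
  by apply: le_lt_trans (opnormD b1 b2) _; rewrite (splitr e) ltrD.
Qed.

End ProductEstimates.

(** * The representation of the free product in the maximal C*-algebra *)

Section Representation.
Context {R : realType} {H L : hilbertType R}.
Variables (A : set (H -> H)) (hA : unital_operator_algebra A).
Variables (F : algType R[i]) (N : F -> R) (s : F -> F) (jA jA' : (H -> H) -> F).
Hypothesis hF : is_oa_free_product A N s jA jA'.
Variables (P : algType R[i]) (iA iA' : (H -> H) -> P) (k : {lrmorphism P -> F}).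
Hypothesis afp : is_algebraic_free_product A iA iA'.
Hypotheses (jAE : forall a, A a -> jA a = k (iA a))
  (jA'E : forall b, adjoint_algebra A b -> jA' b = k (iA' b))
  (Nk : forall p : P, N (k p) = oa_norm A iA iA' (const_mx p : 'M[P]_1))
  (kdense : forall (x : F) (e : R), 0 < e -> exists p : P, N (x - k p) < e).
Variables (C : set (L -> L)) (j : (H -> H) -> (L -> L)).
Hypothesis hC : is_maximal_cstar A C j.

Let nN := ofp_norm hF.
Let iN := ofp_involution hF.
Let sj := ofp_star hF.

(** [j] is isometric, so [j idfun = 0] would make [idfun] zero on [H] and then 1 equal to 0 in the
    nontrivial ring [P]. *)
Lemma cmax_one_neq0 : j idfun <> 0.
Proof.
move=> j0; have Aid := opalg_id hA.
have id0 : idfun = 0 :> (H -> H).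
  apply: opnorm_eq0; first exact: bounded_id.
  rewrite -(cmax_opnorm hC Aid) j0; apply/eqP; rewrite eq_le opnorm_ge0 andbT.
  by apply: opnorm_le => // x; rewrite nrm0 mul0r.
have := oner_neq0 P; rewrite -(uhom1 (afp_homl afp)) [X in iA X]id0 (iA0 hA afp).
by rewrite eqxx.
Qed.

Definition cmax_uc : unital_cstar :=
  UnitalCstar (cmax_cstar hC) (cmax_in hC (opalg_id hA))
    (fun T CT => (cmax_unit hA hC CT).1) (fun T CT => (cmax_unit hA hC CT).2) cmax_one_neq0.

Local Notation X := (op cmax_uc).

(** On the adjoint algebra, [b |-> adjoint (j (adjoint b))] is linear and multiplicative because the
    conjugations and the reversals of products cancel. Agreement with [j] on the diagonal is
    [cmax_diagonal]. *)
Lemma free_product_rep : exists r : {lrmorphism P -> X},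
  (forall a, A a -> op_val (r (iA a)) = j a) /\
  (forall b, adjoint_algebra A b -> op_val (r (iA' b)) = adjoint (j (adjoint b))).
Proof.
pose lift T : X := insubd (0 : X) T.
have liftK T : C T -> op_val (lift T) = T by move=> CT; rewrite /lift [LHS]insubdK//; apply/asboolP.
have jC := cmax_in hC.
have J'C b : adjoint_algebra A b -> C (adjoint (j (adjoint b))).
  by move=> /(adjoint_algP hA)/jC; exact: (cmax_cstar hC).2.
have ul : unital_hom A (lift \o j).
  have jhom := cmax_hom hC.
  split=> [|T U hT hU|c T hT|T U hT hU]; apply: val_inj => /=.
  - by rewrite liftK//; apply: jC; exact: (opalg_id hA).
  - have h1 := jC _ hT; have h2 := jC _ hU; have h3 := jC _ (opalgD hA.1 hT hU).
    by rewrite !liftK// (ophomD jhom).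
  - have h1 := jC _ hT; have h3 := jC _ (opalgZ hA.1 c hT).
    by rewrite !liftK// (ophomZ jhom).
  - have h1 := jC _ hT; have h2 := jC _ hU; have h3 := jC _ (opalgM hA.1 hT hU).
    by rewrite !liftK// (ophomM jhom).
have ur : unital_hom (adjoint_algebra A) (lift \o (fun b => adjoint (j (adjoint b)))).
  have jhom := cmax_hom hC.
  split=> [|T U hT hU|c T hT|T U hT hU]; apply: val_inj => /=.
  - rewrite liftK; last by apply: J'C; exact: (adjoint_alg_id hA).
    by rewrite adjoint_id (cmax_unit_adjoint hA hC).
  - have h1 := J'C _ hT; have h2 := J'C _ hU; have h3 := J'C _ (adjoint_algD hA hT hU).
    have aT := adjoint_algP hA hT; have aU := adjoint_algP hA hU.
    rewrite !liftK// adjointD ?(ophomD jhom) ?adjointD//;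
      by [exact: (cmax_bop_j hC)|exact: (adjoint_alg_bop hA)].
  - have h1 := J'C _ hT; have h3 := J'C _ (adjoint_algZ hA c hT).
    have aT := adjoint_algP hA hT.
    rewrite !liftK// adjointZ ?(ophomZ jhom) ?adjointZ ?conjcK//;
      by [exact: (cmax_bop_j hC)|exact: (adjoint_alg_bop hA)].
  - have h1 := J'C _ hT; have h2 := J'C _ hU; have h3 := J'C _ (adjoint_algM hA hT hU).
    have aT := adjoint_algP hA hT; have aU := adjoint_algP hA hU.
    have bT := adjoint_alg_bop hA hT; have bU := adjoint_alg_bop hA hU.
    rewrite (liftK _ h1) (liftK _ h2) (liftK _ h3) (adjointM bT bU) (ophomM jhom aU aT).
    by rewrite (adjointM (cmax_bop_j hC aU) (cmax_bop_j hC aT)).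
have agree d : Defs.diagonal A d -> (lift \o j) d = (lift \o (fun b => adjoint (j (adjoint b)))) d.
  move=> [Ad /(adjoint_algP hA) Ad'] /=; congr lift; exact: (cmax_diagonal hA hC).
have [r [rl rr] _] := afp_universal afp ul ur agree.
exists r; split=> [a Aa|b Ab]; rewrite ?rl ?rr//= liftK//; [exact: jC|exact: J'C].
Qed.

Variable r : {lrmorphism P -> X}.
Hypotheses (rl : forall a, A a -> op_val (r (iA a)) = j a)
  (rr : forall b, adjoint_algebra A b -> op_val (r (iA' b)) = adjoint (j (adjoint b))).

Let r0 (p : P) : L -> L := op_val (r p).

Let r0C p : C (r0 p).
Proof. exact: (op_in (r p)). Qed.

Let r0b p : bounded_operator (r0 p).
Proof. exact: op_bounded. Qed.

Let r0D p q : r0 (p + q) = r0 p + r0 q.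
Proof. by rewrite /r0 raddfD. Qed.

Let r0B p q : r0 (p - q) = r0 p - r0 q.
Proof. by rewrite /r0 raddfB. Qed.

Let r0M p q : r0 (p * q) = r0 p \o r0 q.
Proof. by rewrite /r0 rmorphM. Qed.

Let r0Z c p : r0 (c *: p) = c *: r0 p.
Proof. by rewrite /r0 linearZ. Qed.

Let r01 : r0 1 = j idfun.
Proof. by rewrite /r0 rmorph1. Qed.

Let r0_sum I (t : seq I) (Q : pred I) (f : I -> P) v :
  r0 (\sum_(i <- t | Q i) f i) v = \sum_(i <- t | Q i) r0 (f i) v.
Proof.
by apply: (big_morph (fun x => r0 x v)) => [x y|]; rewrite ?r0D// /r0 raddf0.
Qed.

(** Each factor is sent to an operator matrix of no larger norm: over [A] because [j] is completely
    isometric, over the adjoint algebra after passing to adjoints. Products multiply the bounds. *)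
Let oaf_bound m n (x : 'M[P]_(m, n)) c : oa_factorization A iA iA' x c ->
  forall xi, vsq (mxop (map_mx r0 x) xi) <= c ^+ 2 * vsq xi.
Proof.
have jrect p q (a : 'M[H -> H]_(p, q)) : (forall i l, A (a i l)) ->
    mx_opnorm (map_mx j a) <= mx_opnorm a.
  apply: rect_contractive.
  - exact: (opalg_zero hA).
  - by have := ophomZ (cmax_hom hC) 0 (opalg_zero hA); rewrite !scale0r.
  - exact: (opalg_bop hA).
  - exact: (cmax_bop_j hC).
  - by move=> l b Ab; rewrite (cmax_isometric hC).
have bnd p q (T : 'M[L -> L]_(p, q)) d : bounded_mx T -> mx_opnorm T <= d ->
    forall xi, vsq (mxop T xi) <= d ^+ 2 * vsq xi.
  move=> bT Td xi; apply: le_trans (mx_opnormP bT xi) _.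
  rewrite ler_wpM2r ?vsq_ge0// ler_pXn2r ?nnegrE ?mx_opnorm_ge0//.
  exact: le_trans (mx_opnorm_ge0 _) Td.
elim=> {m n x c} [m n a Aa|m n b Ab|m n p x y c d _ IHx hy IHy] xi.
- have -> : map_mx r0 (map_mx iA a) = map_mx j a.
    by apply/matrixP => i l; rewrite !mxE; exact: rl.
  apply: bnd; last exact: jrect.
  by move=> i l; rewrite mxE; exact: (cmax_bop_j hC).
- have bb : bounded_mx b by move=> i l; exact: (adjoint_alg_bop hA).
  have Ab' i l : A (mxadj b i l) by rewrite mxE; exact: (adjoint_algP hA).
  have bj : bounded_mx (map_mx j (mxadj b)).
    by move=> i l; rewrite mxE; exact: (cmax_bop_j hC).
  have -> : map_mx r0 (map_mx iA' b) = mxadj (map_mx j (mxadj b)).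
    by apply/matrixP => i l; rewrite !mxE; exact: rr.
  apply: bnd; first exact: bounded_mxadj.
  by rewrite (mx_opnorm_adj bj) -(mx_opnorm_adj bb); exact: jrect.
have -> : mxop (map_mx r0 (x *m y)) xi = mxop (map_mx r0 x) (mxop (map_mx r0 y) xi).
  apply/funext => i; rewrite /mxop.
  transitivity (\sum_(h < p) \sum_(l < n) r0 (x i l) (r0 (y l h) (xi h))).
    by apply: eq_bigr => h _; rewrite !mxE r0_sum; apply: eq_bigr => l _; rewrite r0M.
  rewrite exchange_big; apply: eq_bigr => l _; rewrite !mxE (bop_sum (r0b _)).
  by apply: eq_bigr => h _; rewrite !mxE.
apply: le_trans (IHx _) _; rewrite exprMn -(mulrA (c ^+ 2)).
by rewrite ler_wpM2l ?sqr_ge0.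
Qed.

Let r0_norm p : opnorm (r0 p) <= N (k p).
Proof.
rewrite Nk; apply: lb_le_inf; first exact: (oaf_exists hA afp p).
move=> c hc; have := oaf_bound hc; rewrite map_const_mx => hb.
by apply: mx_opnorm_le => //; exact: oaf_ge0 hc.
Qed.

(** [P] is given without an involution. The formal adjoint of [p] is therefore expressed by some
    [p'] that [k] sends to [s (k p)], found by induction over the generators. *)
Let r0_star p : exists2 p', s (k p) = k p' & r0 p' = adjoint (r0 p).
Proof.
apply: (free_product_ind hA afp (S := [set p | exists2 p', s (k p) = k p' & r0 p' = adjoint (r0 p)])) => /=.
- split=> /= [|c x y [x' sx rx] [y' sy ry]|x y [x' sx rx] [y' sy ry]].
  + by exists 1; rewrite ?rmorph1 ?(inv1 iN)// r01 (cmax_unit_adjoint hA hC).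
  + exists (conjc c *: x' + y').
      by rewrite !raddfD /= !linearZ (invD iN) (invZ iN) sx sy.
    rewrite !r0D !r0Z rx ry adjointD ?adjointZ//.
    exact: bounded_scale.
  + by exists (y' * x'); rewrite ?rmorphM ?(invM iN) ?sx ?sy// !r0M rx ry adjointM.
- move=> a Aa; have Aa' : adjoint_algebra A (adjoint a) by exists a.
  exists (iA' (adjoint a)); first by rewrite -jAE// sj// jA'E.
  by rewrite /r0 rr// rl// adjointK//; exact: (opalg_bop hA).
- move=> b Ab; have Ab' := adjoint_algP hA Ab; have bb := adjoint_alg_bop hA Ab.
  exists (iA (adjoint b)).
    by rewrite -jA'E// -{1}(adjointK bb) -sj// (Defs.invK iN) jAE.
  by rewrite /r0 rl// rr// adjointK//; exact: (cmax_bop_j hC).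
Qed.

(* rel x T: T is the value at x of the continuous extension of r0 along k. *)
Let rel (x : F) (T : L -> L) : Prop := bounded_operator T /\
  forall e : R, 0 < e -> exists2 p, N (x - k p) < e & opnorm (T - r0 p) < e.

Let rel_k p : rel (k p) (r0 p).
Proof.
split=> // e e0; exists p; rewrite subrr ?(can0 nN)//.
by apply: le_lt_trans e0; apply: opnorm_le => // v; rewrite nrm0 mul0r.
Qed.

(** [r0_norm] turns closeness in [F] into closeness of operators; the four errors [e / 4] are two in
    [F] and two in operator norm. Uniqueness makes each closure property of [rel] below an identity
    for [rho]. *)
Let rel_uniq x T T' : rel x T -> rel x T' -> T = T'.
Proof.
move=> [bT hT] [bT' hT']; apply/eqP; rewrite -subr_eq0; apply/eqP.
apply: opnorm_eq0; first exact: bounded_sub.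
apply/eqP; rewrite eq_le opnorm_ge0 andbT; apply: le_add_eps => e e0; rewrite add0r.
have [p xp Tp] := hT (e / 4) ltac:(by rewrite divr_gt0).
have [q xq Tq] := hT' (e / 4) ltac:(by rewrite divr_gt0).
have -> : T - T' = (T - r0 p) + (r0 (p - q) + (r0 q - T')).
  by rewrite r0B (addrA (r0 p - _)) subrK addrA subrK.
have b1 : bounded_operator (T - r0 p) by exact: bounded_sub.
have b2 : bounded_operator (r0 q - T') by exact: bounded_sub.
have h1 := opnormD b1 (bounded_add (r0b (p - q)) b2).
have h2 := opnormD (r0b (p - q)) b2.
have h3 := r0_norm (p - q); rewrite raddfB /= in h3.
have h4 := can_dist nN (k p) x (k q); rewrite (canB nN (k p) x) in h4.
have h5 : opnorm (r0 q - T') < e / 4 by rewrite opnormB.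
apply: (le_trans h1); lra.
Qed.

Let rel_ex x : exists T, rel x T.
Proof.
have /choice[u hu] n : exists p, N (x - k p) < n.+1%:R^-1.
  by apply: kdense; rewrite invr_gt0.
have [|T bT hT] := bounded_complete (fun n => r0b (u n)).
  move=> e e0; have [n0 hn0] := small_inv (ltac:(by rewrite divr_gt0) : 0 < e / 2 :> R).
  exists n0 => m n /hn0 hm /hn0 hn; rewrite -r0B; apply: le_lt_trans (r0_norm _) _.
  rewrite raddfB /=; apply: le_lt_trans (can_dist nN _ x _) _; rewrite (canB nN (k (u m)) x).
  by rewrite (splitr e) ltrD// ?(lt_trans (hu m))// (lt_trans (hu n)).
exists T; split=> // e e0; have [n1 h1] := small_inv e0; have [n2 h2] := hT e e0.
exists (u (maxn n1 n2)); first by apply: lt_trans (hu _) _; rewrite h1// leq_maxl.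
by rewrite opnormB// h2// leq_maxr.
Qed.

Let relD x y S T : rel x S -> rel y T -> rel (x + y) (S + T).
Proof.
move=> [bS hS] [bT hT]; split=> [|e e0]; first exact: bounded_add.
have [p xp Sp] := hS (e / 2) ltac:(by rewrite divr_gt0).
have [q yq Tq] := hT (e / 2) ltac:(by rewrite divr_gt0).
exists (p + q).
  rewrite raddfD opprD addrACA; apply: le_lt_trans (canD nN _ _) _.
  by rewrite (splitr e) ltrD.
rewrite r0D opprD addrACA; apply: le_lt_trans (opnormD _ _) _; [exact: bounded_sub..|].
by rewrite (splitr e) ltrD.
Qed.

Let relZ c x T : rel x T -> rel (c *: x) (c *: T).
Proof.
move=> [bT hT]; split=> [|e e0]; first exact: bounded_scale.
have c0 : 0 < nrm c + 1 by rewrite ltr_wpDl ?nrm_ge0.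
have [p xp Tp] := hT (e / (nrm c + 1)) ltac:(by rewrite divr_gt0).
have bd (u : R) : 0 <= u -> u < e / (nrm c + 1) -> nrm c * u < e.
  move=> u0; rewrite ltr_pdivlMr// => h; apply: le_lt_trans h.
  by rewrite mulrC ler_wpM2l// lerDl.
exists (c *: p).
  by rewrite linearZ /= -scalerBr (canZn nN); apply: bd => //; exact: (can_ge0 nN).
by rewrite r0Z -scalerBr opnormZ; [apply: bd => //; exact: opnorm_ge0|exact: bounded_sub].
Qed.

Let relM x y S T : rel x S -> rel y T -> rel (x * y) (S \o T).
Proof.
move=> [bS hS] [bT hT]; split=> [|e e0]; first exact: bounded_comp.
have [d1 d10 h1] := can_mul_close x y nN e0.
have [d2 d20 h2] := comp_close bS bT e0.
have d0 : 0 < Num.min d1 d2 by rewrite lt_min d10.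
have [p xp Sp] := hS _ d0; have [q yq Tq] := hT _ d0.
move: xp Sp yq Tq; rewrite !lt_min => /andP[x1 _] /andP[_ S2] /andP[y1 _] /andP[_ T2].
by exists (p * q); rewrite ?rmorphM ?r0M; [exact: h1|exact: h2].
Qed.

Let rel_star x T : rel x T -> rel (s x) (adjoint T).
Proof.
move=> [bT hT]; split=> [|e e0]; first exact: bounded_adjoint.
have [p xp Tp] := hT e e0; have [p' sp rp] := r0_star p.
exists p'; first by rewrite -sp -(invB iN) (inv_norm iN).
have bd : bounded_operator (T - r0 p) by exact: bounded_sub.
rewrite rp -(opnorm_adjoint bd) in Tp *.
rewrite (_ : adjoint T - adjoint (r0 p) = adjoint (T - r0 p))//.
rewrite adjointD//; last by rewrite -scaleN1r; exact: bounded_scale.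
congr (_ + _); rewrite -(scaleN1r (r0 p)) adjointZ// conjcN conjc1 scaleN1r//.
Qed.

Let relC x T : rel x T -> C T.
Proof.
move=> [bT hT]; apply: (opalg_closed (cmax_cstar hC).1) => // e /hT[p _ h].
by exists (r0 p).
Qed.

Lemma exists_rho : exists2 rho : F -> (L -> L),
  induces_cstar_iso s (gamma s) C rho & forall a, A a -> rho (jA a) = j a.
Proof.
have /choice[rho rhoP] := rel_ex.
have rhoE x T : rel x T -> rho x = T by exact: rel_uniq.
have rhoC x : C (rho x) := relC (rhoP x).
have rhob x : bounded_operator (rho x) by case: (rhoP x).
have rhoD x y : rho (x + y) = rho x + rho y by apply: rhoE; exact: relD.
have rhoZ c x : rho (c *: x) = c *: rho x by apply: rhoE; exact: relZ.
have rhoM x y : rho (x * y) = rho x \o rho y by apply: rhoE; exact: relM.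
have rhos x : rho (s x) = adjoint (rho x) by apply: rhoE; exact: rel_star.
have rhok p : rho (k p) = r0 p by apply: rhoE; exact: rel_k.
have rho1 : rho 1 = j idfun by rewrite -(rmorph1 k) rhok r01.
have rhoj a : A a -> rho (jA a) = j a by move=> Aa; rewrite jAE// rhok /r0 rl.
exists rho => //.
have rhoN x : rho (- x) = - rho x by rewrite -scaleN1r rhoZ scaleN1r.
have rho0 : rho 0 = 0 by apply: (addrI (rho 0)); rewrite -rhoD !addr0.
(* Applying [rho] to the sum of squares [t^2 - x# x] bounds [|rho x v|^2] by [t^2] times
   [dot (j idfun v) v]. As [rho 1] is [j idfun], perhaps a proper projection, contractivity is used
   to bound the last factor by [|v|^2]. *)
have le_gamma x : opnorm (rho x) <= gamma s x.
  apply: lb_le_inf; first exact: (gamma_bounds_neq0 nN iN).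
  move=> t; rewrite (gamma_boundsE iN) => -[t0 [zs hz]].
  apply: opnorm_le; first exact: ltW.
  move=> v; rewrite -(@ler_pXn2r _ 2) ?nnegrE ?mulr_ge0 ?nrm_ge0 ?(ltW t0)// exprMn.
  have sq z : complex.Re (dot (rho (s z * z) v) v) = nrm (rho z v) ^+ 2.
    by rewrite rhoM rhos /= (adjointPr (rhob z)) dotxx.
  have : 0 <= complex.Re (dot (rho (\sum_(z <- zs) s z * z) v) v).
    elim: zs {hz} => [|z zs IH]; first by rewrite big_nil rho0 dot0l.
    by rewrite big_cons rhoD fctE dotDl raddfD /= sq addr_ge0 ?sqr_ge0.
  rewrite -hz rhoD rhoN rhoZ rho1 !fctE dotBl dotZl raddfB /= sq subr_ge0 => h.
  apply: (le_trans h); rewrite [leLHS](_ : _ = t ^+ 2 * complex.Re (dot (j idfun v) v)); last first.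
    by case: (dot _ _) => a b /=; rewrite mul0r subr0.
  rewrite ler_wpM2l ?sqr_ge0//; apply: le_trans (nrmc_ge_Re _) _.
  apply: le_trans (dot_cauchy_schwarz _ _) _; rewrite expr2 ler_wpM2r ?nrm_ge0//.
  exact: (cmax_unit_contr hA hC).
have gamma_le x : gamma s x <= opnorm (rho x).
  have [g0|g0] := ltP 0 (gamma s x); last exact: le_trans g0 (opnorm_ge0 _).
  have [K [pi [xi [pirep nxi gpi]]]] := exists_gns nN iN g0.
  have bpi := srep_bounded pirep.
  have jD a b : A a -> A b -> jA (a + b) = jA a + jA b.
    move=> Aa Ab; rewrite !jAE//; last exact: (opalgD hA.1).
    by rewrite (uhomD (afp_homl afp))// raddfD.
  have jZ (c : R[i]) a : A a -> jA (c *: a) = c *: jA a.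
    move=> Aa; rewrite !jAE//; last exact: (opalgZ hA.1).
    by rewrite (uhomZ (afp_homl afp))// linearZ.
  have jM a b : A a -> A b -> jA (a \o b) = jA a * jA b.
    move=> Aa Ab; rewrite !jAE//; last exact: (opalgM hA.1).
    by rewrite (uhomM (afp_homl afp))// rmorphM.
  have thom : operator_hom A (pi \o jA).
    split=> [S T AS AT|c T AT|S T AS AT] /=.
    - by rewrite jD// (srepD pirep).
    - by rewrite jZ// (srepZ pirep).
    - by rewrite jM// (srepM pirep).
  have [sg [sghom sgB sgj]] := cmax_universal hC (bounded_cstar K) (fun a _ => bpi (jA a))
    thom (rep_completely_contractive hA hF pirep).
  have sg1 : sg (j idfun) = idfun.
    rewrite sgj; last exact: (opalg_id hA).
    rewrite /= jAE; last exact: (opalg_id hA).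
    by rewrite (uhom1 (afp_homl afp)) rmorph1 (srep1 pirep).
  have [sgh sgs] := sghom.
  (* Agreement on [A] propagates to the adjoint algebra because [sg] and [pi] both respect adjoints,
     and then to all products and sums. *)
  have sgr p : sg (r0 p) = pi (k p).
    apply: (free_product_ind hA afp (S := [set p | sg (r0 p) = pi (k p)])) => /=.
    - split=> /= [|c x' y' hx hy|x' y' hx hy].
      + by rewrite r01 sg1 rmorph1 (srep1 pirep).
      + rewrite r0D r0Z (ophomD sgh (opalgZ (cmax_cstar hC).1 c (r0C x')) (r0C y')).
        by rewrite (ophomZ sgh c (r0C x')) hx hy (linearP k) (srepD pirep) (srepZ pirep).
      + by rewrite r0M (ophomM sgh (r0C x') (r0C y')) hx hy rmorphM (srepM pirep).
    - by move=> a Aa; rewrite /r0 rl// sgj//= jAE.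
    - move=> b Ab; have Ab' := adjoint_algP hA Ab; have bb := adjoint_alg_bop hA Ab.
      rewrite /r0 rr// sgs; last exact: (cmax_in hC).
      by rewrite sgj//= (srep_star pirep) sj// adjointK// jA'E.
  (* [sg] is compared with [pi] only on the range of [k]. One [e / 2] pays for [N (x - k p)], the
     other for the distance from [rho x] to [r0 p]. *)
  apply: le_add_eps => e e0.
  have [_ /(_ (e / 2) ltac:(by rewrite divr_gt0))[p xp rp]] := rhoP x.
  apply: (le_trans gpi).
  have -> : pi x xi = pi (x - k p) xi + pi (k p) xi.
    by rewrite -[RHS]/((pi (x - k p) + pi (k p)) xi) -(srepD pirep) subrK.
  have h1 := nrmD (pi (x - k p) xi) (pi (k p) xi).
  have h2 := srep_norm pirep (x - k p) xi; rewrite nxi mulr1 in h2.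
  have h3 := @star_hom_contractive _ _ cmax_uc K sg sghom sgB sg1 (r0 p) xi (r0C p).
  rewrite sgr nxi mulr1 in h3.
  have b1 : bounded_operator (r0 p - rho x) by exact: bounded_sub.
  have h4 := opnormD (rhob x) b1; rewrite addrC subrK opnormB// in h4.
  apply: (le_trans h1); lra.
split=> //.
- by move=> x; apply/eqP; rewrite eq_le le_gamma gamma_le.
move=> T CT e e0.
(* The closure of the range of [rho] is a C*-algebra containing every [j a], hence contains [C]. *)
pose D := [set T : L -> L | bounded_operator T /\
  forall e : R, 0 < e -> exists2 S, range rho S & opnorm (T - S) < e].
have cD : cstar_algebra D.
  apply: closure_cstar.
  - by move=> _ [x _ <-].
  - by exists 0.
  - by move=> _ _ [x _ <-] [y _ <-]; exists (x + y).
  - by move=> c _ [x _ <-]; exists (c *: x).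
  - by move=> _ _ [x _ <-] [y _ <-]; exists (x * y).
  - by move=> _ [x _ <-]; exists (s x).
have [|_ /(_ e e0)[_ [x _ <-] h]] := cmax_generated hC cD _ CT; last by exists x.
move=> a Aa; split; first exact: (cmax_bop_j hC).
move=> d d0; exists (rho (jA a)); first by exists (jA a).
rewrite rhoj// subrr; apply: le_lt_trans d0.
by apply: opnorm_le => // v; rewrite nrm0 mul0r.
Qed.

End Representation.

(** The first conjunct says that [gamma] is an infimum over a nonempty set and not the default value
    of [inf]. The last condition makes the isomorphism compatible with the copies of [A]. *)
Theorem proposition2 (R : realType) (H : hilbertType R) (A : set (H -> H))
    (hA : unital_operator_algebra A)
    (F : algType R[i]) (N : F -> R) (s : F -> F) (jA jA' : (H -> H) -> F)
    (hF : is_oa_free_product A N s jA jA') :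
  [/\ forall x : F, gamma_bounds s x !=set0,
      cstar_seminorm s (gamma s) &
      forall (L : hilbertType R) (C : set (L -> L)) (j : (H -> H) -> (L -> L)),
        is_maximal_cstar A C j ->
        exists2 rho : F -> (L -> L),
          induces_cstar_iso s (gamma s) C rho &
          forall a, A a -> rho (jA a) = j a].
Proof.
have nN := ofp_norm hF; have iN := ofp_involution hF.
split; first exact: (gamma_bounds_neq0 nN iN).
  exact: (gamma_cstar_seminorm nN iN).
move=> L C j hC.
have [P [iA [iA' [k [afp [jAE jA'E] Nk kdense]]]]] := ofp_completion hF.
have [r [rl rr]] := free_product_rep hA afp hC.
exact: (exists_rho hF jAE jA'E Nk kdense rl rr).
Qed.
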